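(* Let $a\geq 3$ and let $\tau$ be a finite block of binary symbols of length $n$. There exists an increasing sequence of integers $k_j$, $j\geq1$, so that for the $B$-sequence $$\mathfrak{T}=\tau\,1\,1\,0^{k_1}\,1\,1\,0^{k_2}\,1\,1\,0^{k_3}\ldots,$$ its associated $A$-sequences $\mathfrak{T}^1$ and $\mathfrak{T}^2$ determine two distinct hairs $\gamma(\mathfrak{T}^1)$ and $\gamma(\mathfrak{T}^2)$ that limit upon themselves, thus becoming non-landing hairs.
   Context: Map: $f_a(z)=a(z-(1-a))\exp(z+a)$, with superattracting fixed point $-a$. Partition: the connected components of $f_a^{-1}(\mathbb{R}^+)$, $\mathbb{R}^+=(0,\infty)$, are the half-line $(1-a,+\infty)$ and, for each nonzero integer $j$, the graph of a strictly monotonic function $\zeta_j:\mathbb{R}\to\mathbb{R}$ (points $x+i\zeta_j(x)$) with $\lim_{x\to-\infty}\zeta_j(x)=\operatorname{sign}(j)(2|j|-1)\pi$ and $\lim_{x\to+\infty}\zeta_j(x)=2j\pi$. Inside the region bounded by the graphs of $\zeta_1$ and $\zeta_{-1}$, the preimage of $(-\infty,-a)$ consists of two curves, graphs of strictly monotonic functions $\eta_1,\eta_{-1}$ of $x>-a$, with $\lim_{x\to -a^+}\eta_{\pm1}(x)=0$ and $\lim_{x\to+\infty}\eta_{\pm1}(x)=\pm\pi$. $T_0$ is the open connected set containing $z=0$ bounded by $\eta_1\cup\eta_{-1}$ (together with $-a$); $T_1$ is the open connected set bounded by $\zeta_{-1}\cup\eta_{-1}\cup\eta_1\cup\zeta_1$.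 For $j=0,1$, $T_{j_1}$ and $T_{j_2}$ are the parts of $T_j$ with negative and positive imaginary part. $f_a$ is one-to-one on $T_0$ and on $T_1$; $g_a^{j_i}$ denotes the inverse branch of $f_a$ with values in $T_{j_i}$ (defined on the open upper or lower half-plane $f_a(T_{j_i})$). For $R>0$, $H_R=\{z\in T_0\cup T_1:\operatorname{Re}(z)\geq R\}$. Sequences: a $B$-sequence is an element of $\{0,1\}^{\mathbb{N}}$ (indices starting at 0). $\Sigma_A$, the set of $A$-sequences, consists of sequences with entries in $\{0_1,0_2,1_1,1_2\}$ having only the transitions $0_1\to 0_1,1_1$; $0_2\to 0_2,1_2$; $1_1\to 0_2,1_2$; $1_2\to 0_1,1_1$. Erasing subscripts gives a 2-to-1 map $\pi:\Sigma_A\to\{0,1\}^{\mathbb{N}}$; for a $B$-sequence $t$, its two associated $A$-sequences are denoted $t^1,t^2$ (they differ by interchanging all subscripts). $\sigma$ is the shift. $0^k$ is a block of $k$ zeros. Only sequences not ending in all zeros are considered. A point $z$ has itinerary $t\in\Sigma_A$ if $f_a^n(z)\in T_{t_n}$ for all $n\geq0$. Tails and hairs: for $R$ large enough and every $t\in\Sigma_A$ not ending in zeros, the tail $\omega_t=\omega_t(R)$ is the curve of all points with itinerary $t$ whose forward orbit lies in $H_R$; its points escape to $\infty$, and it extends to infinity to the right, meeting each line $\operatorname{Re}(z)=r$, $r\ge R$, in exactly one point. The hair associated to $t$ is $$\gamma(t)=\bigcup_{n=0}^\infty g_a^{t_0}\circ\cdots\circ g_a^{t_{n-1}}(\omega_{\sigma^n(t)}),$$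 an increasing union of curves, each extending its predecessor (the $n=0$ term being $\omega_t$). A ray is the image of $[0,+\infty)$ under a continuous one-to-one map; a final segment is the image of $[\alpha,+\infty)$, $\alpha>0$. A ray limits on itself if it is contained in the closure of every final segment of itself. Here $\gamma(t)$ is viewed as a ray starting at its end at $\infty$ (the right-hand end of its tail) and followed in the direction of the successive pullbacks, so its final segments are what remains after removing the portions of the curve toward $\infty$ along the tail end. A hair is non-landing if its accumulation set (of these final segments) is a non-trivial continuum. *)

(* Defs.v *)
From HB Require Import structures.
From mathcomp Require Import all_boot all_order all_algebra complex.
From mathcomp Require Import all_classical all_reals all_analysis.

Set Implicit Arguments.
Unset Strict Implicit.
Unset Printing Implicit Defensive.

Import Order.TTheory GRing.Theory Num.Theory numFieldNormedType.Exports.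

Local Open Scope classical_set_scope.
Local Open Scope complex_scope.
Local Open Scope ring_scope.

Inductive Asymbol : Type := A01 | A02 | A11 | A12.

Definition digit (s : Asymbol) : bool :=
  match s with A01 | A02 => false | A11 | A12 => true end.

Definition transition (s s' : Asymbol) : Prop :=
  match s, s' with
  | A01, (A01 | A11) => True
  | A02, (A02 | A12) => True
  | A11, (A02 | A12) => True
  | A12, (A01 | A11) => True
  | _, _ => False
  end.

Definition Asequence : set (nat -> Asymbol) :=
  [set t | forall n, transition (t n) (t n.+1)].

Definition erase (t : nat -> Asymbol) : nat -> bool := fun n => digit (t n).

Definition shift (T : Type) (n : nat) (t : nat -> T) : nat -> T :=
  fun i => t (n + i)%N.

(* tau 1 1 0^(k 1) 1 1 0^(k 2) ...; the value [k 0] is not used.  The first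
   [i.+1] blocks have total length at least [2 * i.+1], so they determine the
   [i]-th entry and the default of [nth] is never reached. *)
Definition Bword (tau : seq bool) (k : nat -> nat) (m : nat) : seq bool :=
  tau ++ flatten [seq [:: true; true] ++ nseq (k j) false | j <- iota 1 m].

Definition Bsequence (tau : seq bool) (k : nat -> nat) : nat -> bool :=
  fun i => nth false (Bword tau k i.+1) i.

Section Topology.
Variable X : topologicalType.

Definition boundary (U : set X) : set X := closure U `\` interior U.

Definition nontrivial_continuum (K : set X) : Prop :=
  [/\ compact K, connected K & exists x y, [/\ K x, K y & x <> y]].

Variables (R : realType) (h : R -> X).

Definition final_segment (alpha : R) : set X := h @` `[alpha, +oo[.

Definition limits_on_itself : Prop :=
  forall alpha, 0 < alpha -> h @` `[0, +oo[ `<=` closure (final_segment alpha).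

Definition accumulation_set : set X :=
  \bigcap_(alpha in `]0, +oo[) closure (final_segment alpha).

Definition non_landing : Prop := nontrivial_continuum accumulation_set.

End Topology.

Section Map.
Variable R : realType.

(* [R[i]^o] is the type [R[i]] with the topology of the modulus. *)
Local Notation C := (R[i]^o).
Local Notation Chat := (one_point_compactification C).
Local Notation Re := (@complex.Re R).
Local Notation Im := (@complex.Im R).

Definition cexp (z : C) : C :=
  (expR (Re z))%:C * (cos (Im z) +i* sin (Im z)).

Variable a : R.

Definition f (z : C) : C := a%:C * (z - (1 - a)%:C) * cexp (z + a%:C).

Definition graph (D : set R) (phi : R -> R) : set C :=
  [set (x +i* phi x : C) | x in D].

Definition strictly_monotonic (D : set R) (phi : R -> R) : Prop :=
  {in D &, {homo phi : x y / x < y}} \/ {in D &, {homo phi : x y / x < y >-> y < x}}.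

Definition preimage_Rpos : set C := f @^-1` (real_complex R @` `]0, +oo[).

Definition is_zeta (j : int) (phi : R -> R) : Prop :=
  [/\ exists2 z, preimage_Rpos z &
        graph setT phi = connected_component preimage_Rpos z,
      strictly_monotonic setT phi,
      phi x @[x --> -oo] --> (Num.sg j * (2 * `|j| - 1))%:~R * (pi : R) &
      phi x @[x --> +oo] --> (2 * j)%:~R * (pi : R)].

Definition zeta (j : int) : R -> R := xget (cst 0) [set phi | is_zeta j phi].

Definition zeta_region : set C :=
  [set z | zeta (- 1) (Re z) < Im z < zeta 1 (Re z)].

(* The pair (eta_1, eta_{-1}); only values at x > -a are meaningful. *)
Definition is_eta (phi : (R -> R) * (R -> R)) : Prop :=
  [/\ zeta_region `&` f @^-1` (real_complex R @` `]-oo, - a[) =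
        graph `]- a, +oo[ phi.1 `|` graph `]- a, +oo[ phi.2,
      strictly_monotonic `]- a, +oo[ phi.1 /\
        strictly_monotonic `]- a, +oo[ phi.2,
      phi.1 x @[x --> (- a)^'+] --> (0 : R) /\
        phi.2 x @[x --> (- a)^'+] --> (0 : R) &
      phi.1 x @[x --> +oo] --> (pi : R) /\
        phi.2 x @[x --> +oo] --> (- pi : R)].

Definition etas : (R -> R) * (R -> R) :=
  xget (cst 0, cst 0) [set phi | is_eta phi].

Definition eta_curves : set C :=
  graph `]- a, +oo[ etas.1 `|` graph `]- a, +oo[ etas.2 `|` [set (- a)%:C].

Definition zeta_curves : set C :=
  graph setT (zeta 1) `|` graph setT (zeta (- 1)).

Definition T0 : set C :=
  xget set0 [set U : set C |
    [/\ open U, connected U, U 0 & boundary U = eta_curves]].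

(* The curves eta_1 and eta_{-1} meet at their common endpoint -a, which hence
   also lies on the boundary of T1. *)
Definition T1 : set C :=
  xget set0 [set U : set C |
    [/\ open U, connected U & boundary U = zeta_curves `|` eta_curves]].

Definition Tpart (s : Asymbol) : set C :=
  match s with
  | A01 => T0 `&` [set z | Im z < 0]
  | A02 => T0 `&` [set z | 0 < Im z]
  | A11 => T1 `&` [set z | Im z < 0]
  | A12 => T1 `&` [set z | 0 < Im z]
  end.

(* The inverse branch g_a^s; it takes the junk value 0 outside f(T_s). *)
Definition branch (s : Asymbol) : C -> C := 'pinv_(fun=> 0) (Tpart s) f.

Definition itinerary (z : C) (t : nat -> Asymbol) : Prop :=
  forall n, Tpart (t n) (iter n f z).

Definition H (r : R) : set C := (T0 `|` T1) `&` [set z | r <= Re z].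

Definition tail (r : R) (t : nat -> Asymbol) : set C :=
  [set z | itinerary z t /\ forall n, H r (iter n f z)].

(* g^{t 0} o ... o g^{t (n - 1)} *)
Definition pullback (t : nat -> Asymbol) (n : nat) : C -> C :=
  foldr (fun s F => branch s \o F) id (mkseq t n).

Definition hair_piece (r : R) (t : nat -> Asymbol) (n : nat) : set C :=
  pullback t n @` tail r (shift n t).

Definition hair (r : R) (t : nat -> Asymbol) : set C :=
  \bigcup_n hair_piece r t n.

(* [h] exhibits the hair as a ray in the Riemann sphere starting at infinity
   ([None]).  The last clause fixes the direction: the initial portions of the
   ray are the successive pullbacks of tails. *)
Definition hair_ray (r : R) (t : nat -> Asymbol) (h : R -> Chat) : Prop :=
  [/\ {within `[0, +oo[, continuous h},
      {in `[0, +oo[ &, injective h},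
      h 0 = None,
      h @` `]0, +oo[ = Some @` hair r t &
      exists alpha : nat -> R,
        [/\ {homo alpha : m n / (m <= n)%N >-> m <= n},
            forall n, 0 < alpha n &
            forall n, h @` `]0, alpha n] = Some @` hair_piece r t n]].

Definition self_limiting_non_landing_hair
    (r : R) (t : nat -> Asymbol) : Prop :=
  exists h : R -> Chat,
    [/\ hair_ray r t h, limits_on_itself h & non_landing h].

End Map.

(* Main.v *)
Require Import Defs.
From mathcomp Require Import all_boot all_order all_algebra complex.
From mathcomp Require Import all_classical all_reals all_analysis.
From mathcomp Require Import ring lra zify.

Set Implicit Arguments.
Unset Strict Implicit.
Unset Printing Implicit Defensive.

Import Order.TTheory GRing.Theory Num.Theory numFieldNormedType.Exports.

Local Open Scope classical_set_scope.
Local Open Scope complex_scope.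
Local Open Scope ring_scope.

(** Why the theorem is true.

    Put u = Re z + a - 1 and y = Im z. Then f_a z = a e^(u+1) (P + i Q) with P = u cos
    y - y sin y and Q = u sin y + y cos y. The curves zeta and eta are pieces of the
    locus Q = 0, that is, graphs of inverses of the increasing function - y cot y, so
    the four parts of T_0 and T_1 are cut out by explicit inequalities ([TpartE]).
    Each part is mapped bijectively onto a half-plane ([reg_inj], [reg_surj]): in
    polar coordinates of the target the equation for y is that an increasing function
    takes a prescribed value.

    Far to the right f_a expands, and two points of one part whose images are again in
    one part have almost the same height. Hence two points with the same itinerary
    that stay far to the right cannot differ much more vertically than horizontally:
    such a vertical gap would double for ever ([cone_iter]), whereas all parts have
    bounded height. A tail is therefore a Lipschitz graph over a half-line; existence
    follows from finite approximations and compactness ([tail_param]). A hair is then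
    the set of points with the given itinerary whose orbit is eventually far to the
    right ([hairE]), and it is parametrised by an injective continuous map of the
    half-line ([hair_map_ray]).

    The heart of the matter is a U-turn that each block 1 1 0^k forces on the hair
    ([turn_point]). Let z be far to the right on the hair of a shifted sequence that
    starts with 1 1 0^k, with k huge. Consider the curve of points p that follow the
    symbols 1 1 0^k and then land on the tail of the remaining sequence, and look at
    the second iterate q of p. At its near end q lies to the left of the imaginary
    axis, because a start with nonnegative real part would be thrown beyond its
    prescribed end by the k zeros; further along, Re q exceeds 1. Where Re q = 0, the
    zeros, which multiply the distance to the real axis by an enormous factor, force q
    to be almost 0; as 0 is the asymptotic value of f_a, the image of p is extremely
    far to the left, and hence p lies to the right of z. Where Re q = 1, the image of
    p lies in a bounded region, and p is to the left of z. In between there is a point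
    p on the vertical line through z which is different from z, and whose orbit comes
    back from the far right before it escapes.

    Pulling p and z back along the earlier part of the orbit brings them together,
    since this part is expanding. So each point of the hair is a limit of points of
    the hair whose orbits are not yet far to the right at arbitrarily late times, that
    is, of points far along the hair ([dense_ends]). This is the first claim. It also
    shows that the accumulation set contains the whole hair; being a decreasing
    intersection of continua in the sphere it is a continuum
    ([connected_bigcap_nested], [self_limiting_of_dense_ends]).

    The block lengths only have to beat the escape of the orbit. The real part of the
    i-th iterate is at most an exponential tower of height i + J, where J depends on
    the point ([orbit_tower]), while k zeros produce a tower of height k. It suffices
    that the length of the j-th block of zeros exceeds its position by an unbounded
    amount, and 4^j (n + 20) does. *)

(** * The complex plane as a real plane *)

Section ComplexPlane.
Variable R : realType.
Local Notation C := (R[i]^o).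
Local Notation Re := (@complex.Re R).
Local Notation Im := (@complex.Im R).

Lemma sqr_normr (x : R) : `|x| ^+ 2 = x ^+ 2.
Proof. by rewrite real_normK ?num_real. Qed.

Lemma ReImE (z : C) : z = (Re z +i* Im z : C).
Proof. by case: z. Qed.

(** The topology of the modulus is the product topology; all later limits in the plane
    go through this box form. *)
Lemma nbhsCP (z : C) (A : set C) :
  nbhs z A <-> exists2 e : R, 0 < e &
    forall x y, `|x - Re z| < e -> `|y - Im z| < e -> A (x +i* y : C).
Proof.
split=> [/nbhs_ballP[e /= e0 eA]|[e e0 eA]].
  move: e0; rewrite ltcE /= => /andP[/eqP Ie Re0].
  exists (Re e / 2) => [|x y xe ye]; first by lra.
  apply: eA; rewrite /ball/= /ball_ normc_def ltcE/= Ie eqxx/=.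
  have xe' : (Re z - x) ^+ 2 < (Re e / 2) ^+ 2.
    by rewrite -sqr_normr distrC ltr_pXn2r// nnegrE; lra.
  have ye' : (Im z - y) ^+ 2 < (Re e / 2) ^+ 2.
    by rewrite -sqr_normr distrC ltr_pXn2r// nnegrE; lra.
  case: z {xe ye} xe' ye' => zx zy /= xe' ye'.
  rewrite -[ltRHS]ger0_norm; last by lra.
  rewrite -[ltRHS]sqrtr_sqr ltr_sqrt; last by nra.
  by nra.
apply/nbhs_ballP; exists e%:C => /=; first by rewrite ltcR.
case=> x y; rewrite /ball/= /ball_ normc_def ltcR.
case: z eA => zx zy /= eA h.
have h2 : (zx - x) ^+ 2 + (zy - y) ^+ 2 < e ^+ 2.
  move: h; rewrite -[X in _ < X -> _]ger0_norm; last by lra.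
  by rewrite -sqrtr_sqr ltr_sqrt//; nra.
apply: eA; rewrite distrC -(ltr_pXn2r (n:=2))// ?nnegrE ?(ltW e0)// sqr_normr.
  by have := sqr_ge0 (zy - y); lra.
by have := sqr_ge0 (zx - x); lra.
Qed.

Lemma continuous_Re : continuous (Re : C -> R).
Proof.
move=> z A /nbhs_ballP[e /= e0 eA]; apply/nbhsCP; exists e => // x y xe _.
by apply: eA; rewrite /ball/= distrC.
Qed.

Lemma continuous_Im : continuous (Im : C -> R).
Proof.
move=> z A /nbhs_ballP[e /= e0 eA]; apply/nbhsCP; exists e => // x y _ ye.
by apply: eA; rewrite /ball/= distrC.
Qed.

Lemma cvgC (T : Type) (F : set_system T) (FF : Filter F) (f g : T -> R) x y :
  f @ F --> x -> g @ F --> y ->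
  (fun t => (f t +i* g t : C)) @ F --> (x +i* y : C).
Proof.
move=> fx gy A /nbhsCP[e e0 eA].
move/cvgrPdist_lt: fx => /(_ _ e0) fx; move/cvgrPdist_lt: gy => /(_ _ e0) gy.
by apply: filterS2 fx gy => t tx ty; apply: eA; rewrite distrC.
Qed.

Lemma continuousC_comp (T : topologicalType) (f g : T -> R) t :
  continuous_at t f -> continuous_at t g ->
  continuous_at t (fun t => (f t +i* g t : C)).
Proof. by move=> cf cg; apply: cvgC. Qed.

Lemma hausdorffC : hausdorff_space C.
Proof. exact: norm_hausdorff. Qed.

Definition box (x1 x2 y1 y2 : R) : set C :=
  [set z | x1 <= Re z <= x2 /\ y1 <= Im z <= y2].

Lemma compact_box x1 x2 y1 y2 : compact (box x1 x2 y1 y2).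
Proof.
have -> : box x1 x2 y1 y2 =
    (fun p : R * R => (p.1 +i* p.2 : C)) @` (`[x1, x2] `*` `[y1, y2]).
  apply/seteqP; split=> [[x y] /= [h1 h2]|z [[x y]] /= [h1 h2] <-].
    by exists (x, y); rewrite //= !in_itv/= h1 h2.
  by move: h1 h2; rewrite /= !in_itv/=.
apply: continuous_compact; last by apply: compact_setX; exact: segment_compact.
apply: continuous_subspaceT => p; apply: cvgC.
  exact: cvg_fst.
exact: cvg_snd.
Qed.

Lemma locally_compactC : locally_compact [set: C].
Proof.
move=> z _; exists (box (Re z - 1) (Re z + 1) (Im z - 1) (Im z + 1)).
  apply: (@filterS _ (nbhs z) _ (box (Re z - 1) (Re z + 1) (Im z - 1) (Im z + 1))).
    by move=> t tb _.
  apply/nbhsCP; exists 1 => // x y.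
  by rewrite /box/= !ltr_norml => xe ye; split; lra.
split=> //; first exact: compact_box.
by apply: compact_closed; [exact: hausdorffC|exact: compact_box].
Qed.

(** The norm of R[i] takes values in R[i]; this is the modulus as a real number, so that
    it can be compared with other reals. *)
Definition absC (z : C) : R := Num.sqrt ((Re z) ^+ 2 + (Im z) ^+ 2).

Lemma absCM (z w : C) : absC (z * w) = absC z * absC w.
Proof.
rewrite /absC -sqrtrM ?addr_ge0 ?sqr_ge0//; case: z => x y; case: w => u v /=.
by congr Num.sqrt; ring.
Qed.

Lemma absC_ge0 z : 0 <= absC z. Proof. exact: sqrtr_ge0. Qed.

Lemma absC_sq z : (absC z) ^+ 2 = (Re z) ^+ 2 + (Im z) ^+ 2.
Proof. by rewrite sqr_sqrtr// addr_ge0 ?sqr_ge0. Qed.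

Lemma absCN z : absC (- z) = absC z.
Proof. by case: z => x y; rewrite /absC/= !sqrrN. Qed.

Lemma absC_le z c : 0 <= c -> (Re z) ^+ 2 + (Im z) ^+ 2 <= c ^+ 2 -> absC z <= c.
Proof. by move=> c0 h; rewrite -(ler_pXn2r (n:=2))// ?nnegrE ?absC_ge0// absC_sq. Qed.

Lemma absC_ge z c : 0 <= c -> c ^+ 2 <= (Re z) ^+ 2 + (Im z) ^+ 2 -> c <= absC z.
Proof. by move=> c0 h; rewrite -(ler_pXn2r (n:=2))// ?nnegrE ?absC_ge0// absC_sq. Qed.

Lemma normRe_le_absC z : `|Re z| <= absC z.
Proof.
by apply: absC_ge => //; rewrite sqr_normr; have := sqr_ge0 (Im z); lra.
Qed.

Lemma normIm_le_absC z : `|Im z| <= absC z.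
Proof.
by apply: absC_ge => //; rewrite sqr_normr; have := sqr_ge0 (Re z); lra.
Qed.

Lemma absC_le_add z : absC z <= `|Re z| + `|Im z|.
Proof.
apply: absC_le; first by rewrite addr_ge0.
rewrite -(sqr_normr (Re z)) -(sqr_normr (Im z)).
by have := normr_ge0 (Re z); have := normr_ge0 (Im z); nra.
Qed.

Lemma absC_triangle z w : absC (z + w) <= absC z + absC w.
Proof.
apply: absC_le; first by rewrite addr_ge0 ?absC_ge0.
have := absC_sq z; have := absC_sq w; have := absC_ge0 z; have := absC_ge0 w.
case: z => x y; case: w => u v /=.
set p := absC _; set q := absC _ => p0 q0 hp hq.
have h : (x * u + y * v) ^+ 2 <= (p * q) ^+ 2.
  rewrite exprMn hp hq; have := sqr_ge0 (x * v - y * u); nra.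
have : x * u + y * v <= p * q.
  have : `|x * u + y * v| <= p * q.
    rewrite -(ler_pXn2r (n:=2))// ?nnegrE ?mulr_ge0//.
    by rewrite sqr_normr.
  by move/(le_trans (ler_norm _)).
nra.
Qed.

Lemma absC_dist z w : absC z - absC w <= absC (z - w).
Proof. by have := absC_triangle (z - w) w; rewrite subrK; lra. Qed.

Lemma absC_distC z w : absC (z - w) = absC (w - z).
Proof. by rewrite -absCN opprB. Qed.

Lemma absCR (x : R) : absC (x%:C : C) = `|x|.
Proof. by rewrite /absC/= expr0n addr0 sqrtr_sqr. Qed.

Lemma ReB (z w : C) : Re (z - w) = Re z - Re w.
Proof. by case: z; case: w. Qed.
Lemma ImB (z w : C) : Im (z - w) = Im z - Im w.
Proof. by case: z; case: w. Qed.
Lemma ReD (z w : C) : Re (z + w) = Re z + Re w.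
Proof. by case: z; case: w. Qed.
Lemma nbhs_absC (z : C) (A : set C) :
  nbhs z A -> exists2 e : R, 0 < e & forall w, absC (w - z) < e -> A w.
Proof.
move=> /nbhsCP[e e0 eA]; exists e => // w we; rewrite (ReImE w); apply: eA.
  by rewrite -ReB (le_lt_trans (normRe_le_absC _)).
by rewrite -ImB (le_lt_trans (normIm_le_absC _)).
Qed.

Lemma nbhs_absC_lt (z : C) (e : R) : 0 < e -> nbhs z [set w | absC (w - z) < e].
Proof.
move=> e0; apply/nbhsCP; exists (e / 2); first by lra.
move=> x y xe ye /=; apply: le_lt_trans (absC_le_add _) _.
by rewrite ReB ImB /=; lra.
Qed.

End ComplexPlane.

(** * Elementary real inequalities and the polar equation *)

Section RealFacts.
Variable R : realType.
Implicit Types x y u v A B : R.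
Local Notation pi := (@pi R).

Lemma increasing_of_derive (F dF : R -> R) x y : x < y ->
  (forall z, x <= z <= y -> is_derive z 1 F (dF z)) ->
  (forall z, x < z < y -> 0 < dF z) -> F x < F y.
Proof.
move=> xy hF pF.
have [c||c] := @MVT R F dF x y xy.
- by rewrite in_itv/= => /andP[h1 h2]; apply: hF; rewrite !ltW.
- apply: derivable_within_continuous => z; rewrite in_itv/= => /hF h.
  exact: ex_derive.
- rewrite in_itv/= => /pF h e; rewrite -subr_gt0 e mulr_gt0// subr_gt0//.
Qed.

Lemma pi_lt4 : pi < 4. Proof. by have := @pihalf_lt2 R; lra. Qed.

Lemma cos_lt0 y : pi / 2 < y -> y <= pi -> cos y < 0.
Proof.
move=> h1 h2; rewrite -(cos_pihalf R) ltr_cos// in_itv/=; have := @pi_gt0 R; lra.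
Qed.

Lemma sin_gt0 y : 0 < y -> y < pi -> 0 < sin y.
Proof. by move=> h1 h2; apply: sin_gt0_pi; rewrite h1. Qed.

Lemma sin_2pi_sub v : sin (2 * pi - v) = - sin v.
Proof. by rewrite mulr_natl sinB sin2pi cos2pi mul0r mul1r sub0r. Qed.

Lemma cos_2pi_sub v : cos (2 * pi - v) = cos v.
Proof. by rewrite mulr_natl cosB sin2pi cos2pi mul0r mul1r addr0. Qed.

Lemma sin_lt0 y : pi < y -> y < 2 * pi -> sin y < 0.
Proof.
move=> h1 h2; have -> : y = 2 * pi - (2 * pi - y) by ring.
by rewrite sin_2pi_sub oppr_lt0; apply: sin_gt0; lra.
Qed.

Lemma sin_lt_id y : 0 < y -> sin y < y.
Proof.
move=> y0; rewrite -subr_gt0.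
have [y1|y1] := leP y 2; last by have := @sin_le1 R y; lra.
have -> : 0 = 0 - sin 0 :> R by rewrite sin0 subr0.
apply: (@increasing_of_derive (fun z => z - sin z) (fun z => 1 - cos z)) => // z h.
have := @cos_lt0 z; have := @ltr_cos R 0 z; rewrite !in_itv/= cos0.
by have := @pi_ge2 R; rewrite subr_gt0 => h1 ->//; lra.
Qed.

Lemma ycos_lt_sin y : 0 < y -> y <= pi -> y * cos y < sin y.
Proof.
move=> y0 y1; rewrite -subr_gt0.
have -> : 0 = sin 0 - 0 * cos 0 :> R by rewrite sin0 mul0r subr0.
apply: (@increasing_of_derive (fun z => sin z - z * cos z) (fun z => z * sin z)) => // z h.
  by apply: is_derive_eq; rewrite /GRing.scale/=; ring.
by apply: mulr_gt0; [lra|apply: sin_gt0; lra].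
Qed.

Lemma sin_ge_quarter v : 0 <= v -> v <= pi / 2 -> v / 4 <= sin v.
Proof.
move=> v0 v1; have [->|v2] := eqVneq v 0; first by rewrite sin0 mul0r.
have vp : 0 < v by rewrite lt_neqAle eq_sym v2.
have h := @ycos_lt_sin v vp; have := @pi_lt4; have := @cos_ge0_pihalf R v.
have h2 := @cos2Dsin2 R v.
have s0 : 0 < sin v by apply: sin_gt0 => //; have := @pi_gt0 R; lra.
have := @pi_gt0 R.
have [c|c] := leP (1 / 4) (cos v) => pi0 c0 p4.
  have : v * (1 / 4) <= v * cos v by rewrite ler_pM2l.
  by have {}h : v * cos v < sin v; [apply: h; lra|lra].
have {}c0 : 0 <= cos v by apply: c0; lra.
suff : 1 / 2 <= sin v by lra.
by nra.
Qed.

Lemma one_sub_cos v : 1 - cos v <= v ^+ 2 / 2.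
Proof.
wlog v0 : v / 0 <= v => [hw|].
  have [|h] := leP 0 v; first exact: hw.
  by rewrite -cosN -sqrrN; apply: hw; lra.
have -> : cos v = cos ((v / 2) *+ 2) by congr cos; rewrite mulr2n; field.
rewrite cos_mulr2n cos2sin2.
have : `|sin (v / 2)| ^+ 2 <= (v / 2) ^+ 2.
  rewrite lerXn2r ?nnegrE//; first by lra.
  have [->|v2] := eqVneq v 0; first by rewrite mul0r sin0 normr0.
  have vp : 0 < v by rewrite lt_neqAle eq_sym v2.
  have [h|h] := leP (v / 2) pi; last first.
    by have := @sin_max R (v / 2); have := @pi_ge2 R; lra.
  rewrite ger0_norm; first by apply: ltW; apply: sin_lt_id; lra.
  by apply: sin_ge0_pi; lra.
rewrite sqr_normr => h; rewrite -mulr_natl; lra.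
Qed.

(** A crude quadratic remainder: together with [expR_near] and [one_sub_cos] it controls
    e^D - 1 - D for complex D. *)
Lemma sin_near v : `|v| <= 1 -> `|sin v - v| <= v ^+ 2.
Proof.
wlog v0 : v / 0 <= v => [hw|].
  have [|h] := leP 0 v; first exact: hw.
  move=> v1; have := hw (- v); rewrite sinN sqrrN normrN.
  have -> : - sin v - - v = - (sin v - v) by ring.
  by rewrite normrN; apply=> //; lra.
move=> v1; have {}v1 : v <= 1 by move: v1; rewrite ger0_norm.
have [->|v2] := eqVneq v 0; first by rewrite sin0 subr0 normr0 expr0n.
have vp : 0 < v by rewrite lt_neqAle eq_sym v2.
have h1 := @sin_lt_id v vp; have h2 := @ycos_lt_sin v vp.
have h3 := one_sub_cos v; have := @pi_ge2 R => p2.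
have {}h2 : v * cos v < sin v by apply: h2; lra.
by rewrite distrC ger0_norm; nra.
Qed.

Lemma expR_near A : `|A| <= 1 / 2 -> `|expR A - 1 - A| <= 2 * A ^+ 2.
Proof.
rewrite ler_norml => hA.
have h1 := expR_ge1Dx A; have h2 := expR_ge1Dx (- A).
have h3 : expR A * expR (- A) = 1 by rewrite -expRD subrr expR0.
have h4 := expR_gt0 A.
rewrite ger0_norm; last by lra.
have h5 : expR A * (1 - A) <= 1 by rewrite -h3; apply: ler_wpM2l; lra.
have h6 : 1 <= (1 + A + 2 * A ^+ 2) * (1 - A) by nra.
have h7 : expR A * (1 - A) <= (1 + A + 2 * A ^+ 2) * (1 - A) by lra.
by move: h7; rewrite ler_pM2r; lra.
Qed.

Lemma expR1_ge2 : 2 <= expR 1 :> R.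
Proof. by have := expR_ge1Dx (1 : R); lra. Qed.

Lemma is_derive_inv (F : R -> R) x (df : R) : F x != 0 -> is_derive x 1 F df ->
  is_derive x 1 (fun z => (F z)^-1) (- (F x) ^- 2 * df).
Proof.
move=> Fx [hd <-]; apply: DeriveDef; first exact: derivableV.
by rewrite deriveV.
Qed.

Section Polar.
Variable b : R.

(** If a e^(u+1) (u + iy) e^(iy) has argument b, then the argument of u + iy is b - y
    modulo 2 pi. These are the heights y > 0 for which b - y can be taken in ]0, pi[. *)
Definition polar_dom : set R := [set y | [/\ 0 < y, y < b & b - pi < y]].

(** When u + iy has argument b - y, its modulus is y / sin (b - y) and u = y cot (b -
    y); this is the logarithm of the modulus of (u + iy) e^u as a function of y alone. *)
Definition polar_log (y : R) : R :=
  ln y - ln (sin (b - y)) + y * (cos (b - y) * (sin (b - y))^-1).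

Lemma polar_sin y : polar_dom y -> 0 < sin (b - y).
Proof. by case=> h1 h2 h3; apply: sin_gt0; lra. Qed.

Lemma is_derive_sub y : is_derive y 1 (fun z : R => b - z) (-1).
Proof. by have := @is_deriveB R R R (cst b) id y 1 _ _ (is_derive_cst _ _ _) (is_derive_id y 1); rewrite sub0r. Qed.

Lemma is_derive_sin_sub y : is_derive y 1 (fun z : R => sin (b - z)) (- cos (b - y)).
Proof.
have h := is_derive_sub y; have := @is_derive1_comp R sin _ y _ _ (is_derive_sin _) h.
by rewrite mulrN1.
Qed.

Lemma is_derive_cos_sub y : is_derive y 1 (fun z : R => cos (b - z)) (sin (b - y)).
Proof.
have h := is_derive_sub y; have := @is_derive1_comp R cos _ y _ _ (is_derive_cos _) h.
by rewrite mulrNN mulr1.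
Qed.

Lemma is_derive_polar y : polar_dom y ->
  is_derive y 1 polar_log (y^-1 + cos (b - y) / sin (b - y) +
    (cos (b - y) / sin (b - y) + y * (1 + (cos (b - y) / sin (b - y)) ^+ 2))).
Proof.
move=> yd; have s0 := polar_sin yd; case: (yd) => y0 _ _.
have h1 := is_derive1_ln y0.
have hs := is_derive_sin_sub y.
have hc := is_derive_cos_sub y.
have h2 := @is_derive1_comp R (@ln R) _ y _ _ (is_derive1_ln s0) hs.
have h3 := @is_derive_inv (fun z => sin (b - z)) y _ (lt0r_neq0 s0) hs.
have h4 := @is_deriveM R R _ _ y 1 _ _ hc h3.
have h5 := @is_deriveM R R _ _ y 1 _ _ (is_derive_id y 1) h4.
have h6 := @is_deriveD R R R _ _ y 1 _ _ (@is_deriveB R R R _ _ y 1 _ _ h1 h2) h5.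
apply: (is_derive_eq h6) => /=.
set s := sin _ in s0 *; set c := cos _.
change (y^-1 - s^-1 * - c + (y * (c * (- s ^- 2 * - c) + s^-1 * s) + (c * s^-1) * 1) =
  y^-1 + c / s + (c / s + y * (1 + (c / s) ^+ 2))).
field.
by rewrite !gt_eqF.
Qed.

Lemma polar_domW y y' z : polar_dom y -> polar_dom y' -> y <= z <= y' -> polar_dom z.
Proof. by move=> [h1 h2 h3] [k1 k2 k3] /andP[l1 l2]; split; lra. Qed.

(** After multiplication by y, the derivative is the sum of two squares (1 + y cot (b -
    y))^2 + y^2. *)
Lemma polar_mono y y' : polar_dom y -> polar_dom y' -> y < y' ->
  polar_log y < polar_log y'.
Proof.
move=> yd yd' yy'.
apply: (@increasing_of_derive polar_log (fun y => y^-1 + cos (b - y) / sin (b - y) +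
    (cos (b - y) / sin (b - y) + y * (1 + (cos (b - y) / sin (b - y)) ^+ 2)))) => // z h.
  by apply: is_derive_polar; apply: polar_domW yd yd' h.
have [z0 _ _] : polar_dom z by apply: polar_domW yd yd' _; lra.
set k := cos _ / _.
rewrite -(pmulr_rgt0 _ z0).
have -> : z * (z^-1 + k + (k + z * (1 + k ^+ 2))) = (1 + z * k) ^+ 2 + z ^+ 2.
  by field; rewrite gt_eqF.
by have := sqr_ge0 (1 + z * k); have := exprn_gt0 2 z0; lra.
Qed.

Lemma polar_cont y : polar_dom y -> {for y, continuous polar_log}.
Proof.
move=> /is_derive_polar h; apply: differentiable_continuous.
by apply/derivable1_diffP; exact: ex_derive.
Qed.

End Polar.
End RealFacts.

(** * The map is bijective on explicit half strips *)

Section RegionReal.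
Variable R : realType.
Implicit Types x y u v b L X Y r : R.
Local Notation pi := (@pi R).

(** As y tends to b the term - ln (sin (b - y)) tends to infinity. *)
Lemma polar_log_high b L : 0 < b -> exists2 y, polar_dom b y & L <= polar_log b y.
Proof.
move=> b0; pose p := Num.min 1 (b / 2 * Num.min 1 (expR (- L))).
have m0 : 0 < Num.min 1 (expR (- L)) by rewrite lt_min ltr01 expR_gt0.
have p0 : 0 < p by rewrite lt_min ltr01 mulr_gt0//; lra.
have p1 : p <= 1 by rewrite ge_min lexx.
have p2 : p <= b / 2 * Num.min 1 (expR (- L)) by rewrite ge_min lexx orbT.
have p3 : p <= b / 2.
  by apply: le_trans p2 _; rewrite -[leRHS]mulr1 ler_pM2l ?ge_min ?lexx//; lra.
have p4 : p <= b / 2 * expR (- L).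
  by apply: le_trans p2 _; rewrite ler_pM2l ?ge_min ?lexx ?orbT//; lra.
have pi2 := @pi_ge2 R.
exists (b - p); first by split; lra.
have s0 : 0 < sin p by apply: sin_gt0; lra.
have c0 : 0 <= cos p by apply: cos_ge0_pihalf; lra.
rewrite /polar_log (_ : b - (b - p) = p); last by ring.
have h1 : ln (sin p) <= ln p by rewrite ler_ln ?posrE//; exact/ltW/sin_lt_id.
have h2 : ln (b / 2) <= ln (b - p) by rewrite ler_ln ?posrE//; lra.
have h3 : ln p <= ln (b / 2) - L.
  have -> : ln (b / 2) - L = ln (b / 2 * expR (- L)).
    by rewrite (@lnM _ (b / 2) (expR (- L))) ?posrE ?expR_gt0 ?expRK//; lra.
  by rewrite ler_ln ?posrE// mulr_gt0 ?expR_gt0//; lra.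
have : 0 <= (b - p) * (cos p / sin p).
  by rewrite mulr_ge0 ?divr_ge0 ?(ltW s0)//; lra.
by lra.
Qed.

(** For b < pi the variable y may tend to 0, and ln y tends to minus infinity. *)
Lemma polar_log_low_small b L : 0 < b -> b < pi ->
  exists2 y, polar_dom b y & polar_log b y <= L.
Proof.
move=> b0 bpi.
pose F y := - ln (sin (b - y)) + y * (cos (b - y) * (sin (b - y))^-1).
have s0 : 0 < sin (b - 0) by rewrite subr0; exact: sin_gt0.
have cF : {for 0, continuous F}.
  have cs : {for (0:R), continuous (fun y => sin (b - y))}.
    apply: (@continuous_comp _ _ _ (fun y : R => b - y) sin); last exact: continuous_sin.
    by apply: cvgB; [exact: cvg_cst|exact: cvg_id].
  have cc : {for (0:R), continuous (fun y => cos (b - y))}.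
    apply: (@continuous_comp _ _ _ (fun y : R => b - y) cos); last exact: continuous_cos.
    by apply: cvgB; [exact: cvg_cst|exact: cvg_id].
  apply: cvgD.
    apply: cvgN; apply: (@continuous_comp _ _ _ (fun y : R => sin (b - y)) (@ln R)) => //.
    exact: continuous_ln.
  apply: cvgM; first exact: cvg_id.
  by apply: cvgM => //; apply: cvgV => //; rewrite gt_eqF.
have /nbhs_ballP[e /= e0 he] : nbhs (0:R) [set y | F y < F 0 + 1].
  by move/cvgr_lt : cF; apply; lra.
pose y := Num.min (e / 2) (Num.min (b / 2) (expR (L - F 0 - 1))).
have y0 : 0 < y by rewrite !lt_min expR_gt0; lra.
have y1 : y <= e / 2 by rewrite ge_min lexx.
have y2 : y <= b / 2 by rewrite !ge_min lexx !orbT.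
have y3 : y <= expR (L - F 0 - 1) by rewrite !ge_min lexx !orbT.
exists y; first by split; lra.
have : F y < F 0 + 1 by apply: he; rewrite /ball/= sub0r normrN gtr0_norm//; lra.
have : ln y <= L - F 0 - 1.
  by rewrite -[leRHS]expRK ler_ln ?posrE ?expR_gt0.
by rewrite /polar_log /F; lra.
Qed.

(** For b > pi the lower end of the domain is b - pi, where the cotangent term tends to
    minus infinity like - 1 / sin and wins against the logarithm. *)
Lemma polar_log_low_big b L : pi < b -> b < 2 * pi ->
  exists2 y, polar_dom b y & polar_log b y <= L.
Proof.
move=> b0 bpi; have pi2 := @pi_ge2 R.
pose d := b - pi; have d0 : 0 < d by rewrite subr_gt0.
have d4 : 0 < d / 4 by lra.
pose K := ln (d + 1) - ln (d / 4) - L.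
have K0 := normr_ge0 K.
pose e := Num.min 1 (d / 4 / (`|K| + 1)).
have e0 : 0 < e by rewrite lt_min ltr01 !divr_gt0//; lra.
have e1 : e <= 1 by rewrite ge_min lexx.
have e2 : e <= d / 4 / (`|K| + 1) by rewrite ge_min lexx orbT.
exists (d + e); first by split; rewrite /d; lra.
have s0 : 0 < sin e by apply: sin_gt0; lra.
have s1 : sin e <= e by exact/ltW/sin_lt_id.
have c0 : 1 / 2 <= cos e by have := one_sub_cos e; nra.
rewrite /polar_log (_ : b - (d + e) = pi - e); last by rewrite /d; ring.
rewrite sinB cosB sinpi cospi !mul0r !mulN1r sub0r opprK addr0.
pose t := (sin e)^-1; have t0 : 0 < t by rewrite invr_gt0.
have -> : ln (sin e) = - ln t by rewrite lnV ?posrE// opprK.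
have h1 : ln t <= t * (d / 4) - ln (d / 4).
  have := @ln_sublinear R (t * (d / 4)) (mulr_gt0 t0 d4).
  by rewrite (@lnM _ t (d / 4)) ?posrE//; lra.
have h2 : ln (d + e) <= ln (d + 1) by rewrite ler_ln ?posrE; lra.
have h3 : `|K| + 1 <= t * (d / 4).
  have : e * (`|K| + 1) <= d / 4 by rewrite -ler_pdivlMr//; lra.
  move=> h; rewrite /t mulrC ler_pdivlMr//.
  by apply: le_trans h; rewrite mulrC ler_pM2r//; lra.
have h4 : K <= `|K| := ler_norm _.
rewrite -/t mulNr mulrN opprK.
have : d * (1 / 2) * t <= (d + e) * cos e * t.
  by rewrite ler_pM2r//; apply: ler_pM; lra.
rewrite -mulrA.
rewrite /K in h3 h4; lra.
Qed.

Lemma polar_surj b L : 0 < b -> b < 2 * pi -> b != pi ->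
  exists2 y, polar_dom b y & polar_log b y = L.
Proof.
move=> b0 b1 bpi; have [y2 d2 h2] := polar_log_high L b0.
have [y1 d1 h1] : exists2 y, polar_dom b y & polar_log b y <= L.
  have [h|h] := ltP b pi; first exact: polar_log_low_small.
  by apply: polar_log_low_big => //; rewrite lt_neqAle eq_sym bpi.
have y12 : y1 <= y2.
  rewrite leNgt; apply/negP => /(polar_mono d2 d1); lra.
have [||y] := @IVT R (polar_log b) y1 y2 L y12.
- apply: continuous_in_subspaceT => y; rewrite inE/= in_itv/= => h.
  by apply: polar_cont; apply: polar_domW d1 d2 h.
- by rewrite ge_min le_max h1 h2 orbT.
- by rewrite in_itv/= => h e; exists y => //; apply: polar_domW d1 d2 h.
Qed.

(** Up to the positive factor a e^(u+1), these are the real and imaginary parts of f_a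
    at the point with Re z + a - 1 = u and Im z = y. *)
Definition Pf u y := u * cos y - y * sin y.
Definition Qf u y := u * sin y + y * cos y.

(** The upper halves of T_0 (d = 0) and T_1 (d = 1) in the coordinates u and y. *)
Definition reg (d : bool) u y : Prop :=
  if d then [/\ 0 < y, y < 2 * pi & Qf u y < 0] else [/\ 0 < y, y < pi & 0 < Qf u y].

Definition arg_dom (d : bool) b :=
  if d then pi < b /\ b < 2 * pi else 0 < b /\ b < pi.

Lemma arg_exists d X Y : (if d then Y < 0 else 0 < Y) ->
  exists b r, [/\ arg_dom d b, 0 < r, X = r * cos b & Y = r * sin b].
Proof.
have up X' Y' : 0 < Y' ->
    exists b r, [/\ arg_dom false b, 0 < r, X' = r * cos b & Y' = r * sin b].
  move=> Y0; pose r := Num.sqrt (X' ^+ 2 + Y' ^+ 2).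
  have s0 : 0 < X' ^+ 2 + Y' ^+ 2.
    by have := sqr_ge0 X'; have := exprn_gt0 2 Y0; lra.
  have r0 : 0 < r by rewrite sqrtr_gt0.
  have r2 : r ^+ 2 = X' ^+ 2 + Y' ^+ 2 by rewrite sqr_sqrtr// ltW.
  have q2 : (X' / r) ^+ 2 < 1.
    rewrite exprMn exprVn ltr_pdivrMr ?exprn_gt0// mul1r r2.
    by have := exprn_gt0 2 Y0; lra.
  have hq : -1 < X' / r < 1.
    by apply/andP; split; nra.
  have [h1 h2] := andP hq.
  exists (acos (X' / r)), r; split => //.
  - by split; [apply: acos_gt0|apply: acos_ltpi]; lra.
  - by rewrite acosK ?in_itv/= ?(ltW h1) ?(ltW h2)// mulrC divfK// gt_eqF.
  - rewrite sin_acos ?(ltW h1) ?(ltW h2)//.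
    have -> : 1 - (X' / r) ^+ 2 = (Y' / r) ^+ 2.
      by rewrite !exprMn !exprVn -[1](@mulfV _ (r ^+ 2)) ?expf_neq0 ?gt_eqF// {1}r2; ring.
    by rewrite sqrtr_sqr gtr0_norm ?divr_gt0// mulrC divfK// gt_eqF.
case: d => // Y0; last exact: up.
have [|b [r [[b0 b1] r0 hX hY]]] := up X (- Y); first by rewrite oppr_gt0.
exists (2 * pi - b), r; split => //.
- by split; lra.
- by rewrite cos_2pi_sub.
- by rewrite sin_2pi_sub mulrN -hY opprK.
Qed.

(** Rotating the target by - y recovers u + iy up to the factor e^u, and this pins b - y
    down in ]0, pi[, so that u is a function of y, and y solves the polar equation. *)
Lemma reg_polar d u y b r : arg_dom d b -> 0 < r -> reg d u y ->
  expR u * Pf u y = r * cos b -> expR u * Qf u y = r * sin b ->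
  [/\ polar_dom b y, polar_log b y = ln r & u = y * (cos (b - y) * (sin (b - y))^-1)].
Proof.
move=> db r0 ry hP hQ; have e0 := expR_gt0 u.
have hu : expR u * u = r * cos (b - y).
  rewrite cosB mulrDr !mulrA -hP -hQ /Pf /Qf.
  have := cos2Dsin2 y => h.
  transitivity (expR u * (u * (cos y ^+ 2 + sin y ^+ 2))); last by ring.
  by rewrite h mulr1.
have hy : expR u * y = r * sin (b - y).
  rewrite sinB mulrBr !mulrA -hP -hQ /Pf /Qf.
  have := cos2Dsin2 y => h.
  transitivity (expR u * (y * (cos y ^+ 2 + sin y ^+ 2))); last by ring.
  by rewrite h mulr1.
have pi0 := @pi_gt0 R.
have y0 : 0 < y by case: d ry {db} => -[].
have s0 : 0 < sin (b - y).
  by rewrite -(pmulr_rgt0 _ r0) -hy mulr_gt0.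
have bh : - pi < b - y < 2 * pi by case: d ry db => -[h1 h2 h3] [h4 h5]; lra.
have b1 : 0 < b - y.
  rewrite ltNge; apply/negP => h; have : sin (y - b) >= 0.
    by apply: sin_ge0_pi; lra.
  by rewrite -opprB sinN; lra.
have b2 : b - y < pi.
  rewrite ltNge le_eqVlt; apply/negP => /orP[/eqP h|h].
    by move: s0; rewrite -h sinpi ltxx.
  by have := @sin_lt0 R (b - y); lra.
have hyr : y = r * (expR u)^-1 * sin (b - y).
  by rewrite mulrAC -hy mulrAC mulfV ?mul1r// gt_eqF.
have hur : u = r * (expR u)^-1 * cos (b - y).
  by rewrite mulrAC -hu mulrAC mulfV ?mul1r// gt_eqF.
have hu2 : u = y * (cos (b - y) * (sin (b - y))^-1).
  move: hyr hur s0; set s := sin (b - y); set c := cos (b - y) => hyr hur s0.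
  have -> : y * (c * s^-1) = r * (expR u)^-1 * c by rewrite {1}hyr; field; rewrite !gt_eqF.
  exact: hur.
split => //; first by split; lra.
rewrite /polar_log -hu2.
have -> : ln y = ln r - u + ln (sin (b - y)).
  rewrite {1}hyr lnM ?posrE ?divr_gt0// lnM ?posrE ?invr_gt0//.
  by rewrite lnV ?posrE// expRK.
by ring.
Qed.

Lemma polar_reg d b r y : arg_dom d b -> 0 < r -> polar_dom b y -> polar_log b y = ln r ->
  let u := y * (cos (b - y) * (sin (b - y))^-1) in
  [/\ reg d u y, expR u * Pf u y = r * cos b & expR u * Qf u y = r * sin b].
Proof.
move=> db r0 yd hl u; have s0 := polar_sin yd; case: (yd) => y0 y1 y2.
have k0 : 0 < y / sin (b - y) by rewrite divr_gt0.
have hr : expR u * (y / sin (b - y)) = r.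
  have {1}-> : u = ln r - ln y + ln (sin (b - y)) by rewrite -hl /polar_log /u; ring.
  rewrite expRD expRB !lnK ?posrE//; field; rewrite !gt_eqF//.
have eb : b = (b - y) + y by ring.
have hsb : sin b = sin (b - y) * cos y + cos (b - y) * sin y by rewrite -sinD -eb.
have hcb : cos b = cos (b - y) * cos y - sin (b - y) * sin y by rewrite -cosD -eb.
have hQ : Qf u y = y / sin (b - y) * sin b.
  rewrite hsb /Qf /u; field; rewrite gt_eqF//.
have hP : Pf u y = y / sin (b - y) * cos b.
  rewrite hcb /Pf /u; field; rewrite gt_eqF//.
rewrite hP hQ !mulrA -[expR u * y / _]mulrA hr; split => //.
case: d db => -[b1 b2]; rewrite /reg; split; rewrite ?hQ; try lra.
  by rewrite pmulr_rlt0// sin_lt0.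
by rewrite pmulr_rgt0// sin_gt0.
Qed.

Lemma reg_sign d u y : reg d u y -> if d then Qf u y < 0 else 0 < Qf u y.
Proof. by case: d => -[]. Qed.

(** The polar equation has at most one solution, by monotonicity of [polar_log]. *)
Lemma reg_inj d u y u' y' : reg d u y -> reg d u' y' ->
  expR u * Pf u y = expR u' * Pf u' y' -> expR u * Qf u y = expR u' * Qf u' y' ->
  u = u' /\ y = y'.
Proof.
move=> h h' eP eQ.
have hs : if d then expR u * Qf u y < 0 else 0 < expR u * Qf u y.
  by case: d h {h'} => /reg_sign h; rewrite ?pmulr_rlt0 ?pmulr_rgt0// expR_gt0.
have [b [r [db r0 hX hY]]] := arg_exists (expR u * Pf u y) hs.
have [yd hl hu] := reg_polar db r0 h hX hY.
rewrite eP in hX; rewrite eQ in hY.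
have [yd' hl' hu'] := reg_polar db r0 h' hX hY.
suff e : y = y' by split => //; rewrite hu hu' e.
apply/eqP; case: ltgtP => // hlt; exfalso.
  by have := polar_mono yd yd' hlt; rewrite hl hl' ltxx.
by have := polar_mono yd' yd hlt; rewrite hl hl' ltxx.
Qed.

(** The polar equation has a solution, by the intermediate value theorem ([polar_surj]). *)
Lemma reg_surj d X Y : (if d then Y < 0 else 0 < Y) ->
  exists u y, [/\ reg d u y, expR u * Pf u y = X & expR u * Qf u y = Y].
Proof.
move=> hs; have [b [r [db r0 -> ->]]] := arg_exists X hs.
have pi0 := @pi_gt0 R.
have [|||y yd hl] := @polar_surj b (ln r).
- by case: d db {hs} => -[]; lra.
- by case: d db {hs} => -[]; lra.
- by case: d db {hs} => -[h1 h2]; [rewrite gt_eqF|rewrite lt_eqF].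
have := polar_reg db r0 yd hl; set u := _ * _ => h; by exists u, y.
Qed.

End RegionReal.

(** * Real and imaginary parts of the map and its level curves *)

Section RealContinuity.
Variables (R : realType) (T : topologicalType).
Implicit Types (F G : T -> R) (t : T).

Lemma cont_cst (c : R) t : continuous_at t (fun _ : T => c).
Proof. exact: cvg_cst. Qed.

Lemma contD F G t : continuous_at t F -> continuous_at t G ->
  continuous_at t (fun t => F t + G t).
Proof. exact: cvgD. Qed.

Lemma contB F G t : continuous_at t F -> continuous_at t G ->
  continuous_at t (fun t => F t - G t).
Proof. exact: cvgB. Qed.

Lemma contM F G t : continuous_at t F -> continuous_at t G ->
  continuous_at t (fun t => F t * G t).
Proof. exact: cvgM. Qed.

Lemma contcomp F (h : R -> R) t : continuous_at t F -> continuous_at (F t) h ->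
  continuous_at t (fun t => h (F t)).
Proof. exact: continuous_comp. Qed.

End RealContinuity.

Section Curves.
Variable R : realType.
Implicit Types x y u v : R.
Local Notation pi := (@pi R).

(** Where sin v <> 0, the equation Qf u v = 0 reads u = kappa v, so the curves zeta and
    eta are graphs of inverses of this function. *)
Definition kappa v := - (v * (cos v * (sin v)^-1)).

(** The derivative is (v - sin v cos v) / sin^2 v, which is positive for v > 0. *)
Lemma kappa_lt_derive v1 v2 : 0 < v1 -> v1 < v2 ->
  (forall v, v1 <= v <= v2 -> sin v != 0) -> kappa v1 < kappa v2.
Proof.
move=> v10 v12 hs.
apply: (@increasing_of_derive R kappa (fun v => (v - sin v * cos v) / sin v ^+ 2)) => // z hz.
  have s0 := hs _ hz.
  have h3 := @is_derive_inv R sin z _ s0 (is_derive_sin z).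
  have h4 := @is_deriveM R R _ _ z 1 _ _ (is_derive_cos z) h3.
  have h5 := @is_deriveM R R _ _ z 1 _ _ (is_derive_id z 1) h4.
  have h6 := @is_deriveN R R R _ z 1 _ h5.
  apply: (is_derive_eq h6).
  have hc : cos z ^+ 2 = 1 - sin z ^+ 2 by rewrite -(cos2Dsin2 z); ring.
  change (- (z * (cos z * (- sin z ^- 2 * cos z) + (sin z)^-1 * - sin z) +
    cos z * (sin z)^-1 * 1) = (z - sin z * cos z) / sin z ^+ 2).
  have -> : cos z * (- sin z ^- 2 * cos z) = - (1 - sin z ^+ 2) / sin z ^+ 2.
    by rewrite -hc; field.
  by field.
have z0 : 0 < z by lra.
have s0 : sin z != 0 by apply: hs; lra.
rewrite divr_gt0 ?subr_gt0 ?exprn_even_gt0//.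
have := cos2Dsin2 z; have := cos_le1 z; have := sin_lt_id z0; have := cos_geN1 z.
have [hz1|hz1] := ltP z (3 / 2) => h1 h2 h3 h4; last by nra.
have : 0 < sin z by apply: sin_gt0; have := @pi_ge2 R; lra.
by nra.
Qed.

Lemma kappa_mono_low v1 v2 : 0 < v1 -> v1 < v2 -> v2 < pi -> kappa v1 < kappa v2.
Proof.
move=> h1 h2 h3; apply: kappa_lt_derive => // v hv.
by rewrite gt_eqF// sin_gt0; lra.
Qed.

Lemma kappa_mono_high v1 v2 : pi < v1 -> v1 < v2 -> v2 < 2 * pi -> kappa v1 < kappa v2.
Proof.
move=> h1 h2 h3; apply: kappa_lt_derive => // [|v hv]; first by have := @pi_gt0 R; lra.
by rewrite lt_eqF// sin_lt0; lra.
Qed.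

Lemma Qf_kappa u v : sin v != 0 -> Qf u v = (u - kappa v) * sin v.
Proof. by move=> s0; rewrite /Qf /kappa; field. Qed.

Lemma Qf_low u v : 0 < v -> v < pi -> (0 < Qf u v) = (kappa v < u).
Proof.
move=> h1 h2; have s0 := sin_gt0 h1 h2.
by rewrite Qf_kappa ?gt_eqF// pmulr_lgt0// subr_gt0.
Qed.

Lemma Qf_low_lt u v : 0 < v -> v < pi -> (Qf u v < 0) = (u < kappa v).
Proof.
move=> h1 h2; have s0 := sin_gt0 h1 h2.
by rewrite Qf_kappa ?gt_eqF// pmulr_llt0// subr_lt0.
Qed.

Lemma Qf_low_eq u v : 0 < v -> v < pi -> (Qf u v == 0) = (u == kappa v).
Proof.
move=> h1 h2; have s0 := sin_gt0 h1 h2.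
by rewrite Qf_kappa; [rewrite mulf_eq0 subr_eq0 (gt_eqF s0) orbF|rewrite gt_eqF].
Qed.

Lemma Qf_high_lt u v : pi < v -> v < 2 * pi -> (Qf u v < 0) = (kappa v < u).
Proof.
move=> h1 h2; have s0 := sin_lt0 h1 h2.
by rewrite Qf_kappa ?lt_eqF// nmulr_llt0// subr_gt0.
Qed.

Lemma Qf_high_eq u v : pi < v -> v < 2 * pi -> (Qf u v == 0) = (u == kappa v).
Proof.
move=> h1 h2; have s0 := sin_lt0 h1 h2.
by rewrite Qf_kappa; [rewrite mulf_eq0 subr_eq0 (lt_eqF s0) orbF|rewrite lt_eqF].
Qed.

Lemma Qf_pi u : Qf u pi = - pi.
Proof. by rewrite /Qf sinpi cospi; ring. Qed.

Lemma Qf_2pi u : Qf u (2 * pi) = 2 * pi.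
Proof. by rewrite /Qf mulr_natl sin2pi cos2pi; ring. Qed.

Lemma Qf_0 u : Qf u 0 = 0.
Proof. by rewrite /Qf sin0; ring. Qed.

Lemma QfN u v : Qf u (- v) = - Qf u v.
Proof. by rewrite /Qf sinN cosN; ring. Qed.

Lemma PfN u v : Pf u (- v) = Pf u v.
Proof. by rewrite /Pf sinN cosN; ring. Qed.

Lemma Qf_left u v : u <= -1 -> 0 < v -> v <= pi -> Qf u v < 0.
Proof.
move=> hu h1 h2; have := ycos_lt_sin h1 h2; rewrite /Qf.
have : 0 <= sin v by apply: sin_ge0_pi; lra.
by nra.
Qed.

Lemma kappa_gtN1 v : 0 < v -> v < pi -> -1 < kappa v.
Proof. by move=> h1 h2; rewrite -Qf_low_lt//; apply: Qf_left; lra. Qed.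

Lemma continuous_Qfr u : continuous (Qf u).
Proof.
move=> v; apply: cvgD; apply: cvgM.
- exact: cvg_cst.
- exact: continuous_sin.
- exact: cvg_id.
- exact: continuous_cos.
Qed.

Lemma Qf_right u v : 0 < v -> v <= pi / 2 -> 0 < u + cos v -> 0 < Qf u v.
Proof.
move=> v0 v1 h; have p0 := @pi_gt0 R; have s0 : 0 < sin v by apply: sin_gt0; lra.
have c0 : 0 <= cos v by apply: cos_ge0_pihalf; lra.
have := sin_lt_id v0; rewrite /Qf => s1; nra.
Qed.

Lemma eta_exists u : -1 < u -> exists v, [/\ 0 < v, v < pi & Qf u v = 0].
Proof.
move=> hu; pose v := Num.min 1 (u + 1); have v0 : 0 < v by rewrite lt_min ltr01; lra.
have v1 : v <= 1 by rewrite ge_min lexx.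
have v2 : v <= u + 1 by rewrite ge_min lexx orbT.
have p0 := @pi_ge2 R.
have q0 : 0 < Qf u v.
  by apply: Qf_right => //; [lra|have := one_sub_cos v; nra].
have [|||w] := @IVT R (Qf u) v pi 0.
- by lra.
- by apply: continuous_subspaceT; exact: continuous_Qfr.
- by rewrite ge_min le_max Qf_pi (ltW q0); apply/andP; split => //; apply/orP; right; lra.
rewrite in_itv/= => /andP[w1 w2] e; exists w; split => //; first by lra.
rewrite lt_neqAle w2 andbT; apply/eqP => e2; move: e; rewrite e2 Qf_pi; lra.
Qed.

Lemma zeta_exists u : exists v, [/\ pi < v, v < 2 * pi & Qf u v = 0].
Proof.
have p0 := @pi_ge2 R.
have [|||w] := @IVT R (Qf u) pi (2 * pi) 0.
- by lra.
- by apply: continuous_subspaceT; exact: continuous_Qfr.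
- by rewrite Qf_pi Qf_2pi ge_min le_max; apply/andP; split; apply/orP; [left|right]; lra.
rewrite in_itv/= => /andP[w1 w2] e; exists w; split => //.
  rewrite lt_neqAle w1 andbT; apply/eqP => e2; move: e; rewrite -e2 Qf_pi; lra.
rewrite lt_neqAle w2 andbT; apply/eqP => e2; move: e; rewrite e2 Qf_2pi; lra.
Qed.

Lemma eta_fun_exists :
  exists E : R -> R, forall u, -1 < u -> [/\ 0 < E u, E u < pi & kappa (E u) = u].
Proof.
have h u : exists v, -1 < u -> [/\ 0 < v, v < pi & kappa v = u].
  have [hu|hu] := ltP (-1) u; last by exists 0.
  have [v [h1 h2 h3]] := eta_exists hu; exists v => _; split => //.
  by apply/esym/eqP; rewrite -Qf_low_eq// h3.
by have [E hE] := choice h; exists E => u; apply: hE.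
Qed.

Lemma zeta_fun_exists :
  exists Z : R -> R, forall u, [/\ pi < Z u, Z u < 2 * pi & kappa (Z u) = u].
Proof.
have h u : exists v, [/\ pi < v, v < 2 * pi & kappa v = u].
  have [v [h1 h2 h3]] := zeta_exists u; exists v; split => //.
  by apply/esym/eqP; rewrite -Qf_high_eq// h3.
by have [Z hZ] := choice h; exists Z => u; apply: hZ.
Qed.

Definition eta0 := proj1_sig (cid eta_fun_exists).
Definition zeta0 := proj1_sig (cid zeta_fun_exists).

Lemma eta0P u : -1 < u -> [/\ 0 < eta0 u, eta0 u < pi & kappa (eta0 u) = u].
Proof. exact: (proj2_sig (cid eta_fun_exists)). Qed.

Lemma zeta0P u : [/\ pi < zeta0 u, zeta0 u < 2 * pi & kappa (zeta0 u) = u].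
Proof. exact: (proj2_sig (cid zeta_fun_exists)). Qed.

Lemma lt_eta0 v u : 0 < v -> v < pi -> -1 < u -> (v < eta0 u) = (kappa v < u).
Proof.
move=> v0 v1 hu; have [h1 h2 h3] := eta0P hu; case: (ltgtP v (eta0 u)) => h.
- by rewrite -[X in _ < X]h3; apply/esym/kappa_mono_low.
- apply/esym/negbTE; rewrite -leNgt -[X in X <= _]h3; apply/ltW; exact: kappa_mono_low.
- by rewrite h h3 ltxx.
Qed.

Lemma gt_eta0 v u : 0 < v -> v < pi -> -1 < u -> (eta0 u < v) = (u < kappa v).
Proof.
move=> v0 v1 hu; have [h1 h2 h3] := eta0P hu; case: (ltgtP v (eta0 u)) => h.
- apply/esym/negbTE; rewrite -leNgt -[X in _ <= X]h3; apply/ltW; exact: kappa_mono_low.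
- by rewrite -[X in X < _]h3; apply/esym/kappa_mono_low.
- by rewrite h h3 ltxx.
Qed.

Lemma eta0_kappa v : 0 < v -> v < pi -> eta0 (kappa v) = v.
Proof.
move=> v0 v1; have hu := kappa_gtN1 v0 v1.
apply/eqP; rewrite eq_le !leNgt lt_eta0// gt_eta0// ltxx//.
Qed.

Lemma lt_zeta0 v u : pi < v -> v < 2 * pi -> (v < zeta0 u) = (kappa v < u).
Proof.
move=> v0 v1; have [h1 h2 h3] := zeta0P u; case: (ltgtP v (zeta0 u)) => h.
- by rewrite -[X in _ < X]h3; apply/esym/kappa_mono_high.
- apply/esym/negbTE; rewrite -leNgt -[X in X <= _]h3; apply/ltW; exact: kappa_mono_high.
- by rewrite h h3 ltxx.
Qed.

Lemma gt_zeta0 v u : pi < v -> v < 2 * pi -> (zeta0 u < v) = (u < kappa v).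
Proof.
move=> v0 v1; have [h1 h2 h3] := zeta0P u; case: (ltgtP v (zeta0 u)) => h.
- apply/esym/negbTE; rewrite -leNgt -[X in _ <= X]h3; apply/ltW; exact: kappa_mono_high.
- by rewrite -[X in X < _]h3; apply/esym/kappa_mono_high.
- by rewrite h h3 ltxx.
Qed.

Lemma zeta0_kappa v : pi < v -> v < 2 * pi -> zeta0 (kappa v) = v.
Proof.
by move=> v0 v1; apply/eqP; rewrite eq_le !leNgt lt_zeta0// gt_zeta0// ltxx.
Qed.

Lemma eta0_incr u u' : -1 < u -> u < u' -> eta0 u < eta0 u'.
Proof.
move=> hu h; have [h1 h2 h3] := eta0P hu; rewrite lt_eta0//; last by lra.
by rewrite h3.
Qed.

Lemma zeta0_incr u u' : u < u' -> zeta0 u < zeta0 u'.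
Proof. by move=> h; have [h1 h2 h3] := zeta0P u; rewrite lt_zeta0// h3. Qed.

End Curves.

Section Regions.
Variables (R : realType) (a : R).
Local Notation C := (R[i]^o).
Local Notation Re := (@complex.Re R).
Local Notation Im := (@complex.Im R).
Local Notation pi := (@pi R).
Local Notation uc z := (Re z + a - 1).

Lemma fE (x y : R) : f a (x +i* y) =
  (a * expR (x + a) * Pf (x + a - 1) y) +i* (a * expR (x + a) * Qf (x + a - 1) y).
Proof.
rewrite /f /cexp /Pf /Qf /= !addr0.
have -> : (x +i* y - (1 - a)%:C : C) = (x + a - 1) +i* y.
  by apply/eqP; rewrite eq_complex/=; apply/andP; split; apply/eqP; ring.
by apply/eqP; rewrite eq_complex/=; apply/andP; split; apply/eqP; ring.
Qed.

Lemma Re_f z : Re (f a z) = a * expR (Re z + a) * Pf (uc z) (Im z).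
Proof. by case: z => x y; rewrite fE. Qed.

Lemma Im_f z : Im (f a z) = a * expR (Re z + a) * Qf (uc z) (Im z).
Proof. by case: z => x y; rewrite fE. Qed.

Lemma continuous_uc : continuous (fun z : C => uc z).
Proof.
move=> z; apply: contB; last exact: cont_cst.
by apply: contD; [exact: continuous_Re|exact: cont_cst].
Qed.

Lemma continuous_sin_Im : continuous (fun z : C => sin (Im z)).
Proof.
by move=> z; apply: contcomp; [exact: continuous_Im|exact: continuous_sin].
Qed.

Lemma continuous_cos_Im : continuous (fun z : C => cos (Im z)).
Proof.
by move=> z; apply: contcomp; [exact: continuous_Im|exact: continuous_cos].
Qed.

Lemma continuous_Qz : continuous (fun z : C => Qf (uc z) (Im z)).
Proof.
move=> z; apply: contD; apply: contM.
- exact: continuous_uc.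
- exact: continuous_sin_Im.
- exact: continuous_Im.
- exact: continuous_cos_Im.
Qed.

Lemma continuous_Pz : continuous (fun z : C => Pf (uc z) (Im z)).
Proof.
move=> z; apply: contB; apply: contM.
- exact: continuous_uc.
- exact: continuous_cos_Im.
- exact: continuous_Im.
- exact: continuous_sin_Im.
Qed.

Lemma continuous_f : continuous (f a : C -> C).
Proof.
move=> z.
have -> : f a = (fun z => (a * expR (Re z + a) * Pf (uc z) (Im z)) +i*
                          (a * expR (Re z + a) * Qf (uc z) (Im z)) : C).
  by apply/funext => w; case: w => x y; rewrite fE.
have h : continuous_at z (fun z : C => a * expR (Re z + a)).
  apply: contM; first exact: cont_cst.
  apply: contcomp; last exact: continuous_expR.
  by apply: contD; [exact: continuous_Re|exact: cont_cst].
apply: continuousC_comp; (apply: contM; first exact: h).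
  exact: continuous_Pz.
exact: continuous_Qz.
Qed.

Lemma continuous_iter_f n : continuous (iter n (f a) : C -> C).
Proof.
elim: n => [|n IH] z; first exact: cvg_id.
by apply: (@continuous_comp _ _ _ (iter n (f a)) (f a)); [exact: IH|exact: continuous_f].
Qed.

End Regions.

(** * Explicit forms of the two regions *)

Section ConnectedTools.
Variable T : topologicalType.
Implicit Types A B K U V : set T.

(** The form in which connectedness of the regions is proved: every point can be joined
    inside the set to one connected core. *)
Lemma connected_by_pieces A K : connected K -> K `<=` A -> K !=set0 ->
  (forall z, A z -> exists B, [/\ connected B, B `<=` A, B z & B `&` K !=set0]) ->
  connected A.
Proof.
move=> cK KA [k0 Kk0] h.
have h' z : exists B, A z -> [/\ connected B, B `<=` A, B z & B `&` K !=set0].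
  have [/h[B hB]|nA] := pselect (A z); first by exists B.
  by exists set0.
have [B hB] := choice h'.
have -> : A = \bigcup_(z in A) (K `|` B z).
  apply/seteqP; split=> [z Az|w [z Az [/KA//|]]].
    by exists z => //; right; have [] := hB z Az.
  by have [_ + _ _] := hB z Az; apply.
apply: bigcup_connected; first by exists k0 => z _; left.
move=> z Az; have [cB _ _ BK] := hB z Az; apply: connectedU => //.
by rewrite setIC.
Qed.

Lemma sub_of_boundary U V : open U -> connected V -> V `&` U !=set0 ->
  V `&` boundary U = set0 -> V `<=` U.
Proof.
move=> oU cV VU0 Vb.
suff <- : V `&` U = V by move=> z [].
apply: cV => //; first by exists U.
exists (closure U); first exact: closed_closure.
apply/seteqP; split=> z [Vz Uz]; split => //; first exact: subset_closure.
apply: contrapT => nUz.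
suff : set0 z by [].
rewrite -Vb; split => //; split => //.
by move/interior_subset.
Qed.

(** A connected set that meets U and avoids the boundary of U stays in U. This is what
    makes the regions T_0 and T_1, specified through their boundaries, unique. *)
Lemma open_connected_eq U V : open U -> open V -> connected U -> connected V ->
  V `&` U !=set0 -> boundary U = boundary V -> U = V.
Proof.
move=> oU oV cU cV VU bUV.
have di W : open W -> W `&` boundary W = set0.
  move=> oW; apply/seteqP; split => // z [Wz [_]]; apply.
  by move/interior_id: oW => ->.
apply/seteqP; split; apply: sub_of_boundary => //; rewrite 1?setIC//.
  by rewrite setIC -bUV di.
by rewrite setIC bUV di.
Qed.

End ConnectedTools.

Section Segments.
Variable R : realType.
Local Notation C := (R[i]^o).
Local Notation Re := (@complex.Re R).
Local Notation Im := (@complex.Im R).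

Definition hseg (y x1 x2 : R) : set C := [set z | Im z = y /\ x1 <= Re z <= x2].
Definition vseg (x y1 y2 : R) : set C := [set z | Re z = x /\ y1 <= Im z <= y2].

Lemma connected_hseg y x1 x2 : connected (hseg y x1 x2).
Proof.
have -> : hseg y x1 x2 = (fun x => x +i* y : C) @` `[x1, x2].
  apply/seteqP; split=> [[p q] [/= -> h]|z [x /=]].
    by exists p => //=; rewrite in_itv/=.
  by rewrite in_itv/= => h <-.
apply: connected_continuous_connected; first exact: segment_connected.
apply: continuous_subspaceT => x.
by apply: continuousC_comp; [exact: cvg_id|exact: cont_cst].
Qed.

Lemma connected_vseg x y1 y2 : connected (vseg x y1 y2).
Proof.
have -> : vseg x y1 y2 = (fun y => x +i* y : C) @` `[y1, y2].
  apply/seteqP; split=> [[p q] [/= -> h]|z [y /=]].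
    by exists q => //=; rewrite in_itv/=.
  by rewrite in_itv/= => h <-.
apply: connected_continuous_connected; first exact: segment_connected.
apply: continuous_subspaceT => y.
by apply: continuousC_comp; [exact: cont_cst|exact: cvg_id].
Qed.

Lemma connected_sseg (x s v1 v2 : R) :
  connected ((fun v => x +i* (s * v) : C) @` `[v1, v2]).
Proof.
apply: connected_continuous_connected; first exact: segment_connected.
apply: continuous_subspaceT => v.
apply: continuousC_comp; first exact: cont_cst.
by apply: contM; [exact: cont_cst|exact: cvg_id].
Qed.

Lemma closureP (A : set C) (z : C) :
  (forall e : R, 0 < e -> exists w, [/\ A w, `|Re w - Re z| < e & `|Im w - Im z| < e]) ->
  closure A z.
Proof.
move=> h B /nbhsCP[e e0 eB]; have [w [Aw h1 h2]] := h e e0.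
by exists w; split => //; rewrite (ReImE w); apply: eB.
Qed.

End Segments.

Section Near.
Variables (R : realType) (T : topologicalType).
Implicit Types (F : T -> R) (z : T) (c : R).

Lemma near_lt F z c : continuous_at z F -> F z < c -> nbhs z [set w | F w < c].
Proof. by move=> cF h; exact: (cvgr_lt _ cF). Qed.

Lemma near_gt F z c : continuous_at z F -> c < F z -> nbhs z [set w | c < F w].
Proof. by move=> cF h; exact: (cvgr_gt _ cF). Qed.

Lemma closure_le (A : set T) F c : (forall z, continuous_at z F) ->
  (forall z, A z -> F z <= c) -> forall z, closure A z -> F z <= c.
Proof.
move=> cF hA z clz; rewrite leNgt; apply/negP => h.
by have [w [/hA + /=]] := clz _ (near_gt (cF z) h); rewrite leNgt => /negP.
Qed.

Lemma closure_ge (A : set T) F c : (forall z, continuous_at z F) ->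
  (forall z, A z -> c <= F z) -> forall z, closure A z -> c <= F z.
Proof.
move=> cF hA z clz; rewrite leNgt; apply/negP => h.
by have [w [/hA + /=]] := clz _ (near_lt (cF z) h); rewrite leNgt => /negP.
Qed.

Lemma openP (A : set T) : (forall z, A z -> nbhs z A) -> open A.
Proof. by rewrite openE. Qed.

Lemma boundary_open (U : set T) : open U -> boundary U = closure U `\` U.
Proof. by move/interior_id; rewrite /boundary => ->. Qed.

End Near.

Section ExplicitRegions.
Variables (R : realType) (a : R).
Local Notation C := (R[i]^o).
Local Notation Re := (@complex.Re R).
Local Notation Im := (@complex.Im R).
Local Notation pi := (@pi R).
Local Notation uc z := (Re z + a - 1).

(** The sign of this function tells on which side of the level curves a point lies,
    simultaneously in the upper and the lower half-plane. *)
Definition qa (z : C) : R := Qf (uc z) `|Im z|.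

(** At real points the sign of Qf carries no information, since Qf vanishes there; the
    condition u > -1 (that is, Re z > -a) replaces it. *)
Definition region0 : set C := [set z | [/\ -1 < uc z, `|Im z| < pi & Im z != 0 -> 0 < qa z]].

Definition region1 : set C := [set z | [/\ Im z = 0 -> uc z < -1, `|Im z| < 2 * pi &
  Im z != 0 -> qa z < 0]].

Lemma continuous_aIm (z : C) : continuous_at z (fun z : C => `|Im z|).
Proof. by apply: contcomp; [exact: continuous_Im|exact: norm_continuous]. Qed.

Lemma continuous_qa (z : C) : continuous_at z qa.
Proof.
apply: contD; apply: contM.
- exact: continuous_uc.
- by apply: contcomp; [exact: continuous_aIm|exact: continuous_sin].
- exact: continuous_aIm.
- by apply: contcomp; [exact: continuous_aIm|exact: continuous_cos].
Qed.

(** Only real points need care: there sin y < y bounds Qf u y below by a positive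
    multiple of u + cos y, and u + cos y > 0 is an open condition. *)
Lemma open_region0 : open region0.
Proof.
apply: openP => z [h1 h2 h3]; have p0 := @pi_gt0 R.
have [y0|y0] := eqVneq (Im z) 0.
  have n1 : nbhs z [set w : C | `|Im w| < pi / 2].
    by apply: near_lt; [exact: continuous_aIm|rewrite y0 normr0; lra].
  have n2 : nbhs z [set w : C | 0 < uc w + cos (Im w)].
    apply: near_gt; last by rewrite y0 cos0; lra.
    by apply: contD; [exact: continuous_uc|exact: continuous_cos_Im].
  apply: filterS2 n1 n2 => w /= w1 w2; split; first by have := cos_le1 (Im w); lra.
    by lra.
  rewrite -normr_gt0 => w0; apply: Qf_right => //; first by lra.
  by rewrite cos_norm.
have n1 : nbhs z [set w : C | `|Im w| < pi] by apply: near_lt => //; exact: continuous_aIm.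
have n2 : nbhs z [set w : C | 0 < qa w] by apply: near_gt; [exact: continuous_qa|exact: h3].
have n3 : nbhs z [set w : C | -1 < uc w] by apply: near_gt; [exact: continuous_uc|].
apply: filterS3 n1 n2 n3 => w /= w1 w2 w3; split => //.
Qed.

Lemma open_region1 : open region1.
Proof.
apply: openP => z [h1 h2 h3]; have p0 := @pi_gt0 R.
have n1 : nbhs z [set w : C | `|Im w| < 2 * pi] by apply: near_lt => //; exact: continuous_aIm.
have [y0|y0] := eqVneq (Im z) 0.
  have n3 : nbhs z [set w : C | `|Im w| < pi].
    by apply: near_lt; [exact: continuous_aIm|rewrite y0 normr0].
  have n2 : nbhs z [set w : C | uc w < -1].
    by apply: near_lt; [exact: continuous_uc|exact: h1].
  apply: filterS3 n1 n2 n3 => w /= w1 w2 w3; split => //.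
  by rewrite -normr_gt0 => w0; apply: Qf_left; lra.
have n2 : nbhs z [set w : C | qa w < 0] by apply: near_lt; [exact: continuous_qa|exact: h3].
have n3 : nbhs z [set w : C | 0 < `|Im w|].
  by apply: near_gt; [exact: continuous_aIm|rewrite normr_gt0].
apply: filterS3 n1 n2 n3 => w /= w1 w2 w3; split => // w0.
by move: w3; rewrite w0 normr0 ltxx.
Qed.

(** Every point descends vertically to the real half-line Re z > -a inside the region,
    because [kappa] is increasing on ]0, pi[. *)
Lemma connected_region0 : connected region0.
Proof.
pose K : set C := [set z | Im z = 0 /\ -1 < uc z].
have p0 := @pi_gt0 R.
have KT : K `<=` region0 by move=> z [h1 h2]; split; rewrite // h1 ?normr0// eqxx.
apply: (@connected_by_pieces _ _ K) => //.
- apply: (@connected_by_pieces _ _ [set (1 - a)%:C : C]).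
  + exact: connected1.
  + by move=> z ->; rewrite /K/=; split; lra.
  + by exists (1 - a)%:C.
  + move=> z [z1 z2]; exists (hseg 0 (Num.min (Re z) (1 - a)) (Num.max (Re z) (1 - a))).
    split; first exact: connected_hseg.
    * move=> w [w1 /andP[+ _]]; rewrite ge_min /K/= => /orP[]; split => //; lra.
    * by rewrite /hseg/= z1 ge_min le_max !lexx.
    * exists (1 - a)%:C; split => //; rewrite /hseg/= ge_min le_max !lexx !orbT; split => //.
- by exists (1 - a)%:C; rewrite /K/=; split; lra.
- move=> z zT; have [z1 z2 z3] := zT.
  exists ((fun v => Re z +i* (Num.sg (Im z) * v) : C) @` `[0, `|Im z|]); split.
  + exact: connected_sseg.
  + move=> w [v]; rewrite /= in_itv/= => /andP[v0 v1] <-; rewrite /region0 /qa/=.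
    have hv : `|Num.sg (Im z) * v| <= v.
      by rewrite normrM normr_sg (ger0_norm v0); case: eqP => _ /=; lra.
    split => //; first by apply: le_lt_trans z2; lra.
    move=> w0; have z0 : Im z != 0 by move: w0; apply: contraNneq => ->; rewrite sgr0 mul0r.
    have v2 : v != 0 by move: w0; apply: contraNneq => ->; rewrite mulr0.
    have {}v0 : 0 < v by rewrite lt_neqAle eq_sym v2.
    rewrite normrM normr_sg z0 mul1r (gtr0_norm v0).
    have := z3 z0; rewrite /qa !Qf_low//; try lra.
    apply: le_lt_trans; move: v1; rewrite le_eqVlt => /orP[/eqP-> //|h].
    exact/ltW/kappa_mono_low.
  + exists `|Im z|; rewrite /= ?in_itv/= ?lexx ?normr_ge0//.
    by rewrite [in RHS](ReImE z) [in RHS](numEsg (Im z)).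
  + exists (Re z)%:C; split => //; exists 0; rewrite /= ?in_itv/= ?lexx ?normr_ge0//.
    by rewrite mulr0.
Qed.

(** The core consists of the two lines of height pi and - pi, on which Qf is negative,
    joined by a vertical segment far to the left. Points below height pi move left,
    points above it descend to the line. *)
Lemma connected_region1 : connected region1.
Proof.
have p0 := @pi_gt0 R.
pose K : set C := [set z | `|Im z| = pi \/ (Re z = -1 - a /\ `|Im z| <= pi)].
have KT : K `<=` region1.
  move=> z [h|[h1 h2]]; split.
  - by move=> z0; move: h; rewrite z0 normr0; lra.
  - by lra.
  - by move=> _; rewrite /qa h Qf_pi; lra.
  - by rewrite h1; lra.
  - by lra.
  - by rewrite -normr_gt0 => z0; apply: Qf_left => //; lra.
have cK : connected K.
  apply: (@connected_by_pieces _ _ (vseg (-1 - a) (- pi) pi)).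
  - exact: connected_vseg.
  - by move=> z [h1 h2]; right; rewrite ler_norml.
  - by exists ((-1 - a)%:C); rewrite /vseg/=; split => //; lra.
  - move=> z [h|[h1 h2]].
      exists (hseg (Im z) (Num.min (Re z) (-1 - a)) (Num.max (Re z) (-1 - a))); split.
      + exact: connected_hseg.
      + by move=> w [w1 _]; left; rewrite w1.
      + by rewrite /hseg/= ge_min le_max !lexx.
      + exists ((-1 - a) +i* Im z : C); rewrite /vseg/hseg/= ge_min le_max !lexx !orbT.
        by split; split => //; rewrite -ler_norml h.
    exists (vseg (-1 - a) (- pi) pi); rewrite setIid; split => //.
    + exact: connected_vseg.
    + by move=> w [w1 w2]; right; rewrite ler_norml.
    + by rewrite /vseg/= -ler_norml.
    + by exists ((-1 - a)%:C); rewrite /vseg/=; split => //; lra.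
apply: (@connected_by_pieces _ _ K) => //.
  by exists ((-1 - a)%:C); right; rewrite /= normr0; split => //; lra.
move=> z zT; have [z1 z2 z3] := zT.
have [zp|zp] := ltP `|Im z| pi.
  exists (hseg (Im z) (Num.min (Re z) (-1 - a)) (Num.max (Re z) (-1 - a))); split.
  - exact: connected_hseg.
  - move=> w [w1 /andP[_]]; rewrite le_max => w2; split; rewrite ?w1//.
      by move=> /z1 z4; case/orP: w2; lra.
    move=> z4; rewrite /qa w1; case/orP: w2 => w2.
      have := z3 z4; rewrite /qa !Qf_low_lt ?normr_gt0//; lra.
    by apply: Qf_left; rewrite ?normr_gt0//; lra.
  - by rewrite /hseg/= ge_min le_max !lexx.
  - exists ((-1 - a) +i* Im z : C); rewrite /hseg/= ge_min le_max !lexx !orbT.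
    by split => //; right; split => //=; lra.
(* above the line Im = pi: descend vertically *)
have z0 : Im z != 0 by rewrite -normr_gt0; lra.
have s1 : `|Num.sg (Im z)| = 1 by rewrite normr_sg z0.
exists ((fun v => Re z +i* (Num.sg (Im z) * v) : C) @` `[pi, `|Im z|]); split.
- exact: connected_sseg.
- move=> w [v]; rewrite /= in_itv/= => /andP[v0 v1] <-; rewrite /region1 /qa/=.
  have vv : `|Num.sg (Im z) * v| = v by rewrite normrM s1 mul1r gtr0_norm//; lra.
  rewrite vv; split; [|lra|].
    by move=> h; move: vv; rewrite h normr0; lra.
  move=> _; move: v0; rewrite le_eqVlt => /orP[/eqP <-|v0]; first by rewrite Qf_pi; lra.
  have := z3 z0; rewrite /qa !Qf_high_lt//; try lra.
  apply: le_lt_trans; move: v1; rewrite le_eqVlt => /orP[/eqP-> //|h].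
  exact/ltW/kappa_mono_high.
- exists `|Im z|; rewrite /= ?in_itv/= ?lexx ?zp//.
  by rewrite [in RHS](ReImE z) [in RHS](numEsg (Im z)).
- exists (Re z +i* (Num.sg (Im z) * pi) : C); split.
    by exists pi; rewrite /= ?in_itv/= ?lexx ?zp.
  by left; rewrite /= normrM s1 mul1r gtr0_norm.
Qed.

Definition eta_locus : set C :=
  [set z | [/\ Im z != 0, `|Im z| < pi & qa z = 0]] `|` [set (- a)%:C].

Definition zeta_locus : set C := [set z | [/\ pi < `|Im z|, `|Im z| < 2 * pi & qa z = 0]].

Lemma region_disjoint z : region0 z -> region1 z -> False.
Proof.
move=> [h1 h2 h3] [k1 k2 k3]; have [y0|y0] := eqVneq (Im z) 0.
  by have := k1 y0; lra.
by have := h3 y0; have := k3 y0; lra.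
Qed.

Lemma closure_region1_region0 z : closure region1 z -> region0 z -> False.
Proof.
move=> h zT; have [w [w1 w0]] := h region0 (open_nbhs_nbhs (conj open_region0 zT)).
exact: region_disjoint w0 w1.
Qed.

Lemma qa_shift (z : C) (d : R) : qa ((Re z + d) +i* Im z : C) = qa z + d * sin `|Im z|.
Proof. by rewrite /qa /Qf /=; ring. Qed.

Lemma boundary_region0 : boundary region0 = eta_locus.
Proof.
have p0 := @pi_gt0 R.
rewrite (boundary_open open_region0); apply/seteqP; split=> z.
  move=> [cz nz].
  have h1 : `|Im z| <= pi.
    by apply: (closure_le (@continuous_aIm) _ cz) => w [_ h _]; exact: ltW.
  have h2 : -1 <= uc z.
    by apply: (closure_ge (@continuous_uc R a) _ cz) => w [h _ _]; exact: ltW.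
  have h3 : 0 <= qa z.
    apply: (closure_ge (@continuous_qa) _ cz) => w [_ _ h].
    have [w0|w0] := eqVneq (Im w) 0; last exact/ltW/h.
    by rewrite /qa w0 normr0 Qf_0.
  have h4 : `|Im z| < pi.
    rewrite lt_neqAle h1 andbT; apply/eqP => e; move: h3; rewrite /qa e Qf_pi; lra.
  have [y0|y0] := eqVneq (Im z) 0.
    right; rewrite (ReImE z) y0; congr (_ +i* _).
    apply/eqP; rewrite eq_le; apply/andP; split; last by lra.
    rewrite leNgt; apply/negP => h; apply: nz; split => //; first by lra.
    by rewrite y0 eqxx.
  left; split => //; apply/eqP; rewrite eq_le h3 andbT leNgt; apply/negP => h.
  apply: nz; split => //; rewrite ltNge; apply/negP => hu.
  by have := @Qf_left R (uc z) `|Im z| hu; rewrite normr_gt0 => /(_ y0 h1); rewrite /qa in h; lra.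
move=> [[z1 z2 z3]|->]; split.
- have s0 : 0 < sin `|Im z| by apply: sin_gt0; rewrite ?normr_gt0.
  apply: closureP => e e0; exists ((Re z + e / 2) +i* Im z).
  rewrite /= subrr normr0; split => //; last by rewrite [_ + _ - _]addrAC subrr add0r gtr0_norm; lra.
  have h : 0 < qa ((Re z + e / 2) +i* Im z : C).
    by rewrite qa_shift z3 add0r mulr_gt0//; lra.
  split => //; rewrite ltNge; apply/negP => /= hu.
  by have := @Qf_left R _ `|Im z| hu; rewrite normr_gt0 => /(_ z1 (ltW z2)); rewrite /qa in h; lra.
- by case=> _ _ /(_ z1); rewrite z3 ltxx.
- apply: closureP => e e0; exists ((- a + e / 2)%:C) => /=.
  rewrite subrr normr0; split => //; last by rewrite [_ + _ - _]addrAC subrr add0r gtr0_norm; lra.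
  by split => //=; rewrite ?normr0 ?eqxx//; lra.
- by case => /= h _ _; lra.
Qed.

Lemma boundary_region1 : boundary region1 = zeta_locus `|` eta_locus.
Proof.
have p0 := @pi_gt0 R.
rewrite (boundary_open open_region1); apply/seteqP; split=> z.
  move=> [cz nz].
  have h1 : `|Im z| <= 2 * pi.
    by apply: (closure_le (@continuous_aIm) _ cz) => w [_ h _]; exact: ltW.
  have h3 : qa z <= 0.
    apply: (closure_le (@continuous_qa) _ cz) => w [_ _ h].
    have [w0|w0] := eqVneq (Im w) 0; last exact/ltW/h.
    by rewrite /qa w0 normr0 Qf_0.
  have h4 : `|Im z| < 2 * pi.
    rewrite lt_neqAle h1 andbT; apply/eqP => e; move: h3; rewrite /qa e Qf_2pi; lra.
  have [y0|y0] := eqVneq (Im z) 0.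
    right; right; rewrite (ReImE z) y0; congr (_ +i* _).
    apply/eqP; rewrite eq_le; apply/andP; split.
      rewrite leNgt; apply/negP => h; apply: (closure_region1_region0 cz); split; first by lra.
        by rewrite y0 normr0.
      by rewrite y0 eqxx.
    rewrite leNgt; apply/negP => h; apply: nz; split => //; first by lra.
    by rewrite y0 eqxx.
  have q0 : qa z = 0.
    apply/eqP; rewrite eq_le h3 leNgt; apply/negP => h.
    by apply: nz; split => // e; rewrite e eqxx in y0.
  have [hp|hp|hp] := ltgtP `|Im z| pi.
  - by right; left.
  - by left.
  - by move: q0; rewrite /qa hp Qf_pi; lra.
move=> [[z1 z2 z3]|[[z1 z2 z3]|->]]; split.
- have s0 : sin `|Im z| < 0 by apply: sin_lt0.
  apply: closureP => e e0; exists ((Re z + e / 2) +i* Im z).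
  rewrite /= subrr normr0; split => //; last by rewrite [_ + _ - _]addrAC subrr add0r gtr0_norm; lra.
  split => //=; first by move=> y0; move: z1; rewrite y0 normr0; lra.
  by move=> _; rewrite qa_shift z3 add0r nmulr_llt0//; lra.
- case=> _ _ h; have y0 : Im z != 0 by rewrite -normr_gt0; lra.
  by have := h y0; rewrite z3 ltxx.
- have s0 : 0 < sin `|Im z| by apply: sin_gt0; rewrite ?normr_gt0.
  apply: closureP => e e0; exists ((Re z + - (e / 2)) +i* Im z).
  rewrite /= subrr normr0; split => //; last first.
    by rewrite [_ + _ - _]addrAC subrr add0r normrN gtr0_norm; lra.
  split => //=; [by move=> y0; rewrite y0 eqxx in z1|lra|].
  by move=> _; rewrite qa_shift z3 add0r pmulr_llt0//; lra.
- by case=> _ _ /(_ z1); rewrite z3 ltxx.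
- apply: closureP => e e0; exists ((- a - e / 2)%:C) => /=.
  rewrite subrr normr0; split => //; last first.
    by rewrite [_ - _ - _]addrAC subrr add0r normrN gtr0_norm; lra.
  by split => //=; rewrite ?normr0 ?eqxx//; lra.
- by case => /= /(_ erefl) h _ _; lra.
Qed.

End ExplicitRegions.

(** * Identification of the curves and of the regions *)

Section Identify.
Variables (R : realType) (a : R) (a0 : 0 < a).
Local Notation C := (R[i]^o).
Local Notation Re := (@complex.Re R).
Local Notation Im := (@complex.Im R).
Local Notation pi := (@pi R).
Local Notation uc z := (Re z + a - 1).

Lemma xget_unique (T : choiceType) (x0 : T) (P : set T) (x : T) :
  P x -> (forall y, P y -> y = x) -> xget x0 P = x.
Proof. by move=> Px h; apply: h; apply: xgetPex; exists x. Qed.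

Lemma preimage_RposE (z : C) :
  preimage_Rpos a z <-> Qf (uc z) (Im z) = 0 /\ 0 < Pf (uc z) (Im z).
Proof.
have e0 : 0 < a * expR (Re z + a) by rewrite mulr_gt0// expR_gt0.
split.
  case=> r /=; rewrite in_itv/= andbT => r0 rz.
  have hR := Re_f a z; have hI := Im_f a z; rewrite -rz /= in hR hI.
  split; last by rewrite -(pmulr_rgt0 _ e0) -hR.
  by apply/eqP; rewrite -(mulrI_eq0 _ (lregP (lt0r_neq0 e0))) -hI.
move=> [hQ hP]; exists (a * expR (Re z + a) * Pf (uc z) (Im z)).
  by rewrite /= in_itv/= andbT mulr_gt0.
by rewrite (ReImE (f a z)) Re_f Im_f hQ mulr0.
Qed.

Lemma Pf_pos_high u v : pi < v -> v < 2 * pi -> Qf u v = 0 -> 0 < Pf u v.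
Proof.
move=> h1 h2 hQ; have s0 := sin_lt0 h1 h2; have p0 := @pi_gt0 R.
rewrite -(nmulr_llt0 _ s0).
have -> : Pf u v * sin v = Qf u v * cos v - v * (cos v ^+ 2 + sin v ^+ 2).
  by rewrite /Pf /Qf; ring.
by rewrite hQ cos2Dsin2; lra.
Qed.

Lemma Qf_sign (e u v : R) : e = 1 \/ e = -1 -> Qf u (e * v) = e * Qf u v.
Proof. by case=> ->; rewrite ?mul1r// !mulN1r QfN. Qed.

Lemma Pf_sign (e u v : R) : e = 1 \/ e = -1 -> Pf u (e * v) = Pf u v.
Proof. by case=> ->; rewrite ?mul1r// mulN1r PfN. Qed.

Section OneSign.
Variables (e : R) (he : e = 1 \/ e = -1).

Let ee : e * e = 1. Proof. by case: he => ->; ring. Qed.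

Definition zeta_fun (x : R) := e * zeta0 (x + a - 1).

Lemma graph_zeta_fun : graph setT zeta_fun =
  [set z : C | preimage_Rpos a z /\ (pi < e * Im z /\ e * Im z < 2 * pi)].
Proof.
apply/seteqP; split=> [z [x _ <-]|z [pz [h1 h2]]].
  have [h1 h2 h3] := zeta0P (x + a - 1).
  have hQ : Qf (x + a - 1) (zeta0 (x + a - 1)) = 0.
    by apply/eqP; rewrite Qf_high_eq// h3.
  split; last by rewrite /zeta_fun /= mulrA ee mul1r.
  by apply/preimage_RposE; rewrite /zeta_fun/= Qf_sign// Pf_sign// hQ mulr0; split => //; apply: Pf_pos_high.
exists (Re z) => //; rewrite [RHS]ReImE; congr (_ +i* _).
have [hQ _] := (preimage_RposE z).1 pz.
have : Qf (uc z) (e * Im z) = 0 by rewrite Qf_sign// hQ mulr0.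
by move/eqP; rewrite Qf_high_eq// => /eqP hu; rewrite /zeta_fun hu zeta0_kappa// mulrA ee mul1r.
Qed.

(** The graph is the continuous image of ]pi, 2 pi[ under the parametrisation by height,
    which avoids continuity of the inverse function. *)
Lemma connected_graph_zeta_fun : connected (graph setT zeta_fun : set C).
Proof.
have p0 := @pi_gt0 R.
have -> : graph setT zeta_fun = (fun v => (kappa v + 1 - a) +i* (e * v) : C) @` `]pi, (2 * pi)[.
  apply/seteqP; split=> [z [x _ <-]|z [v]].
    have [h1 h2 h3] := zeta0P (x + a - 1).
    by exists (zeta0 (x + a - 1)); rewrite /= ?in_itv/= ?h1// h3; congr (_ +i* _); ring.
  rewrite /= in_itv/= => /andP[h1 h2] <-; exists (kappa v + 1 - a) => //; congr (_ +i* _).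
  by rewrite /zeta_fun (_ : _ + a - 1 = kappa v) ?zeta0_kappa//; ring.
apply: connected_continuous_connected.
  by apply/connected_intervalP; exact: interval_is_interval.
apply: continuous_in_subspaceT => v; rewrite inE/= in_itv/= => /andP[h1 h2].
have s0 := sin_lt0 h1 h2.
apply: continuousC_comp; last by apply: contM; [exact: cont_cst|exact: cvg_id].
apply: contB; last exact: cont_cst.
apply: contD; last exact: cont_cst.
apply: (@contcomp _ R (fun v : R => v * (cos v * (sin v)^-1)) (fun x : R => - x)); last exact: opp_continuous.
apply: contM; first exact: cvg_id.
apply: contM; first exact: continuous_cos.
by apply: cvgV; [rewrite lt_eqF|exact: continuous_sin].
Qed.

(** On the lines of height pi and 2 pi the imaginary part of f_a never vanishes, so a
    component of the preimage of the positive reals cannot cross them. *)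
Lemma component_graph_zeta_fun z : graph setT zeta_fun z ->
  connected_component (preimage_Rpos a) z = graph setT zeta_fun.
Proof.
move=> gz; have p0 := @pi_gt0 R; apply/seteqP; split; last first.
  apply: connected_component_max => //; first by move=> w; rewrite graph_zeta_fun => -[].
  exact: connected_graph_zeta_fun.
move=> w cw.
have sub : connected_component (preimage_Rpos a) z `<=` preimage_Rpos a.
  exact: connected_component_sub.
have pw := sub _ cw.
have : is_interval ((fun z : C => e * Im z) @` connected_component (preimage_Rpos a) z).
  apply/connected_intervalP; apply: connected_continuous_connected.
    exact: component_connected.
  by apply: continuous_subspaceT => v; apply: contM; [exact: cont_cst|exact: continuous_Im].
have gz' := gz; rewrite graph_zeta_fun in gz'; case: gz' => pz [z1 z2].
have cz : connected_component (preimage_Rpos a) z z by exact: connected_component_refl.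
move=> itv.
have no v (c : R) : connected_component (preimage_Rpos a) z v -> e * Im v = c ->
    (forall u, Qf u c != 0) -> False.
  move=> /sub /preimage_RposE[hQ _] ev h; have := h (uc v).
  by rewrite -ev Qf_sign// hQ mulr0 eqxx.
rewrite graph_zeta_fun; split => //; split; rewrite ltNge; apply/negP => h.
  have : ((fun z : C => e * Im z) @` connected_component (preimage_Rpos a) z) pi.
    by apply: (itv (e * Im w) (e * Im z)); [exists w|exists z|rewrite h ltW].
  by case=> v cv ev; apply: (no v pi cv ev) => u; rewrite Qf_pi oppr_eq0 gt_eqF.
have : ((fun z : C => e * Im z) @` connected_component (preimage_Rpos a) z) (2 * pi).
  by apply: (itv (e * Im z) (e * Im w)); [exists z|exists w|rewrite h ltW].
by case=> v cv ev; apply: (no v (2 * pi) cv ev) => u; rewrite Qf_2pi mulf_eq0 !gt_eqF.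
Qed.

Lemma zeta_fun_mono : strictly_monotonic setT zeta_fun.
Proof.
have h x y : x < y -> zeta0 (x + a - 1) < zeta0 (y + a - 1).
  by move=> xy; apply: zeta0_incr; lra.
case: he => E; [left|right] => x y _ _ /h; rewrite /zeta_fun E; lra.
Qed.

Lemma zeta_fun_ninfty : zeta_fun x @[x --> -oo] --> e * pi.
Proof.
have p0 := @pi_gt0 R.
apply/cvgrPdist_lt => eps eps0.
pose v := Num.min (pi + eps) (3 / 2 * pi).
have v1 : pi < v by rewrite lt_min; lra.
have v2 : v < 2 * pi by rewrite gt_min; apply/orP; right; lra.
have v3 : v <= pi + eps by rewrite ge_min lexx.
exists (kappa v + 1 - a); split; first exact: num_real.
move=> x xv; have [h1 h2 h3] := zeta0P (x + a - 1).
have h4 : zeta0 (x + a - 1) < v by rewrite gt_zeta0//; lra.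
rewrite /zeta_fun -mulrBr normrM (_ : `|e| = 1) ?mul1r; last by case: he => ->; rewrite ?normrN normr1.
by rewrite distrC gtr0_norm; lra.
Qed.

Lemma zeta_fun_pinfty : zeta_fun x @[x --> +oo] --> e * (2 * pi).
Proof.
have p0 := @pi_gt0 R.
apply/cvgrPdist_lt => eps eps0.
pose v := Num.max (2 * pi - eps) (3 / 2 * pi).
have v1 : pi < v by rewrite lt_max; apply/orP; right; lra.
have v2 : v < 2 * pi by rewrite gt_max; lra.
have v3 : 2 * pi - eps <= v by rewrite le_max lexx.
exists (kappa v + 1 - a); split; first exact: num_real.
move=> x xv; have [h1 h2 h3] := zeta0P (x + a - 1).
have h4 : v < zeta0 (x + a - 1) by rewrite lt_zeta0//; lra.
rewrite /zeta_fun -mulrBr normrM (_ : `|e| = 1) ?mul1r; last by case: he => ->; rewrite ?normrN normr1.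
by rewrite gtr0_norm; lra.
Qed.

(** Uniqueness uses the limit at minus infinity: it puts a point of the given component
    into the strip of height 0 to 2 pi, and far to the left Qf is negative below height
    pi. *)
Lemma zeta_zeta_fun j : (Num.sg j * (2 * `|j| - 1))%:~R = e -> (2 * j)%:~R = 2 * e ->
  zeta a j = zeta_fun.
Proof.
move=> j1 j2; have p0 := @pi_gt0 R; apply: xget_unique.
  split.
  - have g0 : graph setT zeta_fun (0 +i* zeta_fun 0 : C) by exists 0.
    exists (0 +i* zeta_fun 0); last by rewrite (component_graph_zeta_fun g0).
    by move: g0; rewrite graph_zeta_fun => -[].
  - exact: zeta_fun_mono.
  - by rewrite j1; exact: zeta_fun_ninfty.
  - by rewrite j2 -mulrA mulrCA; exact: zeta_fun_pinfty.
move=> phi [[z pz gz] _ hn _].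
have [x [x1 x2 x3]] : exists x, [/\ x + a - 1 <= -1, 0 < e * phi x & e * phi x < 2 * pi].
  move: hn; rewrite j1 => /cvgrPdist_lt /(_ pi p0) [M [_ hM]].
  exists (Num.min (M - 1) (- a)).
  have h1 : Num.min (M - 1) (- a) < M by rewrite gt_min; apply/orP; left; lra.
  have h2 : Num.min (M - 1) (- a) <= - a by rewrite ge_min lexx orbT.
  set x := Num.min _ _ in h1 h2 *; have := hM _ h1.
  have -> : e * pi - phi x = e * (pi - e * phi x).
    by rewrite mulrBr mulrA ee mul1r.
  rewrite normrM (_ : `|e| = 1) ?mul1r; last by case: he => ->; rewrite ?normrN normr1.
  by rewrite ltr_distlC => /andP[h3 h4]; split; lra.
have pc : graph setT phi (x +i* phi x : C) by exists x.
have pp : preimage_Rpos a (x +i* phi x) by move: pc; rewrite gz => /connected_component_sub.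
have x4 : pi < e * phi x.
  rewrite ltNge; apply/negP => h; have := Qf_left x1 x2 h.
  by rewrite Qf_sign//; have [/= -> _] := (preimage_RposE _).1 pp; rewrite mulr0 ltxx.
have gx : graph setT zeta_fun (x +i* phi x) by rewrite graph_zeta_fun; split.
have e1 : graph setT phi = graph setT zeta_fun.
  rewrite gz -(component_graph_zeta_fun gx); apply: same_connected_component.
  by rewrite gz in pc.
apply/funext => t; have : graph setT phi (t +i* phi t : C) by exists t.
by rewrite e1 => -[t' _ [-> ->]].
Qed.

End OneSign.

Lemma zeta_1 : zeta a 1 = zeta_fun 1.
Proof. by apply: zeta_zeta_fun; [left|rewrite sgr1 normr1|rewrite mulr1]. Qed.

Lemma zeta_N1 : zeta a (- 1) = zeta_fun (- 1).
Proof.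
apply: zeta_zeta_fun; first by right.
  by rewrite sgrN sgr1 normrN normr1.
by rewrite mulrN1 mulrN1.
Qed.

Lemma zeta_curvesE : zeta_curves a = zeta_locus a.
Proof.
have p0 := @pi_gt0 R.
rewrite /zeta_curves zeta_1 zeta_N1 !graph_zeta_fun; [|by right|by left].
apply/seteqP; split=> z.
  move=> [[/preimage_RposE[hQ _] [h1 h2]]|[/preimage_RposE[hQ _] [h1 h2]]].
    have y0 : 0 <= Im z by lra.
    by split; rewrite /qa (ger0_norm y0)//; lra.
  have y0 : Im z <= 0 by lra.
  by split; rewrite /qa (ler0_norm y0) ?QfN ?hQ ?oppr0//; lra.
move=> [h1 h2]; rewrite /qa => hQ.
have [y0|y0] := leP 0 (Im z); [left|right].
  rewrite (ger0_norm y0) in h1 h2 hQ.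
  split; last by lra.
  by apply/preimage_RposE; split => //; apply: Pf_pos_high.
have hh := Pf_pos_high h1 h2 hQ.
rewrite (ltr0_norm y0) in h1 h2 hQ hh.
split; last by lra.
by apply/preimage_RposE; split; [rewrite -[LHS]opprK -QfN hQ oppr0|rewrite -PfN].
Qed.

Lemma zeta_regionE (z : C) : zeta_region a z <-> `|Im z| < zeta0 (uc z).
Proof. by rewrite /zeta_region/= zeta_1 zeta_N1 /zeta_fun mul1r mulN1r ltr_norml. Qed.

Lemma Pf_neg_low u v : 0 < v -> v < pi -> Qf u v = 0 ->
  a * expR (u + 1) * Pf u v < - a.
Proof.
move=> h1 h2 hQ; have s0 := sin_gt0 h1 h2; have s1 := sin_lt_id h1.
have hu : -1 < u.
  by rewrite ltNge; apply/negP => hu; have := Qf_left hu h1 (ltW h2); lra.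
have hP : Pf u v = - (v / sin v).
  apply/eqP; rewrite -subr_eq0 -(mulIr_eq0 _ (rregP (lt0r_neq0 s0))) opprK.
  have -> : (Pf u v + v / sin v) * sin v = Qf u v * cos v - v * (cos v ^+ 2 + sin v ^+ 2) + v.
    by rewrite /Pf /Qf; field; rewrite gt_eqF.
  by rewrite hQ cos2Dsin2; apply/eqP; ring.
rewrite hP mulrN ltrN2 -mulrA ltr_pMr//.
have h3 : 1 < v / sin v by rewrite ltr_pdivlMr// mul1r.
have h4 : 1 < expR (u + 1) by rewrite expR_gt1; lra.
by nra.
Qed.

(** On the level curve inside the zeta curves the value of f_a is - a e^(u+1) y / sin y,
    which is below - a because e^(u+1) > 1 and y > sin y. Real points are excluded since
    a u e^(u+1) attains its minimum - a only at the fixed point. *)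
Lemma negative_preimage (z : C) : zeta_region a z ->
  (real_complex R @` `]-oo, - a[) (f a z) <->
  [/\ Im z != 0, `|Im z| < pi & qa a z = 0].
Proof.
move=> /zeta_regionE hz; have p0 := @pi_gt0 R.
have [zt1 zt2 zt3] := zeta0P (uc z).
have e0 : 0 < a * expR (Re z + a) by rewrite mulr_gt0// expR_gt0.
have eu : uc z + 1 = Re z + a by ring.
split.
  case=> r /=; rewrite in_itv/= => r0 rz.
  have hR := Re_f a z; have hI := Im_f a z; rewrite -rz /= in hR hI.
  have hQ : Qf (uc z) (Im z) = 0.
    by apply/eqP; rewrite -(mulrI_eq0 _ (lregP (lt0r_neq0 e0))) -hI.
  have hq : qa a z = 0.
    rewrite /qa; case: (lerP 0 (Im z)) => h; first by rewrite ger0_norm.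
    by rewrite ltr0_norm// QfN hQ oppr0.
  have y0 : Im z != 0.
    apply/eqP => y0; move: hR; rewrite y0 /Pf sin0 cos0 mulr0 subr0 mulr1 -eu expRD => hR.
    have := expR_ge1Dx (- (uc z + 1)); rewrite expRN expRD.
    have : 0 < expR (uc z) * expR 1 by rewrite mulr_gt0 ?expR_gt0.
    set E := expR _ * expR 1 in hR *; move=> E0.
    move=> h; have hEU : E * uc z < -1 by rewrite -(ltr_pM2l a0); lra.
    have : E * (1 - (uc z + 1)) <= E * E^-1 by apply: ler_wpM2l => //; exact: ltW.
    by rewrite mulfV ?gt_eqF//; lra.
  split => //; rewrite ltNge; apply/negP; rewrite le_eqVlt => /orP[/eqP h|h].
    by move: hq; rewrite /qa -h Qf_pi; lra.
  have h2 : `|Im z| < 2 * pi by lra.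
  by move: hz; rewrite lt_zeta0// -Qf_high_lt// -/(qa a z) hq ltxx.
move=> [y0 hp hq].
have hQ : Qf (uc z) (Im z) = 0.
  move: hq; rewrite /qa; case: (lerP 0 (Im z)) => h; first by rewrite ger0_norm.
  by rewrite ltr0_norm// QfN => /eqP; rewrite oppr_eq0 => /eqP.
have yp : 0 < `|Im z| by rewrite normr_gt0.
exists (a * expR (Re z + a) * Pf (uc z) (Im z)); last first.
  by rewrite (ReImE (f a z)) Re_f Im_f hQ mulr0.
rewrite /= in_itv/= -[in expR _]eu.
have := Pf_neg_low yp hp hq; have [h|h] := leP 0 (Im z); first by rewrite ger0_norm.
by rewrite ltr0_norm// PfN.
Qed.

Definition eta_fun (x : R) := eta0 (x + a - 1).

Lemma eta_set : zeta_region a `&` f a @^-1` (real_complex R @` `]-oo, - a[) =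
  [set z : C | [/\ Im z != 0, `|Im z| < pi & qa a z = 0]].
Proof.
apply/seteqP; split=> z; first by case=> /negative_preimage h /h.
move=> h; have hz : zeta_region a z.
  by apply/zeta_regionE; have [_ h2 _] := h; have [z1 _ _] := zeta0P (uc z); lra.
by split => //; apply/(negative_preimage hz).
Qed.

Lemma eta_fun_incr x y : - a < x -> x < y -> eta_fun x < eta_fun y.
Proof. by move=> h1 h2; apply: eta0_incr; lra. Qed.

Lemma eta_fun_gt0 x : - a < x -> 0 < eta_fun x /\ eta_fun x < pi.
Proof. by move=> h; have [] := @eta0P R (x + a - 1) _; first lra. Qed.

Lemma mem_eta_set (z : C) : - a < Re z ->
  [/\ Im z != 0, `|Im z| < pi & qa a z = 0] <-> (Im z = eta_fun (Re z) \/ Im z = - eta_fun (Re z)).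
Proof.
move=> h; have [e0 e1] := eta_fun_gt0 h; have hu : -1 < uc z by lra.
have [_ _ k3] := eta0P hu.
have q0 : Qf (uc z) (eta_fun (Re z)) = 0 by apply/eqP; rewrite Qf_low_eq// /eta_fun k3.
split=> [[h1 h2 h3]|[]hz].
- have : Im z = eta_fun (Re z) \/ - Im z = eta_fun (Re z); last by case=> hh; [left|right]; lra.
  have yp : 0 < `|Im z| by rewrite normr_gt0.
  move: h3 => /eqP; rewrite /qa Qf_low_eq// /eta_fun => /eqP ->; rewrite eta0_kappa//.
  by case: (lerP 0 (Im z)) => hh; [left; rewrite ger0_norm|right; rewrite ltr0_norm].
- by split; rewrite /qa ?hz ?gtr0_norm// gt_eqF.
- by split; rewrite /qa ?hz ?normrN ?gtr0_norm// oppr_eq0 gt_eqF.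
Qed.

Lemma is_eta_eta_fun : is_eta a (eta_fun, fun x => - eta_fun x).
Proof.
have p0 := @pi_gt0 R.
have l0 : eta_fun x @[x --> (- a)^'+] --> (0 : R).
  apply/cvgrPdist_lt => eps eps0; pose v := Num.min eps (pi / 2).
  have v0 : 0 < v by rewrite lt_min eps0; lra.
  have v1 : v < pi by rewrite gt_min; apply/orP; right; lra.
  have k0 := kappa_gtN1 v0 v1.
  have v2 : v <= eps by rewrite ge_min lexx.
  exists (kappa v + 1) => /=; first by lra.
  move=> x; rewrite /ball_/= => h1 h2; have [e0 e1] := eta_fun_gt0 h2.
  rewrite sub0r normrN gtr0_norm//; apply: lt_le_trans v2.
  rewrite /eta_fun gt_eta0//; last by lra.
  by move: h1; rewrite distrC gtr0_norm; lra.
have ly : eta_fun x @[x --> +oo] --> pi.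
  apply/cvgrPdist_lt => eps eps0; pose v := Num.max (pi - eps) (pi / 2).
  have v0 : 0 < v by rewrite lt_max; apply/orP; right; lra.
  have v1 : v < pi by rewrite gt_max; lra.
  have v2 : pi - eps <= v by rewrite le_max lexx.
  exists (Num.max (- a) (kappa v + 1 - a)); split; first exact: num_real.
  move=> x; rewrite gt_max => /andP[h1 h2]; have [e0 e1] := eta_fun_gt0 h1.
  have h3 : v < eta_fun x by rewrite /eta_fun lt_eta0//; lra.
  by rewrite gtr0_norm; lra.
have hin x : x \in (`]- a, +oo[%classic : set R) -> - a < x.
  by rewrite inE/= in_itv/= andbT.
split.
- rewrite eta_set; apply/seteqP; split=> z.
    move=> h; have hx : - a < Re z.
      rewrite ltNge; apply/negP => hx; case: h => h1 h2.
      by have := @Qf_left R (uc z) `|Im z|; rewrite normr_gt0 /qa => h /eqP; rewrite lt_eqF// h//; lra.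
    by case: ((mem_eta_set hx).1 h) => hz; [left|right];
      exists (Re z); rewrite /= ?in_itv/= ?hx// -hz -ReImE.
  by case=> -[x /=]; rewrite in_itv/= andbT => hx <-; apply/mem_eta_set => //=; [left|right].
- split; [left|right] => x y /hin hx /hin hy xy /=; rewrite ?ltrN2; exact: eta_fun_incr.
- by split => //; rewrite -[X in _ --> X]oppr0; apply: cvgN.
- by split => //; apply: cvgN.
Qed.

(** The union of the two graphs is prescribed by the preimage condition alone, whichever
    pair of functions is selected. *)
Lemma eta_curvesE : eta_curves a = eta_locus a.
Proof.
have he : is_eta a (etas a) by apply: (@xgetPex _ (cst 0, cst 0) [set phi | is_eta a phi]); exists (eta_fun, fun x => - eta_fun x); exact: is_eta_eta_fun.
have [hs _ _ _] := he; rewrite eta_set in hs.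
by rewrite /eta_curves -hs.
Qed.

Lemma T0E : (2 <= a) -> T0 a = region0 a.
Proof.
move=> a2; have z0 : region0 a 0 by split => /=; rewrite ?normr0 ?pi_gt0 ?eqxx//; lra.
apply: xget_unique.
  split => //; [exact: open_region0|exact: connected_region0|].
  by rewrite boundary_region0 eta_curvesE.
move=> U [oU cU U0 bU]; apply: open_connected_eq => //.
- exact: open_region0.
- exact: connected_region0.
- by exists 0.
- by rewrite bU boundary_region0 eta_curvesE.
Qed.

(** The boundary does not obviously force U to meet the explicit region. But a U
    disjoint from it has no point of height pi or - pi, while its boundary contains - a
    and a point of zeta_1; so the connected set of heights of U would contain points on
    both sides of pi and miss pi. *)
Lemma T1E : T1 a = region1 a.
Proof.
have p0 := @pi_gt0 R.
apply: xget_unique.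
  split; [exact: open_region1|exact: connected_region1|].
  by rewrite boundary_region1 eta_curvesE zeta_curvesE.
move=> U [oU cU]; rewrite eta_curvesE zeta_curvesE => bU.
have dU z : U z -> ~ (zeta_locus a `|` eta_locus a) z.
  by rewrite -bU boundary_open// => h [].
have cUz z : (zeta_locus a `|` eta_locus a) z -> closure U z.
  by rewrite -bU boundary_open// => -[].
pose v := 3 / 2 * pi.
have v1 : pi < v by rewrite /v; lra.
have v2 : v < 2 * pi by rewrite /v; lra.
pose zv : C := (kappa v + 1 - a) +i* v.
have hzv : zeta_locus a zv.
  have vp : `|v| = v by rewrite gtr0_norm; lra.
  split; rewrite /qa /= vp//; apply/eqP; rewrite Qf_high_eq//; apply/eqP; ring.
have aC : eta_locus a (- a)%:C by right.
have [[x0 [Ux0 T1x]]|nT1] := pselect (exists x, U x /\ region1 a x).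
  apply: open_connected_eq => //; [exact: open_region1|exact: connected_region1|by exists x0|].
  by rewrite bU boundary_region1.
exfalso.
have {}nT1 x : U x -> ~ region1 a x by move=> Ux Tx; apply: nT1; exists x.
have no_pi x : U x -> `|Im x| <> pi.
  move=> Ux e; apply: (nT1 x) => //; split; rewrite ?e; [|lra|].
    by move=> e0; move: e; rewrite e0 normr0; lra.
  by rewrite /qa e Qf_pi; lra.
have itv : is_interval ((fun z : C => `|Im z|) @` U).
  apply/connected_intervalP; apply: connected_continuous_connected => //.
  by apply: continuous_subspaceT => z; exact: continuous_aIm.
(* the two boundary points force [U] on both sides of height [pi] *)
have [x1 [Ux1 h1]] : exists x, U x /\ `|Im x| < pi.
  have n : nbhs ((- a)%:C : C) [set w : C | `|Im w| < pi].
    by apply: near_lt; [exact: continuous_aIm|rewrite /= normr0].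
  by have [w [Uw hw]] := cUz _ (or_intror aC) _ n; exists w.
have [x2 [Ux2 h2]] : exists x, U x /\ pi < `|Im x|.
  have n : nbhs zv [set w : C | pi < `|Im w|].
    by apply: near_gt; [exact: continuous_aIm|rewrite /= gtr0_norm; lra].
  by have [w [Uw hw]] := cUz _ (or_introl hzv) _ n; exists w.
have : ((fun z : C => `|Im z|) @` U) pi.
  by apply: (itv `|Im x1| `|Im x2|); [exists x1|exists x2|rewrite !ltW].
by case=> x Ux /no_pi.
Qed.

End Identify.

(** * Inverse branches *)

Section Branches.
Variables (R : realType) (a : R) (ha : 3 <= a).
Local Notation C := (R[i]^o).
Local Notation Re := (@complex.Re R).
Local Notation Im := (@complex.Im R).
Local Notation pi := (@pi R).
Local Notation uc z := (Re z + a - 1).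

Let a0 : 0 < a. Proof. by move: ha; lra. Qed.

(** The sign of the imaginary part on the part of symbol s. *)
Definition sgn (s : Asymbol) : R := match s with A01 | A11 => -1 | A02 | A12 => 1 end.
(** A part of T_0 is mapped to the half-plane on its own side, a part of T_1 to the
    opposite one. *)
Definition digit_sgn (d : bool) : R := if d then -1 else 1.
Definition next_sgn s := sgn s * digit_sgn (digit s).

Lemma sgnP s : sgn s = 1 \/ sgn s = -1.
Proof. by case: s; [right|left|right|left]. Qed.

Lemma sgn_sq s : sgn s * sgn s = 1. Proof. by case: s => /=; ring. Qed.

Lemma next_sgn_sq s : next_sgn s * next_sgn s = 1. Proof. by case: s; rewrite /next_sgn /=; ring. Qed.

Lemma transitionP s s' : transition s s' <-> sgn s' = next_sgn s.
Proof.
by case: s; case: s'; rewrite /next_sgn /digit_sgn /=; split => // h; first [exfalso; lra | lra].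
Qed.

Definition piece s : set C := [set z | reg (digit s) (uc z) (sgn s * Im z)].
Definition half_plane s : set C := [set z | 0 < next_sgn s * Im z].

Lemma sgn_norm s y : 0 < sgn s * y -> `|y| = sgn s * y.
Proof.
by case: (sgnP s) => ->; rewrite ?mul1r ?mulN1r => h; [rewrite gtr0_norm|rewrite ltr0_norm//; lra].
Qed.

Lemma TpartE s : Tpart a s = piece s.
Proof.
have p0 := @pi_gt0 R; have a3 := ha; have T1e := T1E a0.
have T0e : T0 a = region0 a by apply: T0E => //; lra.
have hT : Tpart a s = (if digit s then region1 a else region0 a) `&` [set z | 0 < sgn s * Im z].
  case: s; rewrite /= ?T0e ?T1e; apply/seteqP; split => z /= [h1 h2]; split => //; lra.
rewrite hT; apply/seteqP; split=> z.
  move=> [hz hs]; have e := sgn_norm hs.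
  have y0 : Im z != 0 by rewrite -normr_gt0 e.
  rewrite /piece /reg /=; case: (digit s) hz => -[h1 h2 h3]; split => //; rewrite -?e//; exact: h3.
move=> hz; have hs : 0 < sgn s * Im z by move: hz; rewrite /piece /reg /=; case: (digit s) => -[].
split => //; have e := sgn_norm hs.
have y0 : Im z != 0 by rewrite -normr_gt0 e.
move: hz; rewrite /piece /reg /= -e; case: (digit s) => -[h1 h2 h3]; split => //.
  by move=> y; rewrite y eqxx in y0.
by rewrite ltNge; apply/negP => hu; have := Qf_left hu h1 (ltW h2); lra.
Qed.

Lemma Qf_sgn s u y : Qf u (sgn s * y) = sgn s * Qf u y.
Proof. by apply: Qf_sign; exact: sgnP. Qed.

Lemma Pf_sgn s u y : Pf u (sgn s * y) = Pf u y.
Proof. by apply: Pf_sign; exact: sgnP. Qed.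

Lemma aexp_gt0 x : 0 < a * expR x. Proof. by rewrite mulr_gt0 ?expR_gt0. Qed.

Lemma f_coordE z : f a z = (a * expR 1 * (expR (uc z) * Pf (uc z) (Im z))) +i*
   (a * expR 1 * (expR (uc z) * Qf (uc z) (Im z))).
Proof.
rewrite (ReImE (f a z)) Re_f Im_f.
have -> : expR (Re z + a) = expR 1 * expR (uc z) by rewrite -expRD; congr expR; ring.
by congr (_ +i* _); ring.
Qed.

Lemma f_inj s z z' : piece s z -> piece s z' -> f a z = f a z' -> z = z'.
Proof.
move=> hz hz'; rewrite !f_coordE => -[hP hQ].
have k0 : a * expR 1 != 0 by rewrite gt_eqF ?aexp_gt0.
have {}hP := mulfI k0 hP; have {}hQ := mulfI k0 hQ.
have [||h1 h2] := reg_inj hz hz'; rewrite ?Pf_sgn ?Qf_sgn//.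
  by rewrite mulrCA hQ mulrCA.
rewrite (ReImE z) (ReImE z'); congr (_ +i* _); first by lra.
by rewrite -[LHS]mul1r -(sgn_sq s) -mulrA h2 mulrA sgn_sq mul1r.
Qed.

Lemma f_surj s (w : C) : half_plane s w -> exists z, piece s z /\ f a z = w.
Proof.
move=> hw; have k0 : 0 < a * expR 1 := aexp_gt0 1.
have [u [y [hr hP hQ]]] : exists u y, [/\ reg (digit s) u y,
    expR u * Pf u y = Re w / (a * expR 1) & expR u * Qf u y = sgn s * Im w / (a * expR 1)].
  apply: reg_surj; move: hw; rewrite /half_plane /next_sgn /digit_sgn /=; case: (digit s) => h.
    by rewrite pmulr_llt0 ?invr_gt0//; lra.
  by rewrite divr_gt0//; lra.
pose z : C := (u + 1 - a) +i* (sgn s * y).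
have eu : uc z = u by rewrite /z /=; ring.
exists z; split.
  by rewrite /piece /= mulrA sgn_sq mul1r (_ : u + 1 - a + a - 1 = u)//; ring.
rewrite f_coordE eu (ReImE w) /=; congr (_ +i* _).
  by rewrite Pf_sgn hP; field; rewrite gt_eqF// gt_eqF ?expR_gt0.
rewrite Qf_sgn [expR u * _]mulrCA hQ.
transitivity (sgn s * sgn s * Im w); last by rewrite sgn_sq mul1r.
by field; rewrite gt_eqF// gt_eqF ?expR_gt0.
Qed.

Lemma branchK s z : piece s z -> branch a s (f a z) = z.
Proof.
move=> hz; rewrite /branch TpartE; apply: pinvKV; last by rewrite inE.
by move=> x y; rewrite !inE => hx hy; exact: f_inj hx hy.
Qed.

Lemma branchP s w : half_plane s w -> piece s (branch a s w) /\ f a (branch a s w) = w.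
Proof. by move=> /f_surj [z [hz <-]]; rewrite branchK. Qed.

(** The modulus of f_a z is a e^(Re z + a) times the modulus of u + iy: rotation by y
    does not matter. *)
Lemma absC_f (z : C) : absC (f a z) = a * expR (Re z + a) * absC (uc z +i* Im z : C).
Proof.
rewrite -[a * _]gtr0_norm ?aexp_gt0// -(absCR (a * expR _)) /absC /= -sqrtrM; last first.
  by rewrite addr_ge0 ?sqr_ge0.
rewrite Re_f Im_f /Pf /Qf; congr Num.sqrt.
have := cos2Dsin2 (Im z); set c := cos _; set s := sin _ => h.
transitivity ((a * expR (Re z + a)) ^+ 2 * ((uc z) ^+ 2 * (c ^+ 2 + s ^+ 2) + (Im z) ^+ 2 * (c ^+ 2 + s ^+ 2))); first by ring.
by rewrite h; ring.
Qed.

Lemma piece_Im s z : piece s z -> `|Im z| < 2 * pi.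
Proof.
have p0 := @pi_gt0 R.
rewrite /piece /reg /=; case: (digit s) => -[h1 h2 _]; rewrite (sgn_norm h1)//; lra.
Qed.

(** The decay of f_a to the left, with half of the exponent spent on absorbing the
    linear factor. *)
Lemma absC_f_le_left z : `|Im z| < 8 -> uc z <= 0 -> absC (f a z) <= 16 * a * expR (1 + uc z / 2).
Proof.
move=> hy hu; rewrite absC_f.
have -> : expR (Re z + a) = expR (1 + uc z / 2) * expR (uc z / 2) by rewrite -expRD; congr expR; field.
have h1 : absC (uc z +i* Im z : C) <= 16 * expR (- (uc z / 2)).
  apply: le_trans (absC_le_add _) _ => /=; rewrite ler0_norm//.
  by have := expR_ge1Dx (- (uc z / 2)); lra.
have e1 := expR_gt0 (1 + uc z / 2); have e2 := expR_gt0 (uc z / 2).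
have h2 : expR (uc z / 2) * expR (- (uc z / 2)) = 1 by rewrite -expRD subrr expR0.
have : a * (expR (1 + uc z / 2) * expR (uc z / 2)) * absC (uc z +i* Im z : C) <=
       a * (expR (1 + uc z / 2) * expR (uc z / 2)) * (16 * expR (- (uc z / 2))).
  by rewrite ler_pM2l// !mulr_gt0.
have -> : a * (expR (1 + uc z / 2) * expR (uc z / 2)) * (16 * expR (- (uc z / 2))) =
   16 * a * expR (1 + uc z / 2) * (expR (uc z / 2) * expR (- (uc z / 2))) by ring.
by rewrite h2 mulr1.
Qed.

Lemma absC_f_ge z : 0 <= uc z -> a * expR (Re z + a) * uc z <= absC (f a z).
Proof.
move=> hu; rewrite absC_f ler_pM2l ?aexp_gt0//.
by apply: le_trans (normRe_le_absC _); rewrite /= ger0_norm.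
Qed.

Lemma absC_f_ge_lin z : 0 <= uc z -> uc z <= absC (f a z).
Proof.
move=> hu; have a3 := ha; apply: le_trans (absC_f_ge hu).
have e1 : 1 <= expR (Re z + a) by have := expR_ge1Dx (Re z + a); lra.
rewrite -[leLHS]mul1r ler_wpM2r//; nra.
Qed.

(** A closed condition that, together with [half_plane] for the image, characterises the
    part of symbol s; it allows one to pass to limits of orbits. *)
Definition cpiece s : set C := [set z | [/\ 0 <= sgn s * Im z,
  sgn s * Im z <= (if digit s then 2 * pi else pi) &
  0 <= digit_sgn (digit s) * (sgn s * Qf (uc z) (Im z))]].

Lemma piece_cpiece s : piece s `<=` cpiece s.
Proof.
move=> z; rewrite /piece /cpiece /reg /digit_sgn /= -Qf_sgn; case: (digit s) => -[h1 h2 h3]; split; lra.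
Qed.

Lemma closed_cpiece s : closed (cpiece s).
Proof.
move=> z cz; split.
- apply: (closure_ge (F := fun z : C => sgn s * Im z) _ _ cz) => [w|w []//].
  by apply: contM; [exact: cont_cst|exact: continuous_Im].
- apply: (closure_le (F := fun z : C => sgn s * Im z) _ _ cz) => [w|w []//].
  by apply: contM; [exact: cont_cst|exact: continuous_Im].
- apply: (closure_ge (F := fun z : C => digit_sgn (digit s) * (sgn s * Qf (uc z) (Im z))) _ _ cz) => [w|w []//].
  by apply: contM; [exact: cont_cst|apply: contM; [exact: cont_cst|exact: continuous_Qz]].
Qed.

(** Points of the closed piece outside the open one are real, or on a level curve, or at
    height pi or 2 pi; none of them is mapped into the required open half-plane. *)
Lemma cpiece_half_plane s z : cpiece s z -> half_plane s (f a z) -> piece s z.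
Proof.
have p0 := @pi_gt0 R.
move=> [h1 h2 _]; rewrite /half_plane /= Im_f mulrCA pmulr_rgt0 ?aexp_gt0//.
rewrite /next_sgn -mulrA [digit_sgn _ * _]mulrC mulrA -Qf_sgn => h3.
have n0 : sgn s * Im z != 0.
  by apply/eqP => e; move: h3; rewrite e Qf_0 mul0r ltxx.
have h4 : 0 < sgn s * Im z by rewrite lt_neqAle eq_sym n0.
rewrite /piece /reg /=; rewrite /digit_sgn in h3; case: (digit s) h2 h3 => h2 h3; split => //.
- rewrite lt_neqAle h2 andbT; apply/eqP => e; move: h3; rewrite e Qf_2pi; lra.
- by lra.
- rewrite lt_neqAle h2 andbT; apply/eqP => e; move: h3; rewrite e Qf_pi; lra.
- by lra.
Qed.

(** Compactness argument: outside a neighbourhood of z0, the closed piece cut to a large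
    box has compact image that misses w0, and bounds on the modulus of f_a keep the
    preimages of points near w0 in that box. *)
Lemma continuous_branch s (w0 : C) : half_plane s w0 -> continuous_at w0 (branch a s : C -> C).
Proof.
have a3 := ha.
move=> hw0; have [hz0 ez0] := branchP hw0; set z0 := branch a s w0 in hz0 ez0 *.
move=> A; rewrite -/z0 nbhsE => -[B [oB Bz0] BA].
have r0 : 0 < absC w0.
  by apply: lt_le_trans (normIm_le_absC w0); rewrite normr_gt0; apply: contraTneq hw0; rewrite /half_plane /= => ->; rewrite mulr0 ltxx.
set r := absC w0 in r0.
(* the preimages of points near [w0] stay in a compact box *)
pose U := r + 1.
pose L := 2 * ln (r / (32 * a)) - 2.
have q0 : 0 < r / (32 * a) by rewrite divr_gt0//; lra.
pose K := box (Num.min L (- 1) + 1 - a) (U + 1 - a) (- 8) 8 `&` (cpiece s `&` ~` B).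
have cK : compact K.
  apply: (@subclosed_compact _ K (box (Num.min L (- 1) + 1 - a) (U + 1 - a) (- 8) 8)).
  - apply: closedI; last by apply: closedI; [exact: closed_cpiece|exact: open_closedC].
    by apply: compact_closed; [exact: hausdorffC|exact: compact_box].
  - exact: compact_box.
  - by move=> z [].
have cfK : closed (f a @` K).
  apply: compact_closed; first exact: hausdorffC.
  by apply: continuous_compact => //; apply: continuous_subspaceT; exact: continuous_f.
have nK : ~ (f a @` K) w0.
  move=> [z [_ [zc nB]] fz]; have hz : piece s z by apply: cpiece_half_plane zc _; rewrite fz.
  by apply: nB; rewrite (_ : z = z0)//; apply: f_inj hz hz0 _; rewrite fz ez0.
have n1 : nbhs w0 (~` (f a @` K)) by apply: open_nbhs_nbhs; split => //; exact: closed_openC.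
have n2 : nbhs w0 [set w | half_plane s w].
  apply: near_gt => //; first by apply: contM; [exact: cont_cst|exact: continuous_Im].
have n3 : nbhs w0 [set w | absC (w - w0) < Num.min 1 (r / 2)].
  by apply: nbhs_absC_lt; rewrite lt_min ltr01 divr_gt0.
apply: filterS3 n1 n2 n3 => w /= w1 w2; rewrite lt_min => /andP[w3 w4].
have [hz ez] := branchP w2; set z := branch a s w in hz ez *.
apply: BA; apply: contrapT => nB; apply: w1; exists z => //.
have hp := @pi_lt4 R; have hI := piece_Im hz.
split; last by split => //; exact: piece_cpiece.
have d1 := absC_dist w w0; have d2 := absC_dist w0 w; rewrite absC_distC -/r in d2.
rewrite -/r in d1.
split; last by move: hI; rewrite ltr_norml => /andP[]; lra.
apply/andP; split.
  suff : Num.min L (- 1) <= uc z by lra.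
  rewrite leNgt; apply/negP; rewrite lt_min => /andP[k1 k2].
  have := @absC_f_le_left z _ _; rewrite ez => h.
  have {}h : absC w <= 16 * a * expR (1 + uc z / 2) by apply: h; lra.
  have : expR (1 + uc z / 2) < r / (32 * a).
    rewrite -[ltRHS]lnK ?posrE// ltr_expR; rewrite /L in k1; lra.
  rewrite ltr_pdivlMr; last by lra.
  by move=> h2; lra.
have [k|k] := leP (uc z) 0; first by rewrite /U; lra.
have := absC_f_ge_lin (ltW k); rewrite ez /U; lra.
Qed.

End Branches.

(** * Linear approximation and expansion *)

Section Expansion.
Variables (R : realType) (a : R) (ha : 3 <= a).
Local Notation C := (R[i]^o).
Local Notation Re := (@complex.Re R).
Local Notation Im := (@complex.Im R).
Local Notation pi := (@pi R).
Local Notation uc z := (Re z + a - 1).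

Lemma expR_lin_ge (x : R) : 1 + x <= expR (x + a).
Proof. by have a3 := ha; have := expR_ge1Dx (x + a); lra. Qed.

(** The height to which a point of the part of symbol s is forced when it lies far to
    the right and its image has positive real part and bounded height. *)
Definition axis (s : Asymbol) : R := if digit s then sgn R s * (2 * pi) else 0.

(** The ratio of |Q| to P is small, so u + iy times e^(iy) has argument near 0, and y is
    a multiple of 2 pi up to an error of order 1 / u; positivity of P excludes heights
    near pi. *)
Lemma near_axis s z : piece a s z -> 100 <= uc z -> 0 < Re (f a z) -> `|Im (f a z)| <= 8 ->
  `|Im z - axis s| <= 40 / uc z.
Proof.
have a3 := ha; have p0 := @pi_ge2 R; have p4 := @pi_lt4 R => hz hu.
have e0 : 100 <= expR (Re z + a) by have := expR_ge1Dx (Re z + a); lra.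
have k0 : 100 <= a * expR (Re z + a) by nra.
have uV : 0 < (uc z)^-1 by rewrite invr_gt0; lra.
have uK : uc z * (uc z)^-1 = 1 by rewrite mulfV// gt_eqF//; lra.
rewrite Re_f Im_f pmulr_rgt0; last by lra.
rewrite normrM gtr0_norm; last by lra.
have -> : `|Qf (uc z) (Im z)| = `|Qf (uc z) (sgn R s * Im z)|.
  by rewrite Qf_sgn; case: (sgnP R s) => ->; rewrite ?mul1r ?mulN1r ?normrN.
rewrite -(Pf_sgn s) => hP hI.
have -> : `|Im z - axis s| = `|sgn R s * Im z - (if digit s then 2 * pi else 0)|.
  rewrite -[LHS]mul1r -[X in X * _](_ : `|sgn R s| = 1); last first.
    by case: (sgnP R s) => ->; rewrite ?normrN normr1.
  rewrite -normrM mulrBr /axis; case: (digit s); rewrite ?mulr0//.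
  by rewrite (mulrA (sgn R s) (sgn R s)) sgn_sq mul1r.
move: hz hP hI; rewrite /piece /reg /=; set y := sgn R s * Im z; set u := uc z in hu uV uK *.
have sc := cos2Dsin2 y.
case: (digit s) => -[h1 h2 h3] hP hI.
  have hQ : - Qf u y <= 1.
    by rewrite ltr0_norm// in hI; nra.
  have y1 : pi < y.
    rewrite ltNge; apply/negP => h4; have s0 : 0 <= sin y by apply: sin_ge0_pi; lra.
    have c0 : 0 < cos y.
      rewrite ltNge; apply/negP => c0; move: hP; rewrite /Pf.
      have := mulr_ge0 (ltW h1) s0; have : u * cos y <= 0 by apply: mulr_ge0_le0; lra.
      lra.
    by move: h3; rewrite /Qf; nra.
  pose v := 2 * pi - y; have ey : y = 2 * pi - v by rewrite /v; ring.
  have hs : sin y = - sin v by rewrite ey sin_2pi_sub.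
  have hc : cos y = cos v by rewrite ey cos_2pi_sub.
  have v0 : 0 < v by rewrite /v; lra.
  have v1 : v < pi by rewrite /v; lra.
  have s0 := sin_gt0 v0 v1.
  rewrite /Pf /Qf hs hc in hP hQ; have c1 := cos_le1 v.
  have s1 : u * sin v <= 9 by nra.
  have s2 : sin v <= 9 / u by rewrite ler_pdivlMr//; lra.
  have v2 : v <= pi / 2.
    rewrite leNgt; apply/negP => h; have c0 : cos v < 0 by apply: cos_lt0 => //; lra.
    have cc := cos2Dsin2 v; nra.
  have := sin_ge_quarter (ltW v0) v2.
  rewrite ler0_norm; last by rewrite /v in v0; lra.
  rewrite /v in s2 v0 *; lra.
have hQ : Qf u y <= 1 by rewrite gtr0_norm// in hI; nra.
have s0 := sin_gt0 h1 h2.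
have c0 : 0 < cos y.
  rewrite ltNge; apply/negP => c0; move: hP; rewrite /Pf.
  have := mulr_gt0 h1 s0; have : u * cos y <= 0 by apply: mulr_ge0_le0; lra.
  lra.
have y2 : y <= pi / 2 by rewrite leNgt; apply/negP => h; have := @cos_lt0 R y; lra.
have s2 : sin y <= 1 / u.
  rewrite ler_pdivlMr; last by lra.
  by move: hQ; rewrite /Qf; nra.
have := sin_ge_quarter (ltW h1) y2.
by rewrite subr0 gtr0_norm//; lra.
Qed.

Lemma near_diff s z z' v : piece a s z -> piece a s z' -> 100 <= v -> v <= uc z -> v <= uc z' ->
  0 < Re (f a z) -> 0 < Re (f a z') -> `|Im (f a z)| <= 8 -> `|Im (f a z')| <= 8 ->
  `|Im z - Im z'| <= 80 / v.
Proof.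
move=> h1 h2 v0 hv hv' p1 p2 q1 q2.
have k1 := near_axis h1 (le_trans v0 hv) p1 q1.
have k2 := near_axis h2 (le_trans v0 hv') p2 q2.
have l1 : 40 / uc z <= 40 / v by rewrite ler_pM2l// lef_pV2// ?posrE; lra.
have l2 : 40 / uc z' <= 40 / v by rewrite ler_pM2l// lef_pV2// ?posrE; lra.
have -> : Im z - Im z' = (Im z - axis s) - (Im z' - axis s) by ring.
by apply: le_trans (ler_normB _ _) _; lra.
Qed.

Local Notation W z := (uc z +i* Im z : C).

Lemma fWE (z : C) : f a z = a%:C * W z * cexp (z + a%:C).
Proof.
rewrite /f; congr (_ * _ * _); case: z => x y /=.
by apply/eqP; rewrite eq_complex/=; apply/andP; split; apply/eqP; ring.
Qed.

Lemma cexpD (z w : C) : cexp (z + w) = cexp z * cexp w.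
Proof.
case: z => x y; case: w => p q; rewrite /cexp /= expRD cosD sinD.
by apply/eqP; rewrite eq_complex/=; apply/andP; split; apply/eqP; ring.
Qed.

Lemma absC_cexp (z : C) : absC (cexp z) = expR (Re z).
Proof.
rewrite /cexp absCM absCR gtr0_norm ?expR_gt0// /absC /= cos2Dsin2 sqrtr1 mulr1//.
Qed.

(** Taylor expansion with exact remainder: replace z' by z - D in the product formula.
    Both terms are then small multiples of f_a z when D is small and u is large. *)
Lemma f_sub (z z' : C) : f a z - f a z' =
  f a z * (1 - cexp (- (z - z'))) + a%:C * cexp (z + a%:C) * cexp (- (z - z')) * (z - z').
Proof.
have e : cexp (z' + a%:C) = cexp (z + a%:C) * cexp (- (z - z')).
  by rewrite -cexpD; congr cexp; rewrite opprB addrCA [z + _]addrC addrAC subrK addrC.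
have eW : W z' = W z - (z - z').
  by case: z {e} => x y; case: z' => x' y' /=; apply/eqP; rewrite eq_complex/=; apply/andP; split; apply/eqP; ring.
rewrite !fWE e eW; set E := cexp _; set F := cexp _; set D := z - z'; set w := W z; set b := a%:C; ring.
Qed.

(** The restriction Re D >= 0 makes e^(- Re D) (1 + Re D) bounded by 1, so the linear
    quantity on the left is dominated by the real and imaginary parts of 1 - e^(-D). *)
Lemma absC_exp_sub (D : C) : 0 <= Re D -> `|Im D| <= 1 ->
  expR (- Re D) * absC D <= 8 * absC (1 - cexp (- D)).
Proof.
case: D => A B /= A0 B1.
have e0 := expR_gt0 (- A).
have eA : expR (- A) * (1 + A) <= 1.
  have := ler_wpM2l (ltW e0) (expR_ge1Dx A); rewrite -expRD addNr expR0; lra.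
have k1 := normRe_le_absC (1 - cexp (- (A +i* B : C))).
have k2 := normIm_le_absC (1 - cexp (- (A +i* B : C))).
set N := absC _ in k1 k2 *.
have r1 : expR (- A) * A <= N.
  apply: le_trans k1; apply: le_trans (ler_norm _); rewrite /= cosN.
  have : expR (- A) * cos B <= expR (- A) by rewrite -[leRHS]mulr1 ler_pM2l// cos_le1.
  by rewrite !mul0r; lra.
have r2 : expR (- A) * (`|B| / 4) <= N.
  apply: le_trans k2; rewrite /= sinN !mul0r.
  have -> : 0 - (expR (- A) * - sin B + 0) = expR (- A) * sin B by ring.
  rewrite normrM gtr0_norm// ler_pM2l//.
  have := @sin_ge_quarter R `|B| (normr_ge0 _); have := @pi_ge2 R => p0 h.
  have {}h := h ltac:(lra); apply: le_trans h _.
  have [hB|hB] := leP 0 B; first by rewrite (ger0_norm hB) ler_norm.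
  by rewrite (ltr0_norm hB) sinN -normrN ler_norm.
have r3 : absC (A +i* B : C) <= A + `|B|.
  by apply: le_trans (absC_le_add _) _; rewrite /= ger0_norm.
have : expR (- A) * absC (A +i* B : C) <= expR (- A) * (A + `|B|) by rewrite ler_pM2l.
by have := normr_ge0 B; nra.
Qed.

(** By symmetry Re z >= Re z'. The second term of [f_sub] has modulus a e^(Re z' + a)
    |D|, and the first one is at least twice as large because |u + iy| >= 16. *)
Lemma expansion (z z' : C) : 16 <= uc z -> 16 <= uc z' -> `|Im z - Im z'| <= 1 ->
  2 * absC (z - z') <= absC (f a z - f a z').
Proof.
have a3 := ha.
wlog A0 : z z' / Re z' <= Re z.
  move=> hw; have [h|h] := leP (Re z') (Re z); first exact: hw.
  move=> h1 h2 h3; rewrite absC_distC [leRHS]absC_distC; apply: hw => //; first exact: ltW.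
  by rewrite distrC.
move=> u1 u2 hB; rewrite f_sub.
set D := z - z'.
have DA : Re D = Re z - Re z' by rewrite ReB.
have k := @absC_exp_sub D; rewrite DA ImB in k; have {}k := k ltac:(lra) hB.
have hE : absC (cexp (z + a%:C)) = expR (Re z + a) by rewrite absC_cexp ReD.
have hF : absC (cexp (- D)) = expR (- (Re z - Re z')) by rewrite absC_cexp -DA; case: (D).
have hf := absC_f ha z.
move: (cexp (z + a%:C)) (f a z) hE hf => E1 f1 hE hf.
set F1 := cexp _ in hF k *; clearbody F1.
have t1 := absC_dist (f1 * (1 - F1)) (- (a%:C * E1 * F1 * D)).
rewrite absCN opprK in t1; apply: le_trans t1.
rewrite !absCM absCR gtr0_norm; last by lra.
rewrite hE hF hf.
set E := expR (Re z + a); set F := expR (- (Re z - Re z')) in k *.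
have eEF : E * F = expR (Re z' + a) by rewrite -expRD; congr expR; ring.
have EF : 16 <= E * F by rewrite eEF; have := expR_ge1Dx (Re z' + a); lra.
have w16 : 16 <= absC (W z).
  by apply: le_trans (normRe_le_absC _); rewrite /= ger0_norm; lra.
have D0 := absC_ge0 D; have E0 : 0 < E := expR_gt0 _.
set N := absC (1 - _) in k *; set w := absC (W z) in w16 *; set d := absC D in D0 k *.
have N0 : 0 <= N := absC_ge0 _.
have s1 : a * E * 16 * N <= a * E * w * N.
  by rewrite ler_wpM2r// ler_pM2l// mulr_gt0//; lra.
have s2 : a * E * (F * d) <= a * E * (8 * N) by rewrite ler_pM2l// mulr_gt0//; lra.
have s3 : 2 * d <= a * (E * F) * d by rewrite ler_wpM2r//; nra.
by nra.
Qed.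

Lemma linear_approx (z z' : C) : 1 <= uc z -> `|Re z - Re z'| <= 1 / 2 ->
  `|Im z - Im z'| <= 1 / 2 ->
  absC (f a z - f a z' - f a z * (z - z')) <=
    absC (f a z) * (absC (z - z') * (5 * absC (z - z') + 2 / uc z)).
Proof.
have a3 := ha; move=> hu hA hB; rewrite f_sub; set D := z - z'.
have DA : Re D = Re z - Re z' by rewrite ReB.
have DB : Im D = Im z - Im z' by rewrite ImB.
have hE : absC (cexp (z + a%:C)) = expR (Re z + a) by rewrite absC_cexp ReD.
have hF : absC (cexp (- D)) = expR (- Re D) by rewrite absC_cexp; case: (D).
move: (cexp (z + a%:C)) hE => E1 hE.
suff key : absC (f a z * (1 - cexp (- D) - D)) + absC (a%:C * E1 * cexp (- D) * D) <=
    absC (f a z) * (absC D * (5 * absC D + 2 / uc z)).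
  apply: le_trans key; apply: le_trans (absC_triangle _ _).
  rewrite le_eqVlt; apply/orP; left; apply/eqP; congr absC.
  by set F1 := cexp _; set f1 := f a z; ring.
have -> : absC (a%:C * E1 * cexp (- D) * D) = a * expR (Re z + a) * expR (- Re D) * absC D.
  by rewrite 2!absCM hF absCM hE absCR gtr0_norm//; lra.
rewrite absCM.
have e1 : expR (- Re D) <= 2.
  have := @expR_near R (- Re D); rewrite normrN DA => /(_ hA); rewrite ler_norml.
  by move: hA; rewrite ler_norml; nra.
have d2 := absC_sq D; have d0 := absC_ge0 D.
have e2 : absC (1 - cexp (- D) - D) <= 5 * absC D ^+ 2.
  apply: le_trans (absC_le_add _) _; rewrite d2.
  have hA2 : `|- Re D| <= 1 / 2 by rewrite normrN DA.
  have hB2 : `|Im D| <= 1 by rewrite DB; lra.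
  have k1 := expR_near hA2; have k2 := sin_near hB2; have k3 := one_sub_cos (Im D).
  have k4 := cos_le1 (Im D).
  case: (D) e1 hA2 hB2 k1 k2 k3 k4 => A B /= e1 hA2 hB2 k1 k2 k3 k4.
  have E0 := expR_gt0 (- A); rewrite sqrrN in k1.
  have h1 : `|1 - (expR (- A) * cos (- B) - 0 * sin (- B)) - A| <= 2 * (A ^+ 2 + B ^+ 2).
    rewrite cosN mul0r subr0.
    have -> : 1 - expR (- A) * cos B - A = - (expR (- A) - 1 - - A) + expR (- A) * (1 - cos B) by ring.
    apply: le_trans (ler_normD _ _) _; rewrite normrN.
    rewrite [`|expR (- A) * _|]ger0_norm; last by rewrite mulr_ge0 ?(ltW E0)//; lra.
    have : expR (- A) * (1 - cos B) <= 2 * (B ^+ 2 / 2) by apply: ler_pM; lra.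
    lra.
  have h2 : `|0 - (expR (- A) * sin (- B) + 0 * cos (- B)) - B| <= 3 * (A ^+ 2 + B ^+ 2).
    rewrite sinN mul0r addr0.
    have -> : 0 - expR (- A) * - sin B - B = expR (- A) * (sin B - B) + B * (expR (- A) - 1 - - A) + B * - A by ring.
    apply: le_trans (ler_normD _ _) _.
    apply: le_trans (lerD (ler_normD _ _) (lexx _)) _; rewrite !normrM !normrN.
    rewrite [`|expR (- A)|]gtr0_norm// in k1 *.
    have h3 : expR (- A) * `|sin B - B| <= 2 * B ^+ 2 by apply: ler_pM => //; exact: ltW.
    have h4 : `|B| * `|expR (- A) - 1 - - A| <= 1 * (2 * A ^+ 2) by apply: ler_pM.
    have hAB : `|B| * `|A| <= (A ^+ 2 + B ^+ 2) / 2.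
      by rewrite -(sqr_normr A) -(sqr_normr B); have := sqr_ge0 (`|A| - `|B|); nra.
    by have := sqr_ge0 A; have := sqr_ge0 B; lra.
  by lra.
have e3 : a * expR (Re z + a) <= absC (f a z) / uc z.
  rewrite ler_pdivlMr; last by lra.
  by apply: absC_f_ge => //; lra.
have f0 := absC_ge0 (f a z).
have s1 : absC (f a z) * absC (1 - cexp (- D) - D) <= absC (f a z) * (5 * absC D ^+ 2) by apply: ler_wpM2l.
have s2 : a * expR (Re z + a) * expR (- Re D) * absC D <= absC (f a z) / uc z * 2 * absC D.
  apply: ler_wpM2r => //; apply: ler_pM => //; rewrite ?expR_ge0//.
  by rewrite mulr_ge0 ?expR_ge0//; lra.
apply: le_trans (lerD s1 s2) _; rewrite le_eqVlt; apply/orP; left; apply/eqP; field.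
by rewrite gt_eqF//; lra.
Qed.

End Expansion.

(** * Cones far to the right *)

Section FarRight.
Variables (R : realType) (a : R) (ha : 3 <= a).
Local Notation C := (R[i]^o).
Local Notation Re := (@complex.Re R).
Local Notation Im := (@complex.Im R).
Local Notation pi := (@pi R).
Local Notation uc z := (Re z + a - 1).
Local Notation f := (f a).

Lemma piece_Im_lt8 s (z : C) : piece a s z -> `|Im z| < 8.
Proof. by move=> /piece_Im; have := @pi_lt4 R; lra. Qed.

(** The modulus of f_a is large and its imaginary part is bounded, so the real part
    carries the growth. *)
Lemma grow (z : C) : 0 <= uc z -> 0 <= Re (f z) -> `|Im (f z)| <= 8 ->
  3 * expR (uc z + 1) * uc z - 8 <= Re (f z).
Proof.
have a3 := ha; move=> hu hR hI.
have h1 := absC_f_ge ha hu; have h2 := absC_le_add (f z); rewrite (ger0_norm hR) in h2.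
have e0 := expR_gt0 (uc z + 1).
have : 3 * expR (uc z + 1) * uc z <= a * expR (Re z + a) * uc z.
  have -> : expR (Re z + a) = expR (uc z + 1) by congr expR; ring.
  by rewrite ler_wpM2r// ler_pM2r.
by lra.
Qed.

Lemma grow_exp (z : C) : 2 <= uc z -> 0 <= Re (f z) -> `|Im (f z)| <= 8 ->
  expR (Re z) + 4 <= Re (f z).
Proof.
have a3 := ha; move=> hu hR hI; have hu' : 0 <= uc z by lra.
have h := grow hu' hR hI.
have e1 : expR (Re z) <= expR (uc z + 1) by rewrite ler_expR; lra.
have e2 := expR_ge1Dx (uc z + 1); nra.
Qed.

Lemma grow_lin (z : C) : 2 <= uc z -> 0 <= Re (f z) -> `|Im (f z)| <= 8 ->
  8 * uc z <= Re (f z).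
Proof.
move=> hu hR hI; have hu' : 0 <= uc z by lra.
have h := grow hu' hR hI; have e2 := expR_ge1Dx (uc z + 1); nra.
Qed.

(** The aperture of the cones is 1 - cone_const / v, at distance v to the right: the
    correction must absorb the error of the linear approximation, which is of relative
    size a multiple of 1 / v. *)
Definition cone_const : R := 100 * 140.

Lemma cone_scale v : 100 * 300 <= v -> [/\ 0 < 100 / v, 100 / v <= 1 / 300,
  v * (100 / v) = 100, cone_const / v = 140 * (100 / v) &
  cone_const / (2 * v) = 70 * (100 / v)].
Proof.
move=> hv; have v0 : 0 < v by lra.
split; rewrite ?divr_gt0// /cone_const.
- by rewrite ler_pdivrMr//; lra.
- by field; rewrite gt_eqF.
- by ring.
- by field; rewrite gt_eqF.
Qed.

Lemma error_bound (F d w X b q : R) : 0 <= F -> F <= 2 * X -> 0 <= d -> d <= 2 * b ->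
  0 <= w -> w <= q / 50 -> b <= 8 / 10 * q -> F * (d * (5 * d + w)) <= 33 * (X * b * q).
Proof.
move=> F0 F1 d0 d1 w0 w1 bq.
have -> : 33 * (X * b * q) = 2 * X * (2 * b * (33 / 4 * q)) by field.
apply: ler_pM => //; first by rewrite mulr_ge0//; lra.
by apply: ler_pM => //; lra.
Qed.

(** The bookkeeping behind the cone step. Here q = 100 / v, X is the real part of the
    image, b and c are the vertical and horizontal gaps, e is the error of the linear
    approximation, and dR, dI are the gaps of the images. The loss is 34 (m q) in dI and
    the gain is 106 (m q) in dR with m = X b, which leaves the factor 1 - 70 q. *)
Lemma cone_arith (q X b c e dR dI : R) : 0 < q -> q <= 1 / 300 -> 0 <= b -> 0 <= X ->
  8 <= X * q -> c <= (1 - 140 * q) * b -> e <= 33 * (X * b * q) ->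
  dR <= e + (X * c + 8 * b) -> X * b <= dI + e + 8 * c ->
  dR <= (1 - 70 * q) * dI /\ 2 * b <= dI.
Proof.
move=> q0 q1 b0 X0 hX hc he hR hI; set m := X * b in he hI.
have m0 : 0 <= m by rewrite mulr_ge0.
have hXc : X * c <= m - 140 * (m * q).
  have : X * c <= X * ((1 - 140 * q) * b) by rewrite ler_wpM2l.
  by rewrite /m; lra.
have h8 : 8 * b <= m * q by rewrite /m mulrAC ler_wpM2r.
have cb : c <= b by nra.
have {}hR : dR <= m - 106 * (m * q) by lra.
have {}hI : m - 34 * (m * q) <= dI by lra.
have mq0 : 0 <= m * q by rewrite mulr_ge0// ltW.
have mq1 : m * q <= m / 300 by rewrite ler_wpM2l//; lra.
split; last by lra.
apply: le_trans hR _.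
have : (1 - 70 * q) * (m - 34 * (m * q)) <= (1 - 70 * q) * dI by rewrite ler_wpM2l//; lra.
by clear -q0 q1 m0 mq0; nra.
Qed.

(** Multiplication by f_a z is almost multiplication by the positive real number Re (f_a
    z), because the imaginary part is bounded. So a gap that is more vertical than
    horizontal is stretched and stays so; the aperture widens a little, but v doubles,
    and hence the widening is summable. *)
Lemma cone_step s s' (z z' : C) v : piece a s z -> piece a s z' ->
  piece a s' (f z) -> piece a s' (f z') -> 0 < Re (f z) -> 0 < Re (f z') ->
  100 * 300 <= v -> v <= uc z -> v <= uc z' ->
  `|Re z - Re z'| <= (1 - cone_const / v) * `|Im z - Im z'| ->
  [/\ `|Re (f z) - Re (f z')| <= (1 - cone_const / (2 * v)) * `|Im (f z) - Im (f z')|,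
      2 * `|Im z - Im z'| <= `|Im (f z) - Im (f z')| ,
      2 * v <= uc (f z) & 2 * v <= uc (f z')].
Proof.
have a3 := ha; move=> hz hz' hfz hfz' X0 X0' hv hu hu'.
have I1 := ltW (piece_Im_lt8 hfz); have I2 := ltW (piece_Im_lt8 hfz').
have v100 : 100 <= v by clear -hv; lra.
have B80 := near_diff ha hz hz' v100 hu hu' X0 X0' I1 I2; clear hz hz' hfz hfz'.
have u2 : 2 <= uc z by clear -v100 hu; lra.
have u2' : 2 <= uc z' by clear -v100 hu'; lra.
have g1 := grow_lin u2 (ltW X0) I1; have g2 := grow_lin u2' (ltW X0') I2.
have [] := cone_scale hv; set q := 100 / v => q0 q1 qv -> -> hc.
have B8 : `|Im z - Im z'| <= 8 / 10 * q.
  by apply: le_trans B80 _; rewrite /q; clear; lra.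
have b0 := normr_ge0 (Im z - Im z').
have hAB : `|Re z - Re z'| <= `|Im z - Im z'| by clear -hc q0 b0; nra.
have k2 : `|Im z - Im z'| <= 1 / 2 by clear -B8 q1; lra.
have k1 := le_trans hAB k2.
have u1 : 1 <= uc z by clear -u2; lra.
have hT := linear_approx ha u1 k1 k2; set T := _ - _ - _ in hT.
have uq : 2 / uc z <= q / 50.
  have : (uc z)^-1 <= v^-1 by clear -v100 hu; rewrite lef_pV2// ?posrE; lra.
  by rewrite /q; clear; lra.
have uq0 : 0 <= 2 / uc z by clear -u2; rewrite divr_ge0//; lra.
have nD : absC (z - z') <= 2 * `|Im z - Im z'|.
  by apply: le_trans (absC_le_add _) _; rewrite ReB ImB; clear -hAB; lra.
have nf : absC (f z) <= 2 * Re (f z).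
  by apply: le_trans (absC_le_add _) _; rewrite gtr0_norm//; clear -I1 g1 u2; lra.
have {}hT := le_trans hT (error_bound (absC_ge0 _) nf (absC_ge0 _) nD uq0 uq B8).
have eR : Re (f z) - Re (f z') = Re T + (Re (f z) * (Re z - Re z') - Im (f z) * (Im z - Im z')).
  by clear; rewrite /T; move: (f z) (f z') => [p1 p2] [p3 p4]; case: (z) => x y; case: (z') => x' y' /=; ring.
have eI : Re (f z) * (Im z - Im z') =
    (Im (f z) - Im (f z')) - Im T - Im (f z) * (Re z - Re z').
  by clear; rewrite /T; move: (f z) (f z') => [p1 p2] [p3 p4]; case: (z) => x y; case: (z') => x' y' /=; ring.
have hX : 8 <= Re (f z) * q.
  have : 8 * v * q <= Re (f z) * q by rewrite ler_pM2r//; clear -g1 hu; lra.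
  by rewrite -mulrA qv; clear; lra.
have hR : `|Re (f z) - Re (f z')| <=
    absC T + (Re (f z) * `|Re z - Re z'| + 8 * `|Im z - Im z'|).
  rewrite eR; apply: le_trans (ler_normD _ _) (lerD (normRe_le_absC T) _).
  apply: le_trans (ler_normB _ _) _; rewrite !normrM (gtr0_norm X0).
  by rewrite lerD2l ler_wpM2r.
have hI : Re (f z) * `|Im z - Im z'| <=
    `|Im (f z) - Im (f z')| + absC T + 8 * `|Re z - Re z'|.
  rewrite -{1}(gtr0_norm X0) -normrM eI; apply: le_trans (ler_normB _ _) (lerD _ _).
    by apply: le_trans (ler_normB _ _) _; rewrite lerD2l; exact: normIm_le_absC.
  by rewrite normrM ler_wpM2r.
have [h1 h2] := cone_arith q0 q1 b0 (ltW X0) hX hc hT hR hI.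
by split => //; [clear -g1 hu v100 a3|clear -g2 hu' v100 a3]; lra.
Qed.

(** Iterating [cone_step] from aperture 1 / 2: after n steps v has been multiplied by
    2^n, so the aperture never reaches 1. *)
Lemma cone_iter n (t : nat -> Asymbol) r (z z' : C) : 100 * 300 <= r ->
  (forall k, (k <= n)%N -> [/\ piece a (t k) (iter k f z), piece a (t k) (iter k f z'),
     r <= Re (iter k f z) & r <= Re (iter k f z')]) ->
  `|Re z - Re z'| <= 1 / 2 * `|Im z - Im z'| ->
  2 ^+ n * `|Im z - Im z'| <= `|Im (iter n f z) - Im (iter n f z')|.
Proof.
have a3 := ha; move=> hr h hc; have p2 (k : nat) : 1 <= 2 ^+ k :> R by rewrite exprn_ege1// ler1n.
suff : [/\ `|Re (iter n f z) - Re (iter n f z')| <=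
         (1 - cone_const / (2 ^+ n * r)) * `|Im (iter n f z) - Im (iter n f z')|,
       2 ^+ n * `|Im z - Im z'| <= `|Im (iter n f z) - Im (iter n f z')|,
       2 ^+ n * r <= uc (iter n f z) & 2 ^+ n * r <= uc (iter n f z')] by case.
elim: n h => [|n IH] h.
  have [_ _ h1 h2] := h 0%N (leqnn _); rewrite /= in h1 h2 *.
  rewrite expr0 !mul1r; split => //; try lra.
  apply: le_trans hc _; rewrite ler_wpM2r//.
  have : cone_const / r <= 1 / 2 by rewrite ler_pdivrMr /cone_const; lra.
  by lra.
have [h1 h2 h3 h4] := IH (fun k hk => h k (leqW hk)).
have [s1 s2 _ _] := h n (leqnSn n); have [s3 s4 k3 k4] := h n.+1 (leqnn _).
rewrite iterS in s3 k3; rewrite iterS in s4 k4.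
have hv : 100 * 300 <= 2 ^+ n * r by have := p2 n; nra.
have X0 : 0 < Re (f (iter n f z)) by lra.
have X0' : 0 < Re (f (iter n f z')) by lra.
have [c1 c2 c3 c4] := cone_step s1 s2 s3 s4 X0 X0' hv h3 h4 h1.
rewrite !iterS exprS -!(mulrA 2); split => //.
by apply: le_trans c2; rewrite ler_pM2l.
Qed.

Lemma expansion_piece s s' (z z' : C) : piece a s z -> piece a s z' ->
  piece a s' (f z) -> piece a s' (f z') -> 0 < Re (f z) -> 0 < Re (f z') ->
  100 <= uc z -> 100 <= uc z' -> 2 * absC (z - z') <= absC (f z - f z').
Proof.
move=> hz hz' hfz hfz' X0 X0' u1 u2; apply: (expansion ha); try lra.
have := near_diff ha hz hz' (lexx 100) u1 u2 X0 X0' (ltW (piece_Im_lt8 hfz)) (ltW (piece_Im_lt8 hfz')).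
by lra.
Qed.

(** An upper bound for the modulus of f_a on the part of the strip |Im z| < 8 where u <=
    V. *)
Definition far_const V : R := 16 * a * expR (V + 1) * (V + 8) + 1.

Lemma far_constP V (z : C) : 0 <= V -> `|Im z| < 8 -> uc z <= V -> absC (f z) < far_const V.
Proof.
have a3 := ha; move=> V0 hI hu.
have e1 : 1 <= expR (V + 1) by have := expR_ge1Dx (V + 1); lra.
have [h|h] := leP (uc z) 0.
  have h1 := absC_f_le_left ha hI h; apply: le_lt_trans h1 _; rewrite /far_const.
  have h2 : expR (1 + uc z / 2) <= expR (V + 1) by rewrite ler_expR; lra.
  have h3 : 16 * a * expR (1 + uc z / 2) <= 16 * a * expR (V + 1) * (V + 8).
    apply: (@le_trans _ _ (16 * a * expR (V + 1))); first by rewrite ler_pM2l//; lra.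
    by rewrite ler_peMr; [|rewrite mulr_ge0 ?expR_ge0//; lra|lra].
  by lra.
rewrite (absC_f ha) /far_const.
have e2 : expR (Re z + a) <= expR (V + 1) by rewrite ler_expR; lra.
have h1 : absC (uc z +i* Im z : C) <= V + 8.
  by apply: le_trans (absC_le_add _) _; rewrite /= gtr0_norm//; lra.
have : a * expR (Re z + a) * absC (uc z +i* Im z : C) <= a * expR (V + 1) * (V + 8).
  apply: ler_pM => //; [by rewrite mulr_ge0 ?expR_ge0//; lra|exact: absC_ge0|].
  by rewrite ler_pM2l//; lra.
have : 0 <= a * expR (V + 1) * (V + 8) by rewrite !mulr_ge0 ?expR_ge0//; lra.
lra.
Qed.

End FarRight.

(** * Tails are Lipschitz graphs *)

Section Tails.
Variables (R : realType) (a : R) (ha : 3 <= a).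
Local Notation C := (R[i]^o).
Local Notation Re := (@complex.Re R).
Local Notation Im := (@complex.Im R).
Local Notation pi := (@pi R).
Local Notation uc z := (Re z + a - 1).
Local Notation f := (f a).
Local Notation S := (piece a).

Lemma continuous_of_lip2 (F : R -> R) : (forall x y, `|F x - F y| <= 2 * `|x - y|) ->
  continuous F.
Proof.
move=> h x; apply/cvgrPdist_lt => e e0.
have : nbhs x (ball x (e / 3)) by apply: nbhsx_ballx; rewrite divr_gt0.
apply: filterS => y; rewrite /ball/= => hy; apply: le_lt_trans (h _ _) _.
by lra.
Qed.

Lemma max_lip (r x y : R) : `|Num.max r x - Num.max r y| <= `|x - y|.
Proof.
have [h1|h1] := leP r x; have [h2|h2] := leP r y; rewrite ?lexx//.
- by rewrite ger0_norm ?subr_ge0//; apply: le_trans (ler_norm _); lra.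
- by rewrite ler0_norm ?subr_le0//; rewrite -normrN; apply: le_trans (ler_norm _); lra.
- by rewrite subrr normr0.
Qed.

Lemma pow2_bounded (b c : R) : (forall n : nat, 2 ^+ n * b <= c) -> b <= 0.
Proof.
move=> h; rewrite leNgt; apply/negP => b0.
have [n hn] : exists n : nat, c / b < n%:R.
  by exists (Num.bound `|c / b|); apply: le_lt_trans (ler_norm _) _; exact: archi_boundP.
have := h n; rewrite -ler_pdivlMr// => h1.
have : (n%:R : R) <= 2 ^+ n by rewrite -natrX ler_nat; apply: ltnW; exact: ltn_expl.
by lra.
Qed.

Lemma tailE r t (z : C) : tail a r t z <->
  forall n, S (t n) (iter n f z) /\ r <= Re (iter n f z).
Proof.
split=> [[h1 h2] n|h].
  by split; [rewrite -(TpartE ha); exact: h1|have [] := h2 n].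
have h1 : itinerary a z t by move=> n; rewrite TpartE//; have [] := h n.
split => // n; split; last by have [] := h n.
by have := h1 n; case: (t n) => -[]; [left|left|right|right].
Qed.

Lemma piece_sgn s (z : C) : S s z -> 0 < sgn R s * Im z.
Proof. by rewrite /piece /reg /=; case: (digit s) => -[]. Qed.

Lemma piece_half_plane s s' (z : C) : transition s s' -> S s' z -> half_plane s z.
Proof. by move=> /(transitionP R) h /piece_sgn; rewrite h. Qed.

(** A reference height strictly inside the part of symbol s; approximations to a tail
    are required to end at this height. *)
Definition mid_height s : R := sgn R s * (if digit s then 3 / 2 * pi else pi / 2).

Lemma piece_mid_height s (z : C) : 0 < uc z -> Im z = mid_height s -> S s z.
Proof.
move=> hu hz; have p0 := @pi_gt0 R.
rewrite /piece /reg /= hz /mid_height mulrA sgn_sq mul1r /Qf; case: (digit s).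
  have -> : 3 / 2 * pi = 2 * pi - pi / 2 by field.
  by rewrite sin_2pi_sub cos_2pi_sub sin_pihalf cos_pihalf; split; lra.
by rewrite sin_pihalf cos_pihalf; split; lra.
Qed.

Variable r : R.
Hypothesis hr : 100 * 300 <= r.

Let r100 : 100 <= r. Proof. by move: hr; lra. Qed.

Definition finite_orbit n (t : nat -> Asymbol) (z : C) :=
  forall k, (k <= n)%N -> S (t k) (iter k f z) /\ r <= Re (iter k f z).

(** Two approximations of the same length end at the same height, whereas a steep gap
    between them would have grown. *)
Lemma finite_orbit_lip n t (z z' : C) : finite_orbit n t z -> finite_orbit n t z' ->
  Im (iter n f z) = Im (iter n f z') -> `|Im z - Im z'| <= 2 * `|Re z - Re z'|.
Proof.
move=> h h' e; rewrite leNgt; apply/negP => hlt.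
have : 2 ^+ n * `|Im z - Im z'| <= `|Im (iter n f z) - Im (iter n f z')|.
  apply: (cone_iter ha hr (t := t)); last by lra.
  by move=> k hk; have [h1 h2] := h k hk; have [h3 h4] := h' k hk.
have := normr_ge0 (Re z - Re z').
have : 1 <= 2 ^+ n :> R by rewrite exprn_ege1// ler1n.
by rewrite e subrr normr0; nra.
Qed.

Lemma branch_lt (s : Asymbol) (w : C) : half_plane s w -> Re w = r -> `|Im w| < 8 ->
  Re (branch a s w) < r.
Proof.
have a3 := ha; have r1 := r100; move=> hw wr hI; have [hz ez] := branchP ha hw.
rewrite ltNge; apply/negP => h.
have h2 : 2 <= uc (branch a s w) by lra.
have := grow_lin ha h2; rewrite ez wr => /(_ _ (ltW hI)); lra.
Qed.

(** Induction on the length: the approximations for the shifted sequence form a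
    Lipschitz curve; its pullback under the branch of the first symbol starts to the
    left of r and ends to the right of x, so it crosses the line over x. *)
Lemma finite_orbit_exists n : forall t, Asequence t -> forall x, r <= x ->
  exists z : C, [/\ Re z = x, finite_orbit n t z & Im (iter n f z) = mid_height (t n)].
Proof.
have a3 := ha; have r1 := r100.
elim: n => [|n IH] t At x rx.
  exists (x +i* mid_height (t 0%N)); split => // k; rewrite leqn0 => /eqP -> /=; split => //.
  by apply: piece_mid_height => //=; lra.
have At' : Asequence (fun i => t i.+1) by move=> i; exact: At.
have hmax x' : r <= Num.max r x' by rewrite le_max lexx.
have [c hc] := choice (fun x' => IH _ At' (Num.max r x') (hmax x')).
have cRe x' : Re (c x') = Num.max r x' by have [] := hc x'.
have cHP x' : half_plane (t 0%N) (c x').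
  by have [_ h _] := hc x'; apply: piece_half_plane (At 0%N) _; have [] := h 0%N (leq0n _).
have cIm x' : `|Im (c x')| < 8.
  by have [_ h _] := hc x'; have [h1 _] := h 0%N (leq0n _); exact: piece_Im_lt8 h1.
have clip x1 x2 : `|Im (c x1) - Im (c x2)| <= 2 * `|x1 - x2|.
  have [e1 o1 i1] := hc x1; have [e2 o2 i2] := hc x2.
  apply: le_trans (finite_orbit_lip o1 o2 _) _; first by rewrite i1 i2.
  by rewrite e1 e2 ler_pM2l// max_lip.
have cont : continuous c.
  move=> x0; have -> : c = fun x' => (Re (c x') +i* Im (c x') : C).
    by apply/funext => x'; rewrite -ReImE.
  apply: continuousC_comp.
    apply: (@continuous_of_lip2 (fun x' => Re (c x'))) => y1 y2; rewrite !cRe.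
    by apply: le_trans (max_lip _ _ _) _; have := normr_ge0 (y1 - y2); lra.
  exact: (@continuous_of_lip2 (fun x' => Im (c x'))).
pose d x' := Re (branch a (t 0%N) (c x')).
have dcont : continuous d.
  move=> x0.
  apply: (@continuous_comp _ _ _ (fun x' => branch a (t 0%N) (c x')) Re).
    by apply: (@continuous_comp _ _ _ c (branch a (t 0%N))); [exact: cont|exact: continuous_branch].
  exact: continuous_Re.
pose M := Num.max r (far_const a (x + a - 1)).
have rM : r <= M by rewrite le_max lexx.
have dr : d r < r by apply: branch_lt => //; rewrite cRe maxxx.
have dM : x <= d M.
  rewrite leNgt; apply/negP => h.
  have [hz ez] := branchP ha (cHP M).
  have := @far_constP _ a ha (x + a - 1) (branch a (t 0%N) (c M)).
  rewrite ez => k; have {}k : absC (c M) < far_const a (x + a - 1).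
    by apply: k; [lra|exact: piece_Im_lt8 hz|rewrite /d in h; lra].
  have := normRe_le_absC (c M); have := ler_norm (Re (c M)); rewrite cRe.
  have : far_const a (x + a - 1) <= Num.max r M by rewrite !le_max lexx !orbT.
  by lra.
have [||y _ ey] := @IVT R d r M x rM.
- exact: continuous_subspaceT.
- by rewrite ge_min le_max dM orbT (ltW (lt_le_trans dr rx)).
have [hz ez] := branchP ha (cHP y); have [_ o i] := hc y.
exists (branch a (t 0%N) (c y)); split => //.
- move=> [|k] hk; first by split => //=; rewrite -/(d y) ey.
  by rewrite iterSr ez; exact: o.
- by rewrite iterSr ez.
Qed.

(** The closed piece with the additional lower bound pi on the height for digit 1.
    Finite approximations satisfy it by [near_axis], and it keeps limits of
    approximations away from the real axis at times of digit 1. *)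
Definition inner_piece s : set C := [set z |
  [/\ (if digit s then pi else 0) <= sgn R s * Im z,
     sgn R s * Im z <= (if digit s then 2 * pi else pi) &
     0 <= digit_sgn R (digit s) * (sgn R s * Qf (uc z) (Im z))]].

Lemma inner_cpiece s (z : C) : inner_piece s z -> cpiece a s z.
Proof.
case=> h1 h2 h3; split => //; apply: le_trans h1; case: (digit s) => //; exact: pi_ge0.
Qed.

Lemma finite_orbit_inner n t (z : C) : finite_orbit n t z -> Im (iter n f z) = mid_height (t n) ->
  forall k, (k <= n)%N -> inner_piece (t k) (iter k f z).
Proof.
have a3 := ha; have r1 := r100; have p2 := @pi_ge2 R.
move=> o e k; rewrite leq_eqVlt => /orP[/eqP ->|hk].
  have [h _] := o n (leqnn _); have [h1 h2 h3] := piece_cpiece h; split => //.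
  by rewrite e /mid_height mulrA sgn_sq mul1r; case: (digit _); lra.
have [h hx] := o k (ltnW hk); have [h1 h2 h3] := piece_cpiece h; split => //.
have [h' hx'] := o k.+1 hk; rewrite iterS in h' hx'.
have := near_axis ha h _ _ (ltW (piece_Im_lt8 h')) => hm.
have {}hm : `|Im (iter k f z) - axis R (t k)| <= 40 / uc (iter k f z) by apply: hm; lra.
have : 40 / uc (iter k f z) <= 1 by rewrite ler_pdivrMr; lra.
move: hm; rewrite /axis; case: (digit (t k)) h1 => // _ h4 h5.
have : sgn R (t k) * (2 * pi) * sgn R (t k) - 1 <= sgn R (t k) * Im (iter k f z).
  by move: h4; rewrite ler_norml => /andP[]; case: (sgnP R (t k)) => ->; lra.
by rewrite mulrAC sgn_sq mul1r; lra.
Qed.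

(** A cluster point of the finite approximations over x; each condition on the k-th
    iterate is closed and holds from the k-th approximation on. *)
Lemma closed_orbit_exists t x : Asequence t -> r <= x ->
  exists z : C, Re z = x /\ forall k, inner_piece (t k) (iter k f z) /\ r <= Re (iter k f z).
Proof.
have p4 := @pi_lt4 R.
move=> At rx.
have [z hz] := choice (fun n => @finite_orbit_exists n t At x rx).
pose y n := Im (z n).
have ez n : z n = x +i* y n by have [e _ _] := hz n; rewrite (ReImE (z n)) e.
have yb n : `[- 8, 8]%classic (y n).
  have [_ o _] := hz n; have [h _] := o 0%N (leq0n _).
  by have := piece_Im_lt8 h; rewrite /= in_itv/= ltr_norml => /andP[h1 h2]; rewrite !ltW.
have [|p [_ hp]] := @segment_compact R (- 8) 8 (y @ \oo) _.
  by exists 0%N => // n _; exact: yb.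
exists (x +i* p); split => // k.
pose K : set R := [set q | inner_piece (t k) (iter k f (x +i* q)) /\ r <= Re (iter k f (x +i* q))].
have clK : closure K p.
  move=> B pB; apply: hp => //; exists k => // n /= kn.
  have [_ o i] := hz n; rewrite /K /= -ez; split; last by have [] := o k kn.
  exact: finite_orbit_inner o i k kn.
have cont q : continuous_at q (fun q => iter k f (x +i* q : C)).
  apply: (@continuous_comp _ _ _ (fun q => x +i* q : C) (iter k f)); last exact: continuous_iter_f.
  by apply: continuousC_comp; [exact: cont_cst|exact: cvg_id].
have cI q : continuous_at q (fun q => Im (iter k f (x +i* q : C))).
  by apply: (@continuous_comp _ _ _ (fun q => iter k f (x +i* q : C)) Im);
    [exact: cont|exact: continuous_Im].
have cR q : continuous_at q (fun q => Re (iter k f (x +i* q : C))).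
  by apply: (@continuous_comp _ _ _ (fun q => iter k f (x +i* q : C)) Re);
    [exact: cont|exact: continuous_Re].
have cQ q : continuous_at q (fun q => Qf (uc (iter k f (x +i* q : C))) (Im (iter k f (x +i* q : C)))).
  apply: (@continuous_comp _ _ _ (fun q => iter k f (x +i* q : C))
    (fun z : C => Qf (uc z) (Im z))); first exact: cont.
  exact: continuous_Qz.
split; last by apply: (closure_ge cR _ clK) => q [].
split.
- apply: (closure_ge (F := fun q => sgn R (t k) * Im (iter k f (x +i* q))) _ _ clK) => q.
    by apply: contM; [exact: cont_cst|exact: cI].
  by case=> -[].
- apply: (closure_le (F := fun q => sgn R (t k) * Im (iter k f (x +i* q))) _ _ clK) => q.
    by apply: contM; [exact: cont_cst|exact: cI].
  by case=> -[].
- apply: (closure_ge (F := fun q => digit_sgn R (digit (t k)) * (sgn R (t k) *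
     Qf (uc (iter k f (x +i* q))) (Im (iter k f (x +i* q))))) _ _ clK) => q.
    by apply: contM; [exact: cont_cst|apply: contM; [exact: cont_cst|exact: cQ]].
  by case=> -[].
Qed.

(** The sequence does not end in zeros. *)
Definition often_one (t : nat -> Asymbol) := forall n, exists2 m, (n <= m)%N & digit (t m).

(** A limit point could leave the open pieces only by becoming real; it would then stay
    real, contradicting the height at a later digit 1. *)
Lemma tail_exists t x : Asequence t -> often_one t -> r <= x ->
  exists z : C, Re z = x /\ tail a r t z.
Proof.
move=> At Ot rx; have [z [zx hz]] := closed_orbit_exists At rx.
exists z; split => //; apply/tailE => k; split; last by have [] := hz k.
have [zk _] := hz k; apply: (cpiece_half_plane ha) (inner_cpiece zk) _.
rewrite /half_plane /=; rewrite ltNge; apply/negP => hle.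
have [zk1 _] := hz k.+1; have [h1 _ _] := inner_cpiece zk1.
rewrite ((transitionP R _ _).1 (At k)) iterS in h1.
have I0 : Im (iter k.+1 f z) = 0.
  have e : next_sgn R (t k) * Im (f (iter k f z)) = 0 by apply/eqP; rewrite eq_le h1 hle.
  by rewrite iterS -[LHS]mul1r -(next_sgn_sq R (t k)) -mulrA e mulr0.
have I j : Im (iter (j + k.+1) f z) = 0.
  elim: j => [//|j IH]; rewrite addSn iterS Im_f IH Qf_0 mulr0//.
have [m km dm] := Ot k.+1.
have [[h2 _ _] _] := hz m; move: h2; rewrite dm -(subnK km) I mulr0.
by have := @pi_gt0 R; lra.
Qed.

Lemma tail_lip t (z z' : C) : tail a r t z -> tail a r t z' ->
  `|Im z - Im z'| <= 2 * `|Re z - Re z'|.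
Proof.
move=> /tailE h /tailE h'; rewrite leNgt; apply/negP => hlt.
suff : `|Im z - Im z'| <= 0 by have := normr_ge0 (Re z - Re z'); lra.
apply: (@pow2_bounded _ 16) => n.
apply: le_trans (_ : `|Im (iter n f z) - Im (iter n f z')| <= _).
  apply: (cone_iter ha hr (t := t)); last by lra.
  by move=> k hk; have [h1 h2] := h k; have [h3 h4] := h' k.
have [h1 _] := h n; have [h2 _] := h' n.
by apply: le_trans (ler_normB _ _) _; have := piece_Im_lt8 h1; have := piece_Im_lt8 h2; lra.
Qed.

Lemma tail_param t : Asequence t -> often_one t ->
  exists T : R -> C, [/\ continuous T, forall x, Re (T x) = Num.max r x,
    forall x, tail a r t (T x) & forall z, tail a r t z -> T (Re z) = z].
Proof.
move=> At Ot.
have hmax x' : r <= Num.max r x' by rewrite le_max lexx.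
have [T hT] := choice (fun x => tail_exists At Ot (hmax x)).
have TRe x : Re (T x) = Num.max r x by have [] := hT x.
have Tt x : tail a r t (T x) by have [] := hT x.
have Tlip x1 x2 : `|Im (T x1) - Im (T x2)| <= 2 * `|x1 - x2|.
  apply: le_trans (tail_lip (Tt x1) (Tt x2)) _.
  by rewrite !TRe ler_pM2l// max_lip.
exists T; split => //.
  move=> x0; have -> : T = fun x' => (Re (T x') +i* Im (T x') : C).
    by apply/funext => x'; rewrite -ReImE.
  apply: continuousC_comp.
    apply: (@continuous_of_lip2 (fun x' => Re (T x'))) => y1 y2; rewrite !TRe.
    by apply: le_trans (max_lip _ _ _) _; have := normr_ge0 (y1 - y2); lra.
  exact: (@continuous_of_lip2 (fun x' => Im (T x'))).
move=> z hz; have h := tail_lip (Tt (Re z)) hz.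
have rz : r <= Re z by have /tailE /(_ 0%N) [] := hz.
have eR : Re (T (Re z)) = Re z by rewrite TRe; apply/max_idPr.
rewrite (ReImE (T (Re z))) (ReImE z) eR; congr (_ +i* _).
move: h; rewrite eR subrr normr0 mulr0 => h; apply/eqP.
by rewrite -subr_eq0 -normr_le0.
Qed.

End Tails.

(** * Pullbacks and the parametrisation of a hair *)

Section Pullbacks.
Variables (R : realType) (a : R) (ha : 3 <= a).
Local Notation C := (R[i]^o).
Local Notation Re := (@complex.Re R).
Local Notation Im := (@complex.Im R).
Local Notation f := (f a).
Local Notation S := (piece a).

(** The head of the composition is applied last, so prolonging a pullback by one step
    means applying one more branch first. *)
Lemma pullbackS t n (w : C) : pullback a t n.+1 w = pullback a t n (branch a (t n) w).
Proof.
by rewrite /pullback -addn1 /mkseq iotaD map_cat foldr_cat /= add0n; elim: (map _ _) => //= s l ->.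
Qed.

Lemma pullbackP t n (w : C) : Asequence t -> S (t n) w ->
  iter n f (pullback a t n w) = w /\
  forall k, (k <= n)%N -> S (t k) (iter k f (pullback a t n w)).
Proof.
move=> At; elim: n w => [|n IH] w hw.
  by split => // k; rewrite leqn0 => /eqP ->.
have [hb eb] := branchP ha (piece_half_plane (At n) hw).
have [h1 h2] := IH _ hb; rewrite pullbackS iterS h1 eb; split => // k.
rewrite leq_eqVlt => /orP[/eqP ->|hk]; last exact: h2.
by rewrite iterS h1 eb.
Qed.

Lemma pullbackK t n (z : C) : (forall k, (k < n)%N -> S (t k) (iter k f z)) ->
  pullback a t n (iter n f z) = z.
Proof.
elim: n => [//|n IH] h; rewrite pullbackS iterS branchK//; last exact: h.
by apply: IH => k hk; apply: h; exact: ltnW.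
Qed.

Lemma continuous_pullback t n (w : C) : Asequence t -> S (t n) w ->
  continuous_at w (pullback a t n : C -> C).
Proof.
move=> At; elim: n w => [|n IH] w hw; first exact: cvg_id.
have -> : pullback a t n.+1 = (pullback a t n : C -> C) \o (branch a (t n) : C -> C).
  by apply/funext => x /=; rewrite pullbackS.
have hH := piece_half_plane (At n) hw; have [hb eb] := branchP ha hH.
by apply: continuous_comp; [exact: continuous_branch|exact: IH].
Qed.

Lemma Asequence_shift n t : Asequence t -> Asequence (Defs.shift n t).
Proof. by move=> h i; rewrite /Defs.shift addnS; exact: h. Qed.

Lemma often_one_shift n t : often_one t -> often_one (Defs.shift n t).
Proof.
move=> h i; have [m hm dm] := h (n + i)%N; exists (m - n)%N.
  by rewrite leq_subRL// (leq_trans (leq_addr _ _) hm).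
by rewrite /Defs.shift subnKC// (leq_trans (leq_addr _ _) hm).
Qed.

Lemma hair_pieceE r t n (z : C) : Asequence t -> hair_piece a r t n z <->
  (forall k, S (t k) (iter k f z)) /\ (forall k, (n <= k)%N -> r <= Re (iter k f z)).
Proof.
move=> At; split=> [[w /(tailE ha) hw <-]|[h1 h2]].
  have [h0 _] := hw 0%N; rewrite /Defs.shift addn0 /= in h0.
  have [e hk] := pullbackP At h0.
  have ek k : (n <= k)%N -> iter k f (pullback a t n w) = iter (k - n) f w.
    by move=> nk; rewrite -{1}(subnK nk) iterD e.
  split=> k; last by move=> nk; rewrite ek//; have [] := hw (k - n)%N.
  have [kn|nk] := leqP k n; first exact: hk.
  rewrite ek 1?ltnW//; have [+ _] := hw (k - n)%N.
  by rewrite /Defs.shift subnKC// ltnW.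
exists (iter n f z); last by apply: pullbackK => k _; exact: h1.
apply/(tailE ha) => k; rewrite -iterD /Defs.shift addnC; split; first exact: h1.
by apply: h2; exact: leq_addl.
Qed.

(** Membership in a hair without reference to inverse branches. *)
Lemma hairE r t (z : C) : Asequence t -> hair a r t z <->
  (forall k, S (t k) (iter k f z)) /\ exists n, forall k, (n <= k)%N -> r <= Re (iter k f z).
Proof.
move=> At; split=> [[n _ /(hair_pieceE _ _ _ At)[h1 h2]]|[h1 [n h2]]].
  by split => //; exists n.
by exists n => //; apply/hair_pieceE.
Qed.

End Pullbacks.

Section HairParam.
Variables (R : realType) (a : R) (ha : 3 <= a).
Local Notation C := (R[i]^o).
Local Notation Chat := (one_point_compactification C).
Local Notation Re := (@complex.Re R).
Local Notation Im := (@complex.Im R).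
Local Notation uc z := (Re z + a - 1).
Local Notation f := (f a).
Local Notation S := (piece a).
Variables (r : R) (hr : 100 * 300 <= r) (t : nat -> Asymbol).
Hypotheses (At : Asequence t) (Ot : often_one t).

Let r100 : 100 <= r. Proof. by move: hr; lra. Qed.

Lemma tail_params : exists T : nat -> R -> C, forall n,
  [/\ continuous (T n), forall x, Re (T n x) = Num.max r x,
    forall x, tail a r (Defs.shift n t) (T n x) &
    forall z, tail a r (Defs.shift n t) z -> T n (Re z) = z].
Proof.
have h n := tail_param ha hr (Asequence_shift n At) (often_one_shift n Ot).
by have [T hT] := choice h; exists T.
Qed.

Definition tail_pt := proj1_sig (cid tail_params).
Lemma tail_ptP n : [/\ continuous (tail_pt n), forall x, Re (tail_pt n x) = Num.max r x,
    forall x, tail a r (Defs.shift n t) (tail_pt n x) &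
    forall z, tail a r (Defs.shift n t) z -> tail_pt n (Re z) = z].
Proof. exact: (proj2_sig (cid tail_params)). Qed.

Lemma tail_pt_cont n : continuous (tail_pt n). Proof. by have [] := tail_ptP n. Qed.
Lemma tail_pt_Re n x : Re (tail_pt n x) = Num.max r x. Proof. by have [] := tail_ptP n. Qed.
Lemma tail_pt_tail n x : tail a r (Defs.shift n t) (tail_pt n x). Proof. by have [] := tail_ptP n. Qed.
Lemma tail_ptK n z : tail a r (Defs.shift n t) z -> tail_pt n (Re z) = z.
Proof. by have [_ _ _] := tail_ptP n; apply. Qed.

Lemma tail_pt_piece n x : S (t n) (tail_pt n x).
Proof. by have /(tailE ha) /(_ 0%N) [+ _] := tail_pt_tail n x; rewrite /Defs.shift addn0. Qed.

Lemma tail_f n (z : C) : tail a r (Defs.shift n t) z -> tail a r (Defs.shift n.+1 t) (f z).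
Proof.
move=> /(tailE ha) h; apply/(tailE ha) => k; have := h k.+1.
by rewrite iterSr /Defs.shift addSnnS.
Qed.

(** The action of f_a from the n-th tail to the next one, in terms of the abscissa. *)
Definition phi n x : R := Re (f (tail_pt n x)).

Lemma tail_pt_phi n x : tail_pt n.+1 (phi n x) = f (tail_pt n x).
Proof. by apply: tail_ptK; apply: tail_f; exact: tail_pt_tail. Qed.

Lemma phi_cont n : continuous (phi n).
Proof.
move=> x; apply: (@continuous_comp _ _ _ (fun x => f (tail_pt n x)) Re).
  by apply: (@continuous_comp _ _ _ (tail_pt n) f); [exact: tail_pt_cont|exact: continuous_f].
exact: continuous_Re.
Qed.

Lemma phi_gt n x : r <= x -> x + 100 <= phi n x.
Proof.
have a3 := ha; have r1 := r100; move=> rx; have h1 := tail_pt_Re n x.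
have e : Num.max r x = x by apply/max_idPr.
have /(tailE ha) h := tail_f (tail_pt_tail n x); have [h2 h3] := h 0%N; rewrite /= in h2 h3.
have := grow_lin ha _ _ (ltW (piece_Im_lt8 h2)); rewrite h1 e => k.
have {}k : 8 * (x + a - 1) <= Re (f (tail_pt n x)) by apply: k; lra.
by rewrite /phi; lra.
Qed.

Lemma phi_inj n x y : r <= x -> r <= y -> phi n x = phi n y -> x = y.
Proof.
move=> rx ry e; have : f (tail_pt n x) = f (tail_pt n y) by rewrite -!tail_pt_phi e.
move=> /(f_inj ha (tail_pt_piece n x) (tail_pt_piece n y)) e2.
have := tail_pt_Re n x; rewrite e2 tail_pt_Re.
by move: rx ry => /max_idPr -> /max_idPr ->.
Qed.

Lemma phi_ivt n x v : r <= x -> phi n x <= v -> exists2 y, x <= y & phi n y = v.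
Proof.
have r1 := r100; move=> rx h; pose M := Num.max x v.
have xM : x <= M by rewrite le_max lexx.
have vM : v <= M by rewrite le_max lexx orbT.
have := @phi_gt n M (le_trans rx xM) => hM.
have [||y] := @IVT R (phi n) x M v xM.
- by apply: continuous_subspaceT; exact: phi_cont.
- by rewrite ge_min h le_max; apply/orP; right; lra.
- by rewrite in_itv/= => /andP[xy _] e; exists y.
Qed.

(** The map is injective and takes every value above phi n x to the right of x; were it
    not increasing, such a value would be taken twice. *)
Lemma phi_incr n x y : r <= x -> x < y -> phi n x < phi n y.
Proof.
move=> rx xy; rewrite ltNge; apply/negP => h.
have ry : r <= y by lra.
have [z yz ez] := phi_ivt ry h.
have : z = x by apply: (@phi_inj n) => //; lra.
by lra.
Qed.

Definition hair_pt n x : C := pullback a t n (tail_pt n x).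

Lemma hair_pt_cont n : continuous (hair_pt n).
Proof.
move=> x; apply: (@continuous_comp _ _ _ (tail_pt n) (pullback a t n)); first exact: tail_pt_cont.
by apply: continuous_pullback => //; exact: tail_pt_piece.
Qed.

Lemma hair_pt_iter n x : iter n f (hair_pt n x) = tail_pt n x.
Proof. by have [] := pullbackP ha At (tail_pt_piece n x). Qed.

Lemma hair_pt_inj n x y : r <= x -> r <= y -> hair_pt n x = hair_pt n y -> x = y.
Proof.
move=> rx ry e; have : tail_pt n x = tail_pt n y by rewrite -!hair_pt_iter e.
by move=> /(congr1 Re); rewrite !tail_pt_Re; move: rx ry => /max_idPr -> /max_idPr ->.
Qed.

Lemma hair_pt_piece n : hair_piece a r t n = hair_pt n @` `[r, +oo[.
Proof.
apply/seteqP; split=> [z [w hw <-]|z [x _ <-]].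
  exists (Re w); last by rewrite /hair_pt tail_ptK.
  by have /(tailE ha) /(_ 0%N) [_ h] := hw; rewrite /= in_itv/= h.
by exists (tail_pt n x) => //; exact: tail_pt_tail.
Qed.

Lemma hair_pt_phi n x : hair_pt n.+1 (phi n x) = hair_pt n x.
Proof. by rewrite /hair_pt tail_pt_phi pullbackS branchK//; exact: tail_pt_piece. Qed.

(** A clock for the hair: at time s in ]0, n + 1] the point of the hair is the pullback
    of the point of the n-th tail over this abscissa. On ]0, n + 1] the (n + 1)-st
    abscissa is the image of the n-th one; on [n + 1, n + 2] it decreases linearly from
    phi n r to r, and this covers exactly the piece of the hair that the n-th pullback
    misses. *)
Fixpoint abscissa n (s : R) : R :=
  if n is n'.+1 then
    phi n' (abscissa n' (Num.min s n'.+1%:R)) - Num.max 0 (s - n'.+1%:R) * (phi n' r - r)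
  else r / s.

Lemma abscissa_low n s : s <= n.+1%:R -> abscissa n.+1 s = phi n (abscissa n s).
Proof.
move=> h; have e1 : Num.min s n.+1%:R = s by apply/min_idPl.
have e2 : Num.max 0 (s - n.+1%:R) = 0 by apply/max_idPl; rewrite subr_le0.
by rewrite /= e1 e2 mul0r subr0.
Qed.

Lemma abscissa_high n s : abscissa n n.+1%:R = r -> n.+1%:R <= s ->
  abscissa n.+1 s = phi n r - (s - n.+1%:R) * (phi n r - r).
Proof.
move=> e h; have e1 : Num.min s n.+1%:R = n.+1%:R by apply/min_idPr.
have e2 : Num.max 0 (s - n.+1%:R) = s - n.+1%:R by apply/max_idPr; rewrite subr_ge0.
by rewrite /= e1 e2 e.
Qed.

Lemma abscissa_spec n :
  [/\ abscissa n n.+1%:R = r, forall s, 0 < s -> s <= n.+1%:R -> r <= abscissa n s,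
     forall s s', 0 < s -> s < s' -> s' <= n.+1%:R -> abscissa n s' < abscissa n s,
     forall s : R, 0 < s -> continuous_at s (abscissa n) &
     forall x, r <= x -> exists s, [/\ 0 < s, s <= n.+1%:R & abscissa n s = x]].
Proof.
have r1 := r100.
elim: n => [|n [h1 h2 h3 h4 h5]].
  split => /=; rewrite ?mulr1n ?divr1//.
  - by move=> s s0 s1; rewrite ler_pdivlMr// -[leRHS]mulr1 ler_pM2l//; lra.
  - move=> s s' s0 ss s1; rewrite ltr_pM2l; last by lra.
    by rewrite ltf_pV2 ?posrE//; lra.
  - move=> s s0; apply: contM; first exact: cont_cst.
    by apply: cvgV; [rewrite gt_eqF|exact: cvg_id].
  - move=> x rx; have x0 : 0 < x by lra.
    exists (r / x); rewrite divr_gt0//; last by lra.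
    split => //; first by rewrite ler_pdivrMr// mul1r.
    by field; rewrite !gt_eqF//; lra.
have n0 : 0 < n.+1%:R :> R by rewrite ltr0n.
have eS : n.+2%:R = n.+1%:R + 1 :> R by rewrite -natr1.
have pr := @phi_gt n r (lexx r).
split.
- by rewrite abscissa_high// eS; lra.
- move=> s s0 s1; have [s2|s2] := leP s n.+1%:R.
    by rewrite abscissa_low//; have := @phi_gt n _ (h2 s s0 s2); have := h2 s s0 s2; lra.
  by rewrite abscissa_high ?(ltW s2)//; nra.
- move=> s s' s0 ss s1; have [s2|s2] := leP s' n.+1%:R.
    rewrite !abscissa_low//; last by lra.
    by apply: phi_incr; [apply: h2|apply: h3]; lra.
  rewrite [abscissa n.+1 s']abscissa_high ?(ltW s2)//.
  have [s3|s3] := leP s n.+1%:R.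
    rewrite abscissa_low//; apply: (@lt_le_trans _ _ (phi n r)); first by nra.
    have := h2 s s0 s3; rewrite le_eqVlt => /orP[/eqP <- //|h].
    by apply: ltW; apply: phi_incr.
  by rewrite abscissa_high ?(ltW s3)//; nra.
- move=> s s0; have m0 : 0 < Num.min s n.+1%:R by rewrite lt_min s0.
  apply: contB.
    apply: contcomp; last exact: phi_cont.
    apply: (@contcomp R R (fun s => Num.min s n.+1%:R) (abscissa n)); last exact: h4.
    apply: (@continuous_of_lip2 R (fun s => Num.min s n.+1%:R)) => x y.
    have -> : forall x y : R, Num.min x y = - Num.max (- y) (- x).
      by move=> p q; rewrite oppr_max !opprK minC.
    have -> : forall x y : R, Num.min x y = - Num.max (- y) (- x).
      by move=> p q; rewrite oppr_max !opprK minC.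
    rewrite -opprD normrN; apply: le_trans (max_lip _ _ _) _.
    by rewrite -opprD normrN; have := normr_ge0 (x - y); lra.
  apply: contM; last exact: cont_cst.
  apply: (@contcomp R R (fun s => s - n.+1%:R) (fun x => Num.max 0 x)).
    by apply: contB; [exact: cvg_id|exact: cont_cst].
  apply: (@continuous_of_lip2 R (fun x => Num.max 0 x)) => x y.
  by apply: le_trans (max_lip _ _ _) _; have := normr_ge0 (x - y); lra.
- move=> x rx; have [hx|hx] := leP (phi n r) x.
    have [y ry ey] := phi_ivt (lexx r) hx; have [s [s0 s1 es]] := h5 y ry.
    by exists s; split => //; [lra|rewrite abscissa_low// es].
  have d0 : 0 < phi n r - r by lra.
  pose q := (phi n r - x) / (phi n r - r).
  have q0 : 0 <= q by rewrite divr_ge0; lra.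
  have q1 : q <= 1 by rewrite ler_pdivrMr//; lra.
  exists (n.+1%:R + q); split; [lra|lra|].
  rewrite abscissa_high//; last by lra.
  by rewrite /q; field; rewrite gt_eqF.
Qed.

(** For s <= n + 1 every index from n on gives the same point, so the choice of the
    truncation is harmless. *)
Definition hair_map (s : R) : Chat :=
  if 0 < s then Some (hair_pt (Num.truncn s) (abscissa (Num.truncn s) s)) else None.

Lemma hair_pt_step n m s : (n <= m)%N -> 0 < s -> s <= n.+1%:R ->
  hair_pt m (abscissa m s) = hair_pt n (abscissa n s).
Proof.
move=> le_absC s0 hs; elim: m le_absC => [|m IH]; first by rewrite leqn0 => /eqP ->.
rewrite leq_eqVlt => /orP[/eqP -> //|le_absC].
rewrite abscissa_low; last by apply: le_trans hs _; rewrite ler_nat.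
by rewrite hair_pt_phi IH.
Qed.

Lemma hair_mapE n s : 0 < s -> s <= n.+1%:R -> hair_map s = Some (hair_pt n (abscissa n s)).
Proof.
move=> s0 hs; rewrite /hair_map s0; congr Some.
have hN : s <= (Num.truncn s).+1%:R by apply: ltW; exact: truncnS_gt.
have [h|h] := leqP n (Num.truncn s); first exact: hair_pt_step.
by apply/esym/hair_pt_step => //; exact: ltnW.
Qed.

Lemma nat_bound (s : R) : exists n : nat, s < n.+1%:R.
Proof. by exists (Num.truncn s); exact: truncnS_gt. Qed.

Lemma hair_map_piece n : hair_map @` `]0, n.+1%:R] = Some @` hair_piece a r t n.
Proof.
have [h1 h2 h3 h4 h5] := abscissa_spec n.
rewrite hair_pt_piece; apply/seteqP; split=> z.
  move=> [s]; rewrite /= in_itv/= => /andP[s0 s1] <-; rewrite (hair_mapE s0 s1).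
  exists (hair_pt n (abscissa n s)) => //; exists (abscissa n s) => //=.
  by rewrite in_itv/= h2.
move=> [w [x hx <-] <-]; have rx : r <= x by move: hx; rewrite /= in_itv/= andbT.
have [s [s0 s1 es]] := h5 x rx; exists s; first by rewrite /= in_itv/= s0.
by rewrite (hair_mapE s0 s1) es.
Qed.

Lemma hair_map_inj s s' : 0 <= s -> 0 <= s' -> hair_map s = hair_map s' -> s = s'.
Proof.
rewrite le_eqVlt => /orP[/eqP <-|s0]; rewrite le_eqVlt => /orP[/eqP <-|s0'] //.
- by rewrite {1}/hair_map ltxx; have [n hn] := nat_bound s'; rewrite (hair_mapE s0' (ltW hn)).
- by rewrite {2}/hair_map ltxx; have [n hn] := nat_bound s; rewrite (hair_mapE s0 (ltW hn)).
have [n] := nat_bound (Num.max s s'); rewrite gt_max => /andP[hs hs'].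
have [h1 h2 h3 h4 h5] := abscissa_spec n.
rewrite (hair_mapE s0 (ltW hs)) (hair_mapE s0' (ltW hs')) => -[] /hair_pt_inj e.
have {}e : abscissa n s = abscissa n s' by apply: e; apply: h2 => //; exact: ltW.
have [h|h|//] := ltgtP s s'.
  by have := h3 s s' s0 h (ltW hs'); rewrite e ltxx.
by have := h3 s' s s0' h (ltW hs); rewrite e ltxx.
Qed.

Lemma hair_map_cont_pos (s : R) : 0 < s -> continuous_at s hair_map.
Proof.
move=> s0; have [n hn] := nat_bound s; have [h1 h2 h3 h4 h5] := abscissa_spec n.
have hS : continuous_at s (fun s => Some (hair_pt n (abscissa n s)) : Chat).
  apply: (@continuous_comp _ _ _ (fun s => hair_pt n (abscissa n s)) (Some : C -> Chat)).
    by apply: (@continuous_comp _ _ _ (abscissa n) (hair_pt n)); [exact: h4|exact: hair_pt_cont].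
  exact: one_point_compactification_some_continuous.
move=> U; rewrite /= (hair_mapE s0 (ltW hn)) => /hS.
rewrite /= !nbhs_simpl /= => hU.
have n1 : nbhs s [set x : R | 0 < x] by apply: near_gt => //; exact: cvg_id.
have n2 : nbhs s [set x : R | x < n.+1%:R] by apply: near_lt => //; exact: cvg_id.
by apply: filterS3 hU n1 n2 => x /= Ux x0 xn; rewrite (hair_mapE x0 (ltW xn)).
Qed.

(** Near 0 the abscissa is r / s, so the hair leaves every compact set. *)
Lemma hair_map_cont0 : hair_map @ within `[0, +oo[ (nbhs (0 : R)) --> hair_map 0.
Proof.
rewrite {2}/hair_map ltxx => U [K [cK _] KU].
have [M hM] : exists M, forall z, K z -> Re z <= M.
  have : compact (Re @` K).
    by apply: continuous_compact => //; apply: continuous_subspaceT; exact: continuous_Re.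
  move=> /compact_bounded[M0 [_ hM]]; exists (M0 + 1) => z Kz.
  have : M0 < M0 + 1 by lra.
  by move=> /hM /(_ (Re z)) h; apply: le_trans (ler_norm _) _; apply: h; exists z.
have r1 := r100.
have e0 : 0 < r / (`|M| + 1) by rewrite divr_gt0//; have := normr_ge0 M; lra.
have n1 : nbhs (0:R) [set s | s < Num.min 1 (r / (`|M| + 1))].
  by apply: near_lt; [exact: cvg_id|rewrite lt_min ltr01].
rewrite /= nbhs_simpl /=; apply: filterS n1 => s /=; rewrite lt_min => /andP[s1 s2].
rewrite in_itv/= andbT le_eqVlt => /orP[/eqP <-|s0].
  by apply: KU; right; rewrite /hair_map ltxx.
have s1' : s <= 1%:R by exact: ltW.
rewrite (@hair_mapE 0 s s0 s1'); apply: KU; left; exists (hair_pt 0 (abscissa 0 s)) => // /hM.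
rewrite /hair_pt /= tail_pt_Re.
have : `|M| + 1 < r / s.
  by rewrite ltr_pdivlMr// mulrC -ltr_pdivlMr//; have := normr_ge0 M; lra.
by have := ler_norm M; rewrite ge_max => h1 h2 /andP[_]; lra.
Qed.

Lemma hair_map_ray : hair_ray a r t hair_map.
Proof.
split.
- apply/subspace_continuousP => s; rewrite /= in_itv/= andbT le_eqVlt => /orP[/eqP <-|s0].
    exact: hair_map_cont0.
  by apply: cvg_trans (hair_map_cont_pos s0); apply: cvg_app; exact: cvg_within.
- by move=> s s'; rewrite !in_itv/= !andbT; exact: hair_map_inj.
- by rewrite /hair_map ltxx.
- apply/seteqP; split=> z.
    move=> [s]; rewrite /= in_itv/= andbT => s0 <-.
    have [n hn] := nat_bound s.
    have : (hair_map @` `]0, n.+1%:R]) (hair_map s) by exists s => //; rewrite /= in_itv/= s0 ltW.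
    by rewrite hair_map_piece => -[w hw <-]; exists w => //; exists n.
  move=> [w [n _ hw] <-].
  have : (Some @` hair_piece a r t n : set Chat) (Some w) by exists w.
  rewrite -hair_map_piece => -[s]; rewrite /= in_itv/= => /andP[s0 _] e.
  by exists s => //; rewrite /= in_itv/= s0.
- exists (fun n => n.+1%:R); split.
  + by move=> m n mn; rewrite ler_nat.
  + by move=> n; rewrite ltr0n.
  + by move=> n; exact: hair_map_piece.
Qed.

End HairParam.

(** * Nested continua and self-limiting rays *)

Section Continua.
Variables (R : realType) (X : topologicalType).
Hypotheses (cX : compact [set: X]) (hX : hausdorff_space X).

(** If the intersection were separated by two disjoint open sets, compactness would put
    some A n into their union. *)
Lemma connected_bigcap_nested (A : nat -> set X) :
  (forall n, closed (A n)) -> (forall n, connected (A n)) ->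
  (forall m n, (m <= n)%N -> A n `<=` A m) ->
  connected (\bigcap_n A n).
Proof.
move=> cA coA dA; pose K := \bigcap_n A n.
have cK : closed K by apply: closed_bigI => n _; exact: cA.
move=> B B0 [U oU BU] [F cF BF]; apply: contrapT => BK.
pose D := K `&` ~` U.
have cB : closed B by rewrite BF; exact: closedI.
have cD : closed D by apply: closedI => //; exact: open_closedC.
have BD : B `&` D = set0.
  by apply/seteqP; split => // x []; rewrite {1}BU => -[_ Ux] [_ nUx].
have [V [W [oV oW BV DW VW]]] :=
  (@normal_openP R X).1 (compact_normal hX cX) B D cB cD BD.
have [n An] : exists n, A n `<=` V `|` W.
  apply: contrapT => nex.
  have hx n : exists x, A n x /\ ~ (V `|` W) x.
    apply: contrapT => h; apply: nex; exists n => x Ax; apply: contrapT => nVW.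
    by apply: h; exists x.
  have [x hxn] := choice hx.
  have [p [_ hp]] := @cX (x @ \oo) _ filterT.
  have pA n : A n p.
    apply: (cA n) => Z pZ; apply: hp => //; exists n => // k /= nk.
    by apply: (dA n k nk); have [] := hxn k.
  have nVWp : ~ (V `|` W) p.
    move=> VWp; have pn : nbhs p (V `|` W).
      by apply: open_nbhs_nbhs; split => //; exact: openU.
    have FN : (x @ \oo) (~` (V `|` W)) by exists 0%N => // k _; have [] := hxn k.
    by have [q []] := hp _ _ FN pn.
  apply: nVWp; have Kp : K p by move=> n _; exact: pA.
  have [Up|nUp] := pselect (U p); [left; apply: BV|right; apply: DW] => //.
  by rewrite BU.
have KA : K `<=` A n by move=> x; apply.
have e : A n `&` V = A n.
  apply: coA.
  - by have [b Bb] := B0; exists b; split; [apply: KA; move: Bb; rewrite BU => -[]|exact: BV].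
  - by exists V.
  - exists (~` W); first exact: open_closedC.
    apply/seteqP; split=> x [Ax hx]; split => //.
      by move=> Wx; have : (V `&` W) x by []; rewrite VW.
    by case: (An x Ax).
apply: BK; rewrite BU; apply/seteqP; split=> [x []//|x Kx]; split => //.
apply: contrapT => nUx; have Wx : W x by exact: DW.
have [_ Vx] : (A n `&` V) x by rewrite e; exact: KA.
by have : (V `&` W) x by []; rewrite VW.
Qed.

End Continua.

Section SelfLimiting.
Variables (R : realType) (a : R).
Local Notation C := (R[i]^o).
Local Notation Chat := (one_point_compactification C).

Lemma Chat_hausdorff : hausdorff_space Chat.
Proof.
apply: one_point_compactification_hausdorff; [exact: locally_compactC|exact: hausdorffC].
Qed.

Lemma Chat_compact : compact [set: Chat].
Proof. exact: one_point_compactification_compact. Qed.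

Lemma accumulation_setE (h : R -> Chat) :
  accumulation_set h = \bigcap_n closure (final_segment h n.+1%:R).
Proof.
apply/seteqP; split=> [z hz n _|z hz al].
  by apply: hz; rewrite /= in_itv/= andbT ltr0n.
rewrite /= in_itv/= andbT => al0; have [n hn] := nat_bound al.
apply: (closureS _ (hz n I)) => w [s]; rewrite /= in_itv/= andbT => hs <-.
by exists s => //; rewrite /= in_itv/= andbT; apply: le_trans hs; exact: ltW.
Qed.

(** Density gives the closure property at positive times, and continuity of the ray
    extends it to its endpoint at infinity. The accumulation set then contains the ray,
    and it is the intersection of the closures of the connected final segments. *)
Lemma self_limiting_of_dense_ends (r : R) t (h : R -> Chat) :
  hair_ray a r t h ->
  (forall n, h @` `]0, n.+1%:R] = Some @` hair_piece a r t n) ->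
  (forall z, hair a r t z -> forall n (B : set C), nbhs z B ->
     exists z', [/\ B z', hair a r t z' & ~ hair_piece a r t n z']) ->
  limits_on_itself h /\ non_landing h.
Proof.
move=> [hc hi h0 hh _] hp dense.
have pos_lim al s : 0 < al -> 0 < s -> closure (final_segment h al) (h s).
  move=> al0 s0; have : (h @` `]0, +oo[) (h s) by exists s => //; rewrite /= in_itv/= s0.
  rewrite hh => -[z hz <-] B Bz.
  have [n hn] := nat_bound al.
  have [z' [Bz' hz' nz']] := dense z hz n _ Bz.
  have : (Some @` hair a r t : set Chat) (Some z') by exists z'.
  rewrite -hh => -[s']; rewrite /= in_itv/= andbT => s0' e.
  exists (Some z'); split => //; exists s' => //; rewrite /= in_itv/= andbT.
  rewrite leNgt; apply/negP => sal; apply: nz'.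
  have : (Some @` hair_piece a r t n : set Chat) (Some z').
    rewrite -hp; exists s' => //; rewrite /= in_itv/= s0'/=.
    by apply: ltW; apply: lt_trans hn.
  by case=> w hw [<-].
have lim : limits_on_itself h.
  move=> al al0 w [s]; rewrite /= in_itv/= andbT le_eqVlt => /orP[/eqP <-|s0] <-.
    move=> B; rewrite nbhsE => -[B' [oB' B'0] B'B].
    have /subspace_continuousP /(_ 0) := hc.
    rewrite /= in_itv/= lexx => /(_ isT) /(_ B').
    have B'n : nbhs (h 0) B' by apply: open_nbhs_nbhs.
    move=> /(_ B'n); rewrite /= nbhs_simpl /= => /nbhs_ballP[e /= e0 he].
    have hs : B' (h (e / 2)).
      apply: he; first by rewrite /ball/= sub0r normrN gtr0_norm; lra.
      by rewrite /= in_itv/= andbT; lra.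
    have e20 : 0 < e / 2 by lra.
    have [q [Bq sq]] := pos_lim al (e / 2) al0 e20 _ (open_nbhs_nbhs (conj oB' hs)).
    by exists q; split => //; exact: B'B.
  exact: pos_lim.
split => //; rewrite /non_landing; split.
- rewrite accumulation_setE; apply: (subclosed_compact _ Chat_compact) => //.
  by apply: closed_bigI => n _; exact: closed_closure.
- rewrite accumulation_setE; apply: (connected_bigcap_nested R Chat_compact Chat_hausdorff).
  + by move=> n; exact: closed_closure.
  + move=> n; apply: connected_closure; apply: connected_continuous_connected.
      by apply/connected_intervalP; exact: interval_is_interval.
    apply: continuous_subspaceW hc => s; rewrite /= !in_itv/= !andbT.
    by apply: le_trans; exact: ler0n.
  + move=> m n mn; apply: closureS => w [s]; rewrite /= in_itv/= andbT => hs <-.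
    by exists s => //; rewrite /= in_itv/= andbT; apply: le_trans hs; rewrite ler_nat.
- exists (h 0), (h 1); split.
  + move=> al; rewrite /= in_itv/= andbT => al0; apply: lim => //.
    by exists 0 => //; rewrite /= in_itv/= lexx.
  + move=> al; rewrite /= in_itv/= andbT => al0; apply: lim => //.
    by exists 1 => //; rewrite /= in_itv/= andbT ler01.
  + move=> e; have : (0 : R) = 1 by apply: hi => //; rewrite in_itv/= ?lexx ?ler01.
    by move/eqP; rewrite eq_sym oner_eq0.
Qed.

End SelfLimiting.

(** * Orbits through a block of zeros and near the asymptotic value *)

Section Turn.
Variables (R : realType) (a : R) (ha : 3 <= a).
Local Notation C := (R[i]^o).
Local Notation Re := (@complex.Re R).
Local Notation Im := (@complex.Im R).
Local Notation pi := (@pi R).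
Local Notation uc z := (Re z + a - 1).
Local Notation f := (f a).
Local Notation S := (piece a).

(** Iterated exponentials, the natural scale for the escape along zeros. *)
Definition tower j : R := iter j expR 0.

Lemma towerS j : tower j.+1 = expR (tower j). Proof. by []. Qed.

Lemma tower_mono i j : (i <= j)%N -> tower i <= tower j.
Proof.
move=> /subnK <-; elim: (j - i)%N => [//|k IH]; apply: le_trans IH _.
by rewrite addSn towerS; have := expR_ge1Dx (tower (k + i)); lra.
Qed.

Lemma tower_ge_nat j : j%:R <= tower j.
Proof.
elim: j => [//|j IH]; rewrite towerS -natr1.
by have := expR_ge1Dx (tower j); lra.
Qed.

Lemma tower_ge0 j : 0 <= tower j.
Proof. exact: le_trans (ler0n _ _) (tower_ge_nat j). Qed.

Lemma zero_piece_uc s (w : C) : S s w -> ~~ digit s -> -1 < uc w.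
Proof.
rewrite /piece /reg /=; case: (digit s) => // -[h1 h2 h3] _.
by rewrite ltNge; apply/negP => h; have := Qf_left h h1 (ltW h2); lra.
Qed.

(** Symbol 0 means u > -1, so a large image with bounded imaginary part can only lie to
    the right. *)
Lemma zero_block_pos s (w : C) : 2 <= uc w -> S s (f w) -> ~~ digit s -> 0 <= Re (f w).
Proof.
have a3 := ha; move=> hu hs ds; rewrite leNgt; apply/negP => h.
have h1 := zero_piece_uc hs ds; have h2 := piece_Im_lt8 hs.
have u0 : 0 <= uc w by lra.
have h3 := absC_f_ge ha u0; have h4 := absC_le_add (f w); rewrite (ltr0_norm h) in h4.
have h5 := expR_lin_ge ha (Re w).
have e4 : 4 <= expR (Re w + a) by have := expR_ge1Dx (Re w + a); lra.
have h6 : a * 4 * 2 <= a * expR (Re w + a) * uc w.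
  by apply: ler_pM; rewrite ?mulr_ge0//; [lra|rewrite ler_pM2l//; lra].
by lra.
Qed.

Lemma zero_block k (s : nat -> Asymbol) (q : C) :
  (forall i, (i <= k)%N -> S (s i) (iter i f q)) ->
  (forall i, (i < k)%N -> ~~ digit (s i)) ->
  0 <= Re (iter k f q) -> 0 <= Re q ->
  forall i, (i <= k)%N -> tower i <= Re (iter i f q).
Proof.
have a3 := ha; move=> hS hd hk q0; elim=> [//|i IH] ik.
have h := IH (ltnW ik); have h0 := tower_ge0 i.
have u2 : 2 <= uc (iter i f q) by lra.
have hS' := hS i.+1 ik; rewrite iterS in hS'.
have p : 0 <= Re (f (iter i f q)).
  move: (ik); rewrite leq_eqVlt => /orP[/eqP e|ik']; first by rewrite -iterS e.
  exact: zero_block_pos u2 hS' (hd _ ik').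
have := grow_exp ha u2 p (ltW (piece_Im_lt8 hS')); rewrite iterS towerS.
have : expR (tower i) <= expR (Re (iter i f q)) by rewrite ler_expR.
by lra.
Qed.

(** In a part of T_0 with positive image, y lies in ]0, pi / 2] and Q is at least y / 2. *)
Lemma im_expand s (w : C) : S s w -> ~~ digit s -> 2 <= uc w -> 0 < Re (f w) ->
  expR (Re w) * `|Im w| <= `|Im (f w)|.
Proof.
have a3 := ha; move=> hw ds hu hP; have k0 := aexp_gt0 ha (Re w + a).
rewrite Re_f pmulr_rgt0// in hP.
rewrite Im_f normrM gtr0_norm//.
move: hw; rewrite /piece /reg /=; case: (digit s) ds => // _ [h1 h2 h3].
rewrite -(Pf_sgn s) in hP.
have e1 : `|Im w| = sgn R s * Im w := sgn_norm h1.
have e2 : `|Qf (uc w) (Im w)| = Qf (uc w) (sgn R s * Im w).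
  rewrite -[RHS]gtr0_norm// Qf_sgn normrM.
  by case: (sgnP R s) => ->; rewrite ?normrN normr1 mul1r.
rewrite e1 e2; set y := sgn R s * Im w in h1 h2 h3 hP *; set u := uc w in hu hP h3 *.
have s0 := sin_gt0 h1 h2.
have c0 : 0 < cos y.
  rewrite ltNge; apply/negP => c0; move: hP; rewrite /Pf.
  have := mulr_gt0 h1 s0; have : u * cos y <= 0 by apply: mulr_ge0_le0; lra.
  lra.
have y2 : y <= pi / 2 by rewrite leNgt; apply/negP => h; have := @cos_lt0 R y; lra.
have s1 := sin_ge_quarter (ltW h1) y2.
have q1 : y / 2 <= Qf u y by rewrite /Qf; nra.
have e3 : expR (Re w) <= expR (Re w + a) by rewrite ler_expR; lra.
have E0 := expR_gt0 (Re w); have E1 := expR_gt0 (Re w + a).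
apply: (@le_trans _ _ (expR (Re w + a) * y)); first by rewrite ler_pM2r.
rewrite [a * _]mulrC -mulrA ler_pM2l//.
nra.
Qed.

(** The last of the zeros multiplies the height by e to a tower, the earlier ones do not
    decrease it, and the final height is less than 8. *)
Lemma zero_block_im k (s : nat -> Asymbol) (q : C) :
  (forall i, (i <= k.+1)%N -> S (s i) (iter i f q)) ->
  (forall i, (i < k.+1)%N -> ~~ digit (s i)) ->
  0 < Re (iter k.+1 f q) -> 0 <= Re q ->
  expR (tower k) * `|Im q| <= 8.
Proof.
have a3 := ha; move=> hS hd hk q0; have T := zero_block hS hd (ltW hk) q0.
have step i : (i < k.+1)%N ->
    expR (Re (iter i f q)) * `|Im (iter i f q)| <= `|Im (iter i.+1 f q)|.
  move=> ik; rewrite iterS; apply: im_expand (hd _ ik) _ _; first by apply: hS; exact: ltnW.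
    by have := T i (ltnW ik); have := tower_ge0 i; lra.
  rewrite -iterS; apply: lt_le_trans (T i.+1 ik).
  by rewrite towerS expR_gt0.
have mono i : (i <= k)%N -> `|Im q| <= `|Im (iter i f q)|.
  elim: i => [//|i IH] ik; apply: le_trans (IH (ltnW ik)) _.
  have ik' : (i < k.+1)%N by exact: leqW.
  apply: le_trans (step i ik'); rewrite ler_peMl//.
  by have := expR_ge1Dx (Re (iter i f q)); have := T i (ltnW ik'); have := tower_ge0 i; lra.
have h1 := step k (leqnn _); have h2 := piece_Im_lt8 (hS k.+1 (leqnn _)).
have h3 := mono k (leqnn _).
have h4 : expR (tower k) <= expR (Re (iter k f q)) by rewrite ler_expR; apply: T.
apply: le_trans (ltW h2); apply: le_trans h1.
by apply: ler_pM => //; exact: expR_ge0.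
Qed.

(** The only zero 1 - a of f_a lies in T_0, so on T_1 the linear factor is bounded below
    and f_a is small only where the exponential is small. *)
Lemma one_piece_away s (w : C) : S s w -> digit s -> 1 / 2 <= absC (uc w +i* Im w : C).
Proof.
rewrite /piece /reg /=; case: (digit s) => // -[h1 h2 h3] _.
rewrite leNgt; apply/negP => h.
have hu := le_lt_trans (normRe_le_absC _) h; have hy := le_lt_trans (normIm_le_absC _) h.
rewrite /= in hu hy; rewrite (sgn_norm h1) in hy.
move: h3; rewrite /Qf; set y := sgn R s * Im w in h1 hy *; set u := uc w in hu *.
have s1 := sin_lt_id h1; have c1 := one_sub_cos y.
have s0 : 0 < sin y by apply: sin_gt0 => //; have := @pi_ge2 R; lra.
move: hu; rewrite ltr_norml => /andP[u1 u2]; nra.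
Qed.

Lemma one_piece_exp_le s (w : C) : S s w -> digit s -> expR (uc w) <= absC (f w).
Proof.
have a3 := ha; move=> hw ds; have h := one_piece_away hw ds; rewrite (absC_f ha).
have E1 := expR_gt0 (uc w).
have -> : expR (Re w + a) = expR 1 * expR (uc w) by rewrite -expRD; congr expR; ring.
have := @expR1_ge2 R => e2.
have : 1 * expR (uc w) <= (a * expR 1 * absC (uc w +i* Im w : C)) * expR (uc w).
  rewrite ler_pM2r//; have e6 : 6 <= a * expR 1 by nra.
  by nra.
by rewrite mul1r; move=> k; apply: le_trans k _; rewrite le_eqVlt; apply/orP; left; apply/eqP; ring.
Qed.

(** A value within e^(- B) of the asymptotic value 0 is taken on T_1 only at distance of
    order B to the left. *)
Lemma far_left s (w : C) B : S s w -> digit s -> absC (f w) <= 8 * expR (- B) ->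
  B - 1 <= absC w.
Proof.
have a3 := ha; move=> hw ds h.
have h1 := le_trans (one_piece_exp_le hw ds) h.
have h2 : uc w <= 3 - B.
  have : expR (uc w) <= expR (3 - B).
    apply: le_trans h1 _; rewrite expRD ler_pM2r ?expR_gt0//.
    have -> : 3 = 1 + 1 + 1 :> R by ring.
    by rewrite !expRD; have := @expR1_ge2 R; nra.
  by rewrite ler_expR.
apply: le_trans (normRe_le_absC w); rewrite -normrN; apply: le_trans (ler_norm _); lra.
Qed.

(** On T_1 the modulus of f_a decays to the left and grows to the right, so values of
    moderate modulus are taken in a fixed bounded region. *)
Definition mid_const : R := 2 * `|ln (16 * a)| + 4 * a + 40.

Lemma mid_bound s (w : C) : S s w -> digit s -> 1 <= absC (f w) -> absC (f w) <= 9 ->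
  absC w <= mid_const.
Proof.
have a3 := ha; move=> hw ds h1 h9.
have hI := piece_Im_lt8 hw.
have u1 : uc w <= 8.
  by have := one_piece_exp_le hw ds; have := expR_ge1Dx (uc w); lra.
have u2 : - (2 * `|ln (16 * a)|) - 2 <= uc w.
  rewrite leNgt; apply/negP => hlt; have l0 := normr_ge0 (ln (16 * a)).
  have u0 : uc w <= 0 by lra.
  have := absC_f_le_left ha hI u0.
  have : 16 * a * expR (1 + uc w / 2) < 1; last by lra.
  have a16 : 0 < 16 * a by lra.
  rewrite -[X in X * _](lnK (x := 16 * a)) ?posrE// -expRD expR_lt1.
  by have := ler_norm (ln (16 * a)); lra.
apply: le_trans (absC_le_add _) _.
have : `|Re w| <= 2 * `|ln (16 * a)| + a + 20.
  by have := normr_ge0 (ln (16 * a)); rewrite ler_norml; lra.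
by rewrite /mid_const; lra.
Qed.

(** One application of f_a multiplies e^x by a constant and a linear factor, and both
    are absorbed by squaring. *)
Lemma far_const_le_exp : exists X0 : R, forall x, X0 <= x -> far_const a (x + a) <= expR (2 * x).
Proof.
have a3 := ha; pose c := 16 * a * expR (a + 1) + 1.
have e0 : 0 < 16 * a * expR (a + 1) by rewrite mulr_gt0 ?expR_gt0//; lra.
exists (4 * c + a + 9) => x hx; have c1 : 1 < c by rewrite /c; lra.
have x0 : 0 <= x by lra.
have h1 : 1 + x ^+ 2 / 2 <= expR x by have := @expR_ge1Dxn R x 1 x0; rewrite /= .
have E1 : 1 <= expR x by have := sqr_ge0 x; lra.
rewrite /far_const.
have -> : expR (x + a + 1) = expR (a + 1) * expR x by rewrite -expRD; congr expR; ring.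
have -> : expR (2 * x) = expR x * expR x by rewrite -expRD; congr expR; ring.
have h2 : c * (2 * x) <= x ^+ 2 / 2 by nra.
have h3 : (c - 1) * (x + a + 8) <= c * (2 * x) - 1 by nra.
have -> : 16 * a * (expR (a + 1) * expR x) * (x + a + 8) = (c - 1) * (x + a + 8) * expR x.
  by rewrite /c; ring.
have : (c - 1) * (x + a + 8) * expR x <= (expR x - 1) * expR x.
  by rewrite ler_pM2r ?expR_gt0//; lra.
by lra.
Qed.

End Turn.

(** * The turn, and density of the final segments *)

(** The margin J is arbitrary, so the tower of height k produced by the zeros beats a
    tower of height m + J, whatever constant J an orbit requires. *)
Definition long_zero_runs (b : nat -> bool) := forall J, exists m k,
  [/\ (J <= m)%N, (m + J + 10 <= k)%N, b m.+1 & forall i, (i < k)%N -> ~~ b (m.+2 + i)%N].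

Section Density.
Variables (R : realType) (a : R) (ha : 3 <= a).
Local Notation C := (R[i]^o).
Local Notation Re := (@complex.Re R).
Local Notation Im := (@complex.Im R).
Local Notation uc z := (Re z + a - 1).
Local Notation f := (f a).
Local Notation S := (piece a).

(** Beyond this abscissa the cone estimates apply, and a point whose image is within 16
    of the half-plane to the right of it has u >= 100, so that [expansion_piece] applies
    too. *)
Definition escape_radius : R := 100 * 300 + far_const a 100 + 16.

Lemma far_const_gt0 V : 0 <= V -> 0 < far_const a V.
Proof.
have a3 := ha; move=> V0; rewrite /far_const.
have : 0 <= 16 * a * expR (V + 1) * (V + 8) by rewrite !mulr_ge0 ?expR_ge0//; lra.
by lra.
Qed.

Lemma ivt_between (F : R -> R) x y v : continuous F -> v <= F x -> F y <= v ->
  exists c, [/\ Num.min x y <= c, c <= Num.max x y & F c = v].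
Proof.
move=> cF hx hy; have [xy|yx] := leP x y.
  have [||c] := @IVT R F x y v xy.
  - exact: continuous_subspaceT.
  - by rewrite ge_min le_max hx hy orbT.
  - by rewrite in_itv/= => /andP[h1 h2] e; exists c.
have [||c] := @IVT R F y x v (ltW yx).
- exact: continuous_subspaceT.
- by rewrite ge_min le_max hx hy orbT.
- by rewrite in_itv/= => /andP[h1 h2] e; exists c.
Qed.

Lemma exp_double_le (x y : R) : x <= y / 4 -> 6 <= y -> expR (2 * x) <= expR y / 4.
Proof.
move=> xy y6; have e1 : expR (2 * x) <= expR (y / 2) by rewrite ler_expR; lra.
have e2 : expR y = expR (y / 2) * expR (y / 2) by rewrite -expRD; congr expR; field.
have e3 := expR_ge1Dx (y / 2); rewrite e2; nra.
Qed.

Variables (r : R) (hR : escape_radius <= r) (t : nat -> Asymbol).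
Hypotheses (At : Asequence t) (Ot : often_one t).

Lemma escape_radius_far : far_const a 100 + 16 <= r.
Proof. by move: hR; rewrite /escape_radius; lra. Qed.

Lemma escape_radius_ge : 100 * 300 <= r.
Proof. by have := far_const_gt0 (ler0n R 100); move: hR; rewrite /escape_radius; lra. Qed.

Let r100 : 100 <= r. Proof. by move: escape_radius_ge; lra. Qed.

Local Notation T := (tail_pt ha escape_radius_ge At Ot).
Local Notation tailn n := (tail a r (Defs.shift n t)).

Lemma tailnP n (z : C) : tailn n z <->
  forall i, S (t (n + i)%N) (iter i f z) /\ r <= Re (iter i f z).
Proof. exact: (tailE ha). Qed.

Lemma tailn_iter n l (z : C) : tailn n z -> tailn (n + l) (iter l f z).
Proof.
move=> /tailnP h; apply/tailnP => i; rewrite -iterD.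
by have -> : (n + l + i = n + (i + l))%N by lia.
Qed.

(** The images of the part of a tail to the right of y cover the part of a later tail to
    the right of the image, because each [phi] does. *)
Lemma orbit_cover l m y x : r <= y -> Re (iter l f (T m y)) <= x ->
  exists2 y', y <= y' & iter l f (T m y') = T (m + l)%N x.
Proof.
elim: l x => [|l IH] x ry.
  rewrite /= tail_pt_Re; move: (ry) => /max_idPr -> yx; exists x => //.
  by rewrite addn0.
pose z := iter l f (T m y); have hz : tailn (m + l) z by apply: tailn_iter; exact: tail_pt_tail.
have rz : r <= Re z by have /tailnP /(_ 0%N) [] := hz.
rewrite iterS -/z -(tail_ptK ha escape_radius_ge At Ot hz) => hx.
have [y1 h1 e1] := phi_ivt rz hx.
have [y' yy' e'] := IH y1 ry h1; exists y' => //.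
by rewrite iterS e' -tail_pt_phi e1 addnS.
Qed.

(* One turn. From time m + 1 on the sequence reads 1 0^(k+1), and z is a point of the
   m-th tail; the last two hypotheses on z say that its abscissa is negligible compared
   with the tower of the zeros and larger than the fixed bound of [mid_bound]. *)
Section OneTurn.
Variables (m k : nat) (z : C).
Hypothesis d1 : digit (t m.+1).
Hypothesis dk : forall i, (i < k.+1)%N -> ~~ digit (t (m.+2 + i)).
Hypothesis hz : tailn m z.
Hypotheses (zfar : far_const a (Re z + a) <= tower R k - 1)
  (zmid : mid_const a < Re z) (rk : r < tower R k.+1).

Let n := (m + k.+3)%N.
(** The curve of points that follow the symbols from time m on and reach the n-th tail
    after the block; q is the iterate at which the zeros begin. *)
Let P x : C := pullback a (Defs.shift m t) k.+3 (T n x).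
Let q x : C := f (f (P x)).

Let TS x : S (Defs.shift m t k.+3) (T n x). Proof. exact: (tail_pt_piece ha escape_radius_ge At Ot n x). Qed.

Let PP x : iter k.+3 f (P x) = T n x /\
  forall i, (i <= k.+3)%N -> S (t (m + i)) (iter i f (P x)).
Proof. exact: (pullbackP ha (Asequence_shift m At) (TS x)). Qed.

Let P_cont : continuous P.
Proof.
move=> x; apply: (@continuous_comp _ _ _ (T n) (pullback a (Defs.shift m t) k.+3)).
  exact: tail_pt_cont.
exact: (continuous_pullback ha (Asequence_shift m At) (TS x)).
Qed.

Let q_cont : continuous (fun x => Re (q x)).
Proof.
move=> x; apply: (@continuous_comp _ _ _ q Re); last exact: continuous_Re.
apply: (@continuous_comp _ _ _ (fun x => f (P x)) f); last exact: continuous_f.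
by apply: (@continuous_comp _ _ _ P f); [exact: P_cont|exact: continuous_f].
Qed.

Let q_iter i x : iter i f (q x) = iter i.+2 f (P x).
Proof. by rewrite /q !iterSr. Qed.

Let q_S x i : (i <= k.+1)%N -> S (t (m.+2 + i)) (iter i f (q x)).
Proof.
move=> ik; rewrite q_iter; have [_ h] := PP x; have := h i.+2; rewrite !ltnS => /(_ ik).
by have -> : (m + i.+2 = m.+2 + i)%N by lia.
Qed.

Let q_end x : Re (iter k.+1 f (q x)) = Num.max r x.
Proof. by rewrite q_iter; have [-> _] := PP x; rewrite tail_pt_Re. Qed.

Let q_end_gt0 x : 0 < Re (iter k.+1 f (q x)).
Proof. by rewrite q_end lt_max; apply/orP; left; have := r100; lra. Qed.

(** Otherwise the zeros would send q r beyond r, but it ends on the line of abscissa r. *)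
Let q_low : Re (q r) < 0.
Proof.
rewrite ltNge; apply/negP => h.
have := zero_block ha (q_S r) dk (ltW (q_end_gt0 r)) h (leqnn _).
by rewrite q_end maxxx; have := rk; lra.
Qed.

(** If Re (q x) stayed bounded by 1, so would all k + 1 further iterates, but the last
    one has abscissa x. *)
Let q_high : exists2 x, r <= x & 1 < Re (q x).
Proof.
have a3 := ha.
have bd i : exists b, 0 <= b /\ forall x, Re (q x) <= 1 -> (i <= k.+1)%N ->
    Re (iter i f (q x)) <= b.
  elim: i => [|i [b [b0 hb]]]; first by exists 1.
  exists (far_const a (b + a)); split; first by apply/ltW/far_const_gt0; lra.
  move=> x hx ik; have h := hb x hx (ltnW ik).
  have ba : 0 <= b + a by lra.
  have := far_constP ha ba (piece_Im_lt8 (q_S x (ltnW ik))) => k0; rewrite iterS.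
  apply: le_trans (ler_norm _) _; apply: le_trans (normRe_le_absC _) _.
  by apply: ltW; apply: k0; lra.
have [b [b0 hb]] := bd k.+1.
exists (Num.max r (b + 1)); first by rewrite le_max lexx.
rewrite ltNge; apply/negP => h; have := hb _ h (leqnn _); rewrite q_end.
have hb1 : b + 1 <= Num.max r (Num.max r (b + 1)) by rewrite !le_max lexx !orbT.
by lra.
Qed.

Let q_value v : 0 <= v -> v <= 1 -> exists2 x, r <= x & Re (q x) = v.
Proof.
move=> v0 v1; have [x1 rx h1] := q_high.
have [||c [h2 _ e]] := @ivt_between (fun x => Re (q x)) x1 r v q_cont.
- by lra.
- by have := q_low; lra.
- by exists c => //; move: h2; rewrite ge_min => /orP[]; lra.
Qed.

Let xstar := Re (iter k.+3 f z).

(** From the final abscissa of z on, the curve P runs along the m-th tail itself, where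
    all iterates are to the right of r. *)
Let q_right x : xstar <= x -> r <= Re (q x).
Proof.
move=> hx; have rz : r <= Re z by have /tailnP /(_ 0%N) [] := hz.
have ez := tail_ptK ha escape_radius_ge At Ot hz.
have [|y' yy e] := @orbit_cover k.+3 m (Re z) x rz; first by rewrite ez.
have /tailnP h := tail_pt_tail ha escape_radius_ge At Ot m y'.
have eP : P x = T m y'.
  rewrite /P /n -e; apply: pullbackK => // i _; exact: (h i).1.
by rewrite /q eP; have [_] := h 2%N.
Qed.

Let lt_xstar x : Re (q x) < r -> x < xstar.
Proof. by move=> h; rewrite ltNge; apply/negP => /q_right; lra. Qed.

Let P_S0 x : S (t m) (P x).
Proof. by have [_ /(_ 0%N (leq0n _))] := PP x; rewrite addn0. Qed.

Let P_S1 x : S (t m.+1) (f (P x)).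
Proof. by have [_ /(_ 1%N isT)] := PP x; rewrite addn1. Qed.

(** The zeros force q x to be almost 0, hence f (P x) is extremely far to the left, and
    this is impossible if P x has an abscissa below that of z. *)
Let P_far x : Re (q x) = 0 -> Re z <= Re (P x).
Proof.
have a3 := ha; move=> qx; rewrite leNgt; apply/negP => h.
have rz : r <= Re z by have /tailnP /(_ 0%N) [] := hz.
have q0 : 0 <= Re (q x) by rewrite qx.
have hi := zero_block_im ha (q_S x) dk (q_end_gt0 x) q0.
have nq : absC (f (f (P x))) <= 8 * expR (- tower R k).
  apply: le_trans (absC_le_add _) _; rewrite -/(q x) qx normr0 add0r.
  by rewrite expRN ler_pdivlMr ?expR_gt0// mulrC.
have h1 := far_left ha (P_S1 x) d1 nq.
have V0 : 0 <= Re z + a by have := r100; lra.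
have := far_constP ha V0 (piece_Im_lt8 (P_S0 x)) => h2.
have {}h2 : absC (f (P x)) < far_const a (Re z + a) by apply: h2; lra.
by have := zfar; lra.
Qed.

(** Here f (P x) lies in the bounded region of [mid_bound], whereas a point to the right
    of z has a larger image. *)
Let P_near x : Re (q x) = 1 -> Re (P x) <= Re z.
Proof.
have a3 := ha; move=> qx; rewrite leNgt; apply/negP => h.
have rz : r <= Re z by have /tailnP /(_ 0%N) [] := hz.
have rr := r100.
have n1 : 1 <= absC (f (f (P x))) by apply: le_trans (normRe_le_absC _); rewrite -/(q x) qx normr1.
have n9 : absC (f (f (P x))) <= 9.
  apply: le_trans (absC_le_add _) _; rewrite -/(q x) qx normr1.
  by have := piece_Im_lt8 (q_S x (leq0n _)); rewrite /=; lra.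
have h1 := mid_bound ha (P_S1 x) d1 n1 n9.
have u0 : 0 <= uc (P x) by lra.
by have := absC_f_ge_lin ha u0; have := zmid; lra.
Qed.

(** Between the two parameters [P_far] and [P_near] the abscissa of P takes the value Re
    z. The orbit leaves the half-plane to the right of r, since otherwise P c would be
    the point z of the tail over this abscissa, but it reaches the n-th tail at the
    abscissa c, to the left of where z does. *)
Lemma turn_point : exists p : C, [/\ Re p = Re z,
  forall i, S (t (m + i)) (iter i f p), exists i, Re (iter i f p) < r &
  exists i0, forall i, (i0 <= i)%N -> r <= Re (iter i f p)].
Proof.
have rr := r100.
have [xA rA qA] := q_value (lexx 0) ler01; have [xB rB qB] := q_value ler01 (lexx 1).
have PRc : continuous (fun x => Re (P x)).
  by move=> x; apply: (@continuous_comp _ _ _ P Re); [exact: P_cont|exact: continuous_Re].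
have [c [c1 c2 ec]] := ivt_between PRc (P_far qA) (P_near qB).
have cx : c < xstar.
  by apply: le_lt_trans c2 _; rewrite gt_max; apply/andP; split; apply: lt_xstar; lra.
have rc : r <= c by apply: le_trans c1; rewrite le_min rA.
have [eT hS] := PP c.
have late i : (k.+3 <= i)%N -> S (t (m + i)) (iter i f (P c)) /\ r <= Re (iter i f (P c)).
  move=> ik; have /tailnP h := tail_pt_tail ha escape_radius_ge At Ot n c.
  rewrite -(subnK ik) iterD eT; have := h (i - k.+3)%N.
  by rewrite /n -addnA [(k.+3 + _)%N]addnC.
have allS i : S (t (m + i)) (iter i f (P c)).
  by have [ik|/ltnW ik] := leqP i k.+3; [exact: hS|have [] := late i ik].
exists (P c); split => //; last by exists k.+3 => i /late[].
apply: contrapT => nex.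
have tP : tailn m (P c).
  apply/tailnP => i; split; first exact: allS.
  by rewrite leNgt; apply/negP => h; apply: nex; exists i.
have e : P c = z by rewrite -(tail_ptK ha escape_radius_ge At Ot tP) ec (tail_ptK ha escape_radius_ge At Ot hz).
move: eT; rewrite e => /(congr1 Re); rewrite -/xstar tail_pt_Re.
by move: rc => /max_idPr ->; lra.
Qed.

End OneTurn.

Hypothesis blocks : long_zero_runs (erase t).

Lemma orbit_large (z : C) M X : (forall i, S (t i) (iter i f z)) ->
  (forall i, (M <= i)%N -> r <= Re (iter i f z)) ->
  exists2 M', (M <= M')%N & forall i, (M' <= i)%N -> X <= Re (iter i f z).
Proof.
have a3 := ha; have rr := r100; move=> hS hM.
have g j : j%:R <= Re (iter (M + j) f z).
  elim: j => [|j IH]; first by have := hM (M + 0)%N (leq_addr _ _); lra.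
  have h1 := hM (M + j)%N (leq_addr _ _); have h2 := hM (M + j).+1 (leqW (leq_addr _ _)).
  have h3 := hS (M + j).+1; rewrite addnS; rewrite iterS in h2 h3 *.
  have u2 : 2 <= uc (iter (M + j) f z) by lra.
  have p0 : 0 <= Re (f (iter (M + j) f z)) by lra.
  have := grow_lin ha u2 p0 (ltW (piece_Im_lt8 h3)); rewrite -natr1; lra.
have [j hj] := nat_bound X; exists (M + j.+1)%N; first exact: leq_addr.
move=> i hi; apply: (le_trans (ltW hj)).
have := g (i - M)%N; rewrite subnKC; last by apply: leq_trans hi; exact: leq_addr.
by apply: le_trans; rewrite ler_nat leq_subRL// (leq_trans (leq_addr _ _) hi).
Qed.

(** One step at most squares e^x, hence [exp_double_le] gains one storey of the tower
    per step, with the margin 1 / 4 restored. *)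
Lemma orbit_tower (z : C) M : (forall i, S (t i) (iter i f z)) ->
  (forall i, (M <= i)%N -> r <= Re (iter i f z)) ->
  (forall i, (M <= i)%N -> far_const a (Re (iter i f z) + a) <= expR (2 * Re (iter i f z))) ->
  exists J, forall i, (M <= i)%N -> Re (iter i f z) <= tower R (i + J) / 4.
Proof.
have a3 := ha; have rr := r100; move=> hS hM hX.
have [J hJ] := nat_bound (4 * Re (iter M f z)).
exists (J.+1 + 6)%N => i /subnK <-; elim: (i - M)%N => [|j IH].
  have : J.+1%:R <= tower R (M + (J.+1 + 6)).
    apply: le_trans (tower_ge_nat R _); rewrite ler_nat addnCA; exact: leq_addr.
  by rewrite add0n; lra.
set x := Re (iter (j + M) f z) in IH.
have hxM : (M <= j + M)%N by exact: leq_addl.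
have h1 := hM _ hxM; have h2 := hX _ hxM.
have ba : 0 <= Re (iter (j + M) f z) + a by lra.
have h3 : Re (iter (j.+1 + M) f z) <= expR (2 * x).
  rewrite addSn iterS; apply: le_trans (ler_norm _) _; apply: le_trans (normRe_le_absC _) _.
  apply: le_trans h2; apply: ltW; apply: (far_constP ha ba (piece_Im_lt8 (hS _))); lra.
apply: le_trans h3 _; rewrite !addSn towerS; set y := tower R _ in IH *.
have y6 : 6 <= y.
  by apply: le_trans (tower_ge_nat R _); rewrite ler_nat !addnA; exact: leq_addl.
exact: exp_double_le.
Qed.

(** The expansion read backwards: as long as z is in the far right half-plane, each step
    back halves the distance. A distance of at most 16 keeps the companion point far
    enough to the right as well. *)
Lemma backward_close (z z' : C) M m :
  (forall i, (i <= m)%N -> S (t i) (iter i f z)) ->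
  (forall i, (i <= m)%N -> S (t i) (iter i f z')) ->
  (forall i, (M <= i)%N -> r <= Re (iter i f z)) ->
  absC (iter m f z - iter m f z') <= 16 -> forall j, (M + j <= m)%N ->
  2 ^+ j * absC (iter (m - j) f z - iter (m - j) f z') <= 16.
Proof.
have a3 := ha; have rf := escape_radius_far; have rr := r100; have F0 := far_const_gt0 (ler0n R 100).
move=> hS hS' hM h16; elim=> [|j IH] hj; first by rewrite subn0 expr0 mul1r.
have hj' : (M + j <= m)%N by apply: leq_trans hj; rewrite addnS.
have {}IH := IH hj'.
have jm : (j < m)%N by apply: leq_trans hj; rewrite addnS ltnS leq_addl.
have eS : (m - j)%N = (m - j.+1).+1 by rewrite subnSK.
set i := (m - j.+1)%N in eS *.
have p2 : 1 <= 2 ^+ j :> R by rewrite exprn_ege1// ler1n.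
have n0 := absC_ge0 (iter (m - j) f z - iter (m - j) f z').
have n16 : absC (iter (m - j) f z - iter (m - j) f z') <= 16 by nra.
rewrite eS !iterS in IH n16.
have im : (i < m)%N by rewrite -eS leq_subr.
have Mi : (M <= i)%N by rewrite /i leq_subRL// addnC.
have r1 := hM i.+1 (leqW Mi); rewrite iterS in r1.
have r2 : r - 16 <= Re (f (iter i f z')).
  have := normRe_le_absC (f (iter i f z) - f (iter i f z')); rewrite ReB ler_norml => /andP[_ h].
  by lra.
have large (w : C) : `|Im w| < 8 -> r - 16 <= Re (f w) -> 100 <= uc w.
  move=> hI hw; rewrite leNgt; apply/negP => h.
  have := far_constP ha (ler0n R 100) hI (ltW h).
  have := normRe_le_absC (f w); have := ler_norm (Re (f w)); lra.
have s1 := hS i (ltnW im); have s2 := hS' i (ltnW im).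
have s3 := hS i.+1 im; have s4 := hS' i.+1 im; rewrite iterS in s3; rewrite iterS in s4.
have := expansion_piece ha s1 s2 s3 s4.
have p1 : 0 < Re (f (iter i f z)) by lra.
have p3 : 0 < Re (f (iter i f z')) by lra.
have l1 : 100 <= uc (iter i f z) by apply: large (piece_Im_lt8 s1) _; lra.
have l2 : 100 <= uc (iter i f z') by apply: large (piece_Im_lt8 s2) _; lra.
move=> /(_ p1 p3 l1 l2) h; apply: le_trans IH; rewrite exprS mulrC mulrA [_ * 2]mulrC.
rewrite [leRHS]mulrC ler_wpM2r//; lra.
Qed.

(** Choose a block late enough, apply [turn_point] to the m-th iterate of z, and pull
    the result back to time 0: [backward_close] brings it close to the orbit of z at the
    fixed time M, and the pullback from time M is continuous. The new point leaves the
    right half-plane after time N, so it is not in the N-th piece. *)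
Lemma dense_ends (z : C) : hair a r t z -> forall N (B : set C), nbhs z B ->
  exists z', [/\ B z', hair a r t z' & ~ hair_piece a r t N z'].
Proof.
have a3 := ha; have rr := r100.
move=> /(hairE ha _ _ At)[hS [M0 hM0]] N B Bz.
have [X0 hX0] := far_const_le_exp ha.
have [M M0M hM] := orbit_large (Num.max X0 (mid_const a + 1)) hS hM0.
have hMr i : (M <= i)%N -> r <= Re (iter i f z).
  by move=> h; apply: hM0; exact: leq_trans h.
have hX i : (M <= i)%N -> far_const a (Re (iter i f z) + a) <= expR (2 * Re (iter i f z)).
  by move=> /hM; rewrite ge_max => /andP[h _]; exact: hX0.
have [J hJ] := orbit_tower hS hMr hX.
(* the pullback to time 0 of a small disc around the M-th iterate *)
have eM : pullback a t M (iter M f z) = z by apply: pullbackK => // k _; exact: hS.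
have cp := continuous_pullback ha At (hS M).
have := cp B; rewrite /= eM => /(_ Bz) /nbhs_absC[e e0 he].
have [E hE] := nat_bound (16 / e).
have [Q hQ] := nat_bound r.
have [m [k [hm hk d1 dk]]] := blocks (M + J + N + E.+1 + Q.+1 + 6).
have Mm : (M <= m)%N by clear -hm; lia.
have [k' ek] : exists k', k = k'.+1 by exists k.-1; clear -hk; lia.
rewrite {k}ek in hk dk.
have m1 : ((m + J).+1 <= k')%N by clear -hm hk; lia.
have m6 : (6 <= m + J)%N by clear -hm; lia.
have mQ : (Q.+1 <= k'.+1)%N by clear -hm hk; lia.
have mE : (E.+1 <= m - M)%N by clear -hm; lia.
have hz : tailn m (iter m f z).
  apply/tailnP => i; rewrite -iterD addnC; split; first exact: hS.
  by apply: hMr; apply: leq_trans Mm (leq_addl _ _).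
have h4 := hJ m Mm.
have big : far_const a (Re (iter m f z) + a) <= tower R k' - 1.
  apply: le_trans (hX m Mm) _.
    have := tower_mono R m1; rewrite towerS.
  set y := tower R _ in h4 *.
  have y6 : 6 <= y by apply: le_trans (tower_ge_nat R _); rewrite ler_nat.
  have h6 := exp_double_le h4 y6; have h7 := expR_ge1Dx y.
  clear -h6 h7 y6; move=> h8; lra.
have md : mid_const a < Re (iter m f z).
  by have := hM m Mm; rewrite ge_max => /andP[_]; lra.
have rk : r < tower R k'.+1.
  by apply: lt_le_trans hQ _; apply: le_trans (tower_ge_nat R _); rewrite ler_nat.
have [p [ep pS [i hi] [i0 hi0]]] := turn_point d1 dk hz big md rk.
have pm : S (t m) p by have := pS 0%N; rewrite addn0.
have [e1 z'S] := pullbackP ha At pm; set z' := pullback a t m p in e1 z'S.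
have z'S' j : S (t j) (iter j f z').
  have [jm|jm] := leqP j m; first exact: z'S.
  by rewrite -(subnK (ltnW jm)) iterD e1 addnC; exact: pS.
exists z'; split.
- have z'M : pullback a t M (iter M f z') = z' by apply: pullbackK => // j _; exact: z'S'.
  rewrite -z'M; apply: he.
  have h16 : absC (iter m f z - iter m f z') <= 16.
    apply: le_trans (absC_le_add _) _; rewrite ReB ImB e1 ep subrr normr0 add0r.
    apply: le_trans (ler_normB _ _) _; have := piece_Im_lt8 (hS m); have := piece_Im_lt8 pm; lra.
  have := backward_close (fun i _ => hS i) (fun i _ => z'S' i) hMr h16 (j := (m - M)%N).
  rewrite subnKC// subKn// => /(_ (leqnn _)) hc; rewrite absC_distC.
  have p2 : (E.+1)%:R <= 2 ^+ (m - M) :> R.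
    rewrite -natrX ler_nat; apply: leq_trans mE _; exact: ltnW (ltn_expl _ (ltnSn 1)).
  have n0 := absC_ge0 (iter M f z - iter M f z').
  move: hE; rewrite ltr_pdivrMr// => hE.
  rewrite ltNge; apply/negP => hn; 
  have := le_trans (ler_pM (ler0n R _) (ltW e0) p2 hn) hc.
  by rewrite leNgt hE.
- apply/(hairE ha _ _ At); split => //; exists (m + i0)%N => j hj.
  have jm : (m <= j)%N := leq_trans (leq_addr _ _) hj.
  by rewrite -(subnK jm) iterD e1; apply: hi0; rewrite leq_subRL.
- move=> /(hair_pieceE ha _ _ _ At)[_ h].
  have Nm : (N <= i + m)%N by clear -hm; lia.
  by have := h (i + m)%N Nm; rewrite iterD e1; lra.
Qed.

End Density.

(** * The sequences *)

Section Words.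
Variables (tau : seq bool) (k : nat -> nat).
Local Notation word := (Bword tau k).

Lemma BwordS m : word m.+1 = word m ++ [:: true; true] ++ nseq (k m.+1) false.
Proof.
have iS : iota 1 m.+1 = iota 1 m ++ [:: m.+1] by rewrite -[X in iota 1 X = _]addn1 iotaD.
by rewrite /Bword iS map_cat flatten_cat /= cats0 catA.
Qed.

Lemma size_BwordS m : size (word m.+1) = (size (word m) + 2 + k m.+1)%N.
Proof. by rewrite BwordS !size_cat size_nseq addnA. Qed.

Lemma size_Bword_ge m : (m.*2 <= size (word m))%N.
Proof. elim: m => // m IH; rewrite size_BwordS; lia. Qed.

Lemma nth_Bword m l i : (i < size (word m))%N ->
  nth false (word (m + l)) i = nth false (word m) i.
Proof.
move=> im; elim: l => [|l IH]; first by rewrite addn0.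
suff ml : (i < size (word (m + l)))%N by rewrite addnS BwordS nth_cat ml.
apply: (leq_trans im); elim: (l) => [|l' IH']; first by rewrite addn0.
by apply: (leq_trans IH'); rewrite addnS size_BwordS -addnA leq_addr.
Qed.

(** The words extend each other, so any word that is long enough determines the entry. *)
Lemma BsequenceE m i : (i < size (word m))%N -> Bsequence tau k i = nth false (word m) i.
Proof.
move=> im; have i1 : (i < size (word i.+1))%N.
  by apply: leq_trans (size_Bword_ge _); lia.
by rewrite /Bsequence -(nth_Bword m i1) -(nth_Bword i.+1 im) addnC.
Qed.

Lemma Bsequence_block m : Bsequence tau k (size (word m)).+1 /\
  (forall i, (i < k m.+1)%N -> ~~ Bsequence tau k ((size (word m)).+2 + i)).
Proof.
have h i : (i < 2 + k m.+1)%N -> Bsequence tau k (size (word m) + i) =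
    nth false ([:: true; true] ++ nseq (k m.+1) false) i.
  move=> hi; rewrite (@BsequenceE m.+1) ?size_BwordS -?addnA ?ltn_add2l//.
  by rewrite BwordS nth_cat ltnNge leq_addr/= addKn.
split; first by rewrite -addn1 h.
move=> i ik; have := h i.+2; rewrite !ltnS !addnS /= => /(_ ik).
by rewrite !addSn => ->; rewrite nth_nseq ik.
Qed.

End Words.

(** Growth by the factor 4 makes each block longer than everything before it by an
    unbounded amount. *)
Definition zero_runs n j := (4 ^ j * (n + 20))%N.

Lemma size_Bword_zero_runs (tau : seq bool) m :
  (size (Bword tau (zero_runs (size tau)) m) + m + 10 <= zero_runs (size tau) m.+1)%N.
Proof.
set n := size tau; elim: m => [|m IH].
  by rewrite /Bword cats0 -/n /zero_runs expn1; lia.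
rewrite size_BwordS; have e : zero_runs n m.+2 = (4 * zero_runs n m.+1)%N.
  by rewrite /zero_runs expnS mulnA.
rewrite e; lia.
Qed.

Lemma long_zero_runs_Bsequence (tau : seq bool) :
  long_zero_runs (Bsequence tau (zero_runs (size tau))).
Proof.
move=> J; have [h1 h2] := Bsequence_block tau (zero_runs (size tau)) J.
exists (size (Bword tau (zero_runs (size tau)) J)), (zero_runs (size tau) J.+1).
split => //; last exact: size_Bword_zero_runs.
by apply: leq_trans (size_Bword_ge _ _ _); lia.
Qed.

Lemma long_zero_runs_often_one t : long_zero_runs (erase t) -> often_one t.
Proof. by move=> h n; have [m [_ [nJ _ h1 _]]] := h n; exists m.+1 => //; exact: leqW. Qed.

(** The half-plane of a symbol; it changes after a digit 1 and is kept after a digit 0,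
    so an A-sequence is determined by its digits and by the half-plane of its first
    entry. *)
Definition upper (s : Asymbol) : bool := match s with A02 | A12 => true | _ => false end.

Definition symbol (d up : bool) : Asymbol :=
  match d, up with
  | false, false => A01 | false, true => A02 | true, false => A11 | true, true => A12
  end.

Lemma symbolK s : symbol (digit s) (upper s) = s. Proof. by case: s. Qed.
Lemma digit_symbol d up : digit (symbol d up) = d. Proof. by case: d; case: up. Qed.
Lemma upper_symbol d up : upper (symbol d up) = up. Proof. by case: d; case: up. Qed.

Lemma transition_upper s s' : transition s s' <-> upper s' = digit s (+) upper s.
Proof. by case: s; case: s'. Qed.

Section Lifts.
Variable b : nat -> bool.

Fixpoint side_seq (up : bool) n : bool := if n is n'.+1 then b n' (+) side_seq up n' else up.

Definition lift_seq up n := symbol (b n) (side_seq up n).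

Lemma lift_seqP (t : nat -> Asymbol) :
  Asequence t /\ erase t = b <-> t = lift_seq (upper (t 0%N)).
Proof.
split=> [[At eb]|->].
  have hu n : upper (t n) = side_seq (upper (t 0%N)) n.
    elim: n => [//|n IH] /=; rewrite -IH -eb /erase.
    exact: (transition_upper _ _).1 (At n).
  by apply/funext => n; rewrite /lift_seq -hu -eb /erase symbolK.
split.
  by move=> n; apply/transition_upper; rewrite /lift_seq !upper_symbol digit_symbol.
by apply/funext => n; rewrite /erase digit_symbol.
Qed.

Lemma lift_seq0 up : upper (lift_seq up 0%N) = up. Proof. exact: upper_symbol. Qed.

Lemma lift_seqs : [set t | Asequence t /\ erase t = b] = [set lift_seq false; lift_seq true].
Proof.
apply/seteqP; split=> [t /= /lift_seqP ->|t [] -> /=].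
- by case: (upper _); [right|left].
- by apply/lift_seqP; rewrite lift_seq0.
- by apply/lift_seqP; rewrite lift_seq0.
Qed.

End Lifts.

(** The two hairs lie in different half-planes. *)
Lemma hair_neq (R : realType) (a r : R) t t' : 3 <= a -> 100 * 300 <= r ->
  Asequence t -> often_one t -> Asequence t' -> upper (t 0%N) != upper (t' 0%N) ->
  hair a r t <> hair a r t'.
Proof.
move=> ha hr At Ot At' u eqh.
have hz : hair a r t (hair_pt ha hr At Ot 0 r).
  by exists 0%N => //; rewrite (hair_pt_piece ha hr At Ot); exists r => //=; rewrite in_itv/= lexx.
have /(hairE ha _ _ At)[/(_ 0%N) /= s1 _] := hz.
have := hz; rewrite eqh => /(hairE ha _ _ At')[/(_ 0%N) /= s2 _].
have {}s1 := piece_sgn s1; have {}s2 := piece_sgn s2.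
by case: (t 0%N) u s1; case: (t' 0%N) s2 => //= h1 _ h2; lra.
Qed.

Lemma self_limiting_hair (R : realType) (a r : R) t : 3 <= a -> escape_radius a <= r ->
  Asequence t -> long_zero_runs (erase t) -> self_limiting_non_landing_hair a r t.
Proof.
move=> ha hR At blocks; have hr' := escape_radius_ge ha hR.
have Ot := long_zero_runs_often_one blocks.
exists (hair_map ha hr' At Ot); have hh := hair_map_ray ha hr' At Ot.
have [|h1 h2] := self_limiting_of_dense_ends hh (hair_map_piece ha hr' At Ot).
  exact: dense_ends.
by split.
Qed.

Theorem theorem3p6 (R : realType) (a : R) (ha : 3 <= a) :
  exists R0 : R, forall (n : nat) (tau : n.-tuple bool),
    exists2 k : nat -> nat,
      forall j, (1 <= j)%N -> (k j < k j.+1)%N &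
      exists t1 t2 : nat -> Asymbol,
        [/\ t1 <> t2,
            [set t | Asequence t /\ erase t = Bsequence tau k] = [set t1; t2] &
            forall r : R, R0 <= r ->
              [/\ hair a r t1 <> hair a r t2,
                  self_limiting_non_landing_hair a r t1 &
                  self_limiting_non_landing_hair a r t2]].
Proof.
exists (escape_radius a) => n tau; exists (zero_runs (size tau)).
  by move=> j _; rewrite /zero_runs expnS; have := expn_gt0 4 j; lia.
set b := Bsequence tau _.
have lift up : Asequence (lift_seq b up) /\ erase (lift_seq b up) = b.
  by apply/lift_seqP; rewrite lift_seq0.
have runs up : long_zero_runs (erase (lift_seq b up)).
  by have [_ ->] := lift up; exact: long_zero_runs_Bsequence.
exists (lift_seq b false), (lift_seq b true); split.
- by move=> /(congr1 (fun t => upper (t 0%N))); rewrite !lift_seq0.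
- exact: lift_seqs.
- have [Af _] := lift false; have [At _] := lift true.
  move=> r hR; split; [|exact: self_limiting_hair|exact: self_limiting_hair].
  apply: hair_neq => //; [exact: (escape_radius_ge ha hR)| |by rewrite !lift_seq0].
  exact: long_zero_runs_often_one (runs false).
Qed.
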